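(* Let $X$ and $U$ be Banach spaces, let $A$ be the generator of a strongly continuous semigroup $(T(t))_{t\ge 0}$ on $X$, and let $\tau>0$. Suppose that $B\in\mathcal{L}(U,X_{-1})$, $F\in\mathcal{L}(X,U)$, and $D_0\in\mathcal{S}^{\rm DS}_{t_0}$ for some $t_0>0$. Let $\omega\ge 0$. If the nominal sampled-data system $$\dot x(t)=(A+D)x(t)+Bu(t),\ t\ge 0,\quad x(0)=x^0\in X;\qquad u(t)=Fx(k\tau),\ k\tau\le t<(k+1)\tau,\ k=0,1,2,\dots$$ with $D=0$ is exponentially stable with decay rate greater than $\omega$, then there exists $c^*>0$ such that for every $c\in[0,c^*]$ the perturbed sampled-data system (the same system with $D=cD_0$) is also exponentially stable with decay rate greater than $\omega$.
   Context: $\mathcal{L}(Y,Z)$ denotes the bounded linear operators between Banach spaces $Y$ and $Z$, $\mathcal{L}(Y)=\mathcal{L}(Y,Y)$, $\varrho(A)$ is the resolvent set of $A$, and $\|\cdot\|$ is the norm of $X$. Extrapolation space. $X_{-1}$ is the completion of $X$ with respect to the norm $\|x\|_{-1}^A=\|(\lambda I-A)^{-1}x\|$ for some $\lambda\in\varrho(A)$ (different $\lambda$ give equivalent norms). $T_{-1}(t)$ is the continuous extension of $T(t)$ to $X_{-1}$; $(T_{-1}(t))_{t\ge0}$ is a strongly continuous semigroup on $X_{-1}$, whose generator $A_{-1}$ has domain $X$ and is the unique continuous extension of $A$ to $\mathcal{L}(X,X_{-1})$. Desch-Schappacher perturbations. For $t_0>0$, $\mathcal{X}_{t_0}$ is the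 Banach space of all functions $Q:[0,t_0]\to\mathcal{L}(X)$ that are continuous for the strong operator topology, with norm $\|Q\|_\infty=\sup_{t\in[0,t_0]}\|Q(t)\|_{\mathcal{L}(X)}$. For $\Psi\in\mathcal{L}(X,X_{-1})$ define the abstract Volterra operator $(V_\Psi Q)(t)x=\int_0^t T_{-1}(t-s)\Psi Q(s)x\,\mathrm{d}s$ for $x\in X$, $t\in[0,t_0]$, $Q\in\mathcal{X}_{t_0}$ (integral converging in $X_{-1}$). Then $$\mathcal{S}^{\rm DS}_{t_0}=\{\Psi\in\mathcal{L}(X,X_{-1}): V_\Psi\in\mathcal{L}(\mathcal{X}_{t_0}),\ \|V_\Psi\|_{\mathcal{L}(\mathcal{X}_{t_0})}<1\}.$$ If $D_0\in\mathcal{S}^{\rm DS}_{t_0}$ and $0\le c\le1$, then $cD_0\in\mathcal{S}^{\rm DS}_{t_0}$. Perturbed semigroup (known fact). If $D\in\mathcal{S}^{\rm DS}_{t_0}$, the operator $A_Dx=(A_{-1}+D)x$ with domain $\{x\in X:(A_{-1}+D)x\in X\}$ generates a strongly continuous semigroup $(T_D(t))_{t\ge0}$ on $X$. The extrapolation space associated with $A_D$ is isomorphic to, and is identified with, $X_{-1}$ (for all sufficiently large $\lambda>0$ the norms $\|(\lambda I-A)^{-1}x\|$ and $\|(\lambda I-A_D)^{-1}x\|$ on $X$ are equivalent). $(T_D)_{-1}(t)$ denotes the continuous extension of $T_D(t)$ to $X_{-1}$. Solution. For $B\in\mathcal{L}(U,X_{-1})$ put $S_D(t)u=\int_0^t (T_D)_{-1}(s)Bu\,\mathrm{d}s$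 for $u\in U$, $t\ge0$; it is known that $S_D(t)\in\mathcal{L}(U,X)$. The solution of the sampled-data system with initial state $x^0\in X$ is the function $x:[0,\infty)\to X$ defined recursively by $x(0)=x^0$ and $x(k\tau+t)=T_D(t)x(k\tau)+S_D(t)Fx(k\tau)$ for $t\in(0,\tau]$, $k=0,1,2,\dots$. Exponential stability. The sampled-data system with $D\in\mathcal{S}^{\rm DS}_{t_0}$ for some $t_0>0$ is exponentially stable with decay rate greater than $\omega\ge0$ if there exist constants $M\ge1$ and $\widetilde\omega>\omega$ such that its solution satisfies $\|x(t)\|\le Me^{-\widetilde\omega t}\|x^0\|$ for all $x^0\in X$ and all $t\ge0$. *)

(* Defs.v *)
From Stdlib Require Import Reals.
From Coquelicot Require Export Coquelicot.

Set Implicit Arguments.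
Open Scope R_scope.

(* Banach spaces are complete normed modules over [scalars k]; letting [k] range
   over both values covers real and complex Banach spaces. *)
Inductive scalar_kind : Set := RealScalars | ComplexScalars.

Definition scalars (k : scalar_kind) : AbsRing :=
  match k with RealScalars => R_AbsRing | ComplexScalars => C_AbsRing end.

Definition ofR (k : scalar_kind) : R -> scalars k :=
  match k as k0 return R -> scalars k0 with
  | RealScalars => fun r => r
  | ComplexScalars => RtoC
  end.

Lemma ofR_mult (k : scalar_kind) (x y : R) :
  mult (ofR k x) (ofR k y) = ofR k (mult x y).
Proof. destruct k; [reflexivity | symmetry; apply RtoC_mult]. Qed.

Lemma ofR_plus (k : scalar_kind) (x y : R) :
  ofR k (plus x y) = plus (ofR k x) (ofR k y).
Proof. destruct k; [reflexivity | apply RtoC_plus]. Qed.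

Lemma ofR_one (k : scalar_kind) : ofR k one = one.
Proof. destruct k; reflexivity. Qed.

Lemma abs_ofR (k : scalar_kind) (x : R) : abs (ofR k x) = abs x.
Proof. destruct k; [reflexivity | apply Cmod_R]. Qed.

(* Restriction of scalars to the reals, keeping the norm and the uniform
   structure: Coquelicot's Riemann integral is only available over [R]. *)
Section RestrictScalars.
Context {k : scalar_kind} (V : NormedModule (scalars k)).

Definition rscal (r : R) (x : V) : V := scal (ofR k r) x.

Lemma rscal_assoc (x y : R) (u : V) : rscal x (rscal y u) = rscal (mult x y) u.
Proof. unfold rscal; rewrite scal_assoc, ofR_mult; reflexivity. Qed.

Lemma rscal_one (u : V) : rscal one u = u.
Proof. unfold rscal; rewrite ofR_one; apply scal_one. Qed.

Lemma rscal_distr_l (x : R) (u v : V) :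
  rscal x (plus u v) = plus (rscal x u) (rscal x v).
Proof. apply @scal_distr_l. Qed.

Lemma rscal_distr_r (x y : R) (u : V) :
  rscal (plus x y) u = plus (rscal x u) (rscal y u).
Proof. unfold rscal; rewrite ofR_plus; apply @scal_distr_r. Qed.

Definition restrict_ModuleSpace_mixin : ModuleSpace.mixin_of R_AbsRing V :=
  ModuleSpace.Mixin R_AbsRing V rscal
    rscal_assoc rscal_one rscal_distr_l rscal_distr_r.

Definition restrict_Aux : NormedModuleAux R_AbsRing :=
  NormedModuleAux.Pack R_AbsRing V
    (NormedModuleAux.Class R_AbsRing V
       (ModuleSpace.Class R_AbsRing V _ restrict_ModuleSpace_mixin)
       (UniformSpace.class V))
    V.

Lemma norm_rscal (l : R) (x : V) : norm (rscal l x) <= abs l * norm x.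
Proof.
unfold rscal; rewrite <- (abs_ofR k l); apply @norm_scal.
Qed.

Definition restrict_NormedModule_mixin :
    NormedModule.mixin_of R_AbsRing restrict_Aux :=
  NormedModule.Mixin R_AbsRing restrict_Aux (@norm _ V) (@norm_factor _ V)
    (@norm_triangle _ V) norm_rscal
    (@norm_compat1 _ V) (@norm_compat2 _ V) (@norm_eq_zero _ V).

Definition restrict_scalars : NormedModule R_AbsRing :=
  NormedModule.Pack R_AbsRing V
    (NormedModule.Class R_AbsRing V
       (NormedModuleAux.class R_AbsRing restrict_Aux)
       restrict_NormedModule_mixin)
    V.
End RestrictScalars.

(* [has_integral f a b v]: the V-valued Riemann integral of f over [a,b]
   converges in the norm of V, with value v. *)
Definition has_integral {k : scalar_kind} {V : NormedModule (scalars k)}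
    (f : R -> V) (a b : R) (v : V) : Prop :=
  @is_RInt (restrict_scalars V) f a b v.

(* Coquelicot's [is_linear] includes boundedness, so it is membership in the
   space of bounded linear operators.  Families of operators indexed by time are
   functions on [R], of which only the values at nonnegative times matter. *)

Definition C0_semigroup {k : scalar_kind} {V : NormedModule (scalars k)}
    (T : R -> V -> V) : Prop :=
  (forall t, 0 <= t -> is_linear (T t)) /\
  (forall x, T 0 x = x) /\
  (forall s t x, 0 <= s -> 0 <= t -> T (s + t) x = T s (T t x)) /\
  (forall x, continuous_on (fun t : R => 0 <= t) (fun t => T t x)).

(* Unbounded operators are represented by their graphs: [A x y] means that x is
   in the domain of A and A x = y. *)

Definition generator {k : scalar_kind} {V : NormedModule (scalars k)}
    (T : R -> V -> V) (x y : V) : Prop :=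
  filterlim (fun h : R => scal (ofR k (/ h)) (minus (T h x) x))
    (at_right 0) (locally y).

Definition generates {k : scalar_kind} {V : NormedModule (scalars k)}
    (A : V -> V -> Prop) (T : R -> V -> V) : Prop :=
  C0_semigroup T /\ forall x y, A x y <-> generator T x y.

(* Rl is the bounded inverse of lambda I - A; in particular lambda belongs to
   the resolvent set of A. *)
Definition is_resolvent {k : scalar_kind} {V : NormedModule (scalars k)}
    (A : V -> V -> Prop) (lambda : scalars k) (Rl : V -> V) : Prop :=
  is_linear Rl /\
  (forall y, exists z, A (Rl y) z /\ minus (scal lambda (Rl y)) z = y) /\
  (forall x z, A x z -> Rl (minus (scal lambda x) z) = x).

(* Xm1, with the embedding j, is a completion of X for the norm
   x |-> norm (Rl x), where Rl = (lambda I - A)^-1 for some lambda in the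
   resolvent set of A. *)
Definition is_extrapolation_space {k : scalar_kind}
    {X Xm1 : CompleteNormedModule (scalars k)}
    (A : X -> X -> Prop) (j : X -> Xm1) : Prop :=
  is_linear j /\
  (exists (lambda : scalars k) (Rl : X -> X),
     is_resolvent A lambda Rl /\ forall x, norm (j x) = norm (Rl x)) /\
  (forall (y : Xm1) (eps : R), 0 < eps ->
     exists x : X, norm (minus y (j x)) < eps).

(* For every t >= 0, Tm1 t is the continuous extension of T t to Xm1 (it is
   determined by T since j has dense range). *)
Definition is_extension {k : scalar_kind}
    {X Xm1 : CompleteNormedModule (scalars k)}
    (j : X -> Xm1) (T : R -> X -> X) (Tm1 : R -> Xm1 -> Xm1) : Prop :=
  forall t, 0 <= t ->
    is_linear (Tm1 t) /\ forall x, Tm1 t (j x) = j (T t x).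

(* Norms are valued in [Rbar], so that an unbounded map has norm [p_infty]. *)
Definition op_norm {k : scalar_kind} {Y Z : NormedModule (scalars k)}
    (L : Y -> Z) : Rbar :=
  Lub_Rbar (fun r => exists y, norm y <= 1 /\ r = norm (L y)).

(* Membership in the space of strongly continuous functions
   [0,t0] -> L(X); the values of Q outside [0,t0] are irrelevant. *)
Definition strongly_continuous {k : scalar_kind}
    {X : NormedModule (scalars k)} (t0 : R) (Q : R -> X -> X) : Prop :=
  (forall t, 0 <= t <= t0 -> is_linear (Q t)) /\
  (forall x, continuous_on (fun t : R => 0 <= t <= t0) (fun t => Q t x)).

Definition sup_norm {k : scalar_kind} {X : NormedModule (scalars k)}
    (t0 : R) (Q : R -> X -> X) : Rbar :=
  Rbar_lub (fun r => exists t, 0 <= t <= t0 /\ r = op_norm (Q t)).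

(* P = V_Psi Q on [0,t0]: the integral converges in Xm1 and its value is the
   element P t x of X. *)
Definition is_volterra {k : scalar_kind}
    {X Xm1 : CompleteNormedModule (scalars k)}
    (j : X -> Xm1) (Tm1 : R -> Xm1 -> Xm1) (t0 : R) (Psi : X -> Xm1)
    (Q P : R -> X -> X) : Prop :=
  forall t x, 0 <= t <= t0 ->
    has_integral (fun s => Tm1 (t - s) (Psi (Q s x))) 0 t (j (P t x)).

Definition volterra_norm {k : scalar_kind}
    {X Xm1 : CompleteNormedModule (scalars k)}
    (j : X -> Xm1) (Tm1 : R -> Xm1 -> Xm1) (t0 : R) (Psi : X -> Xm1) : Rbar :=
  Rbar_lub (fun r => exists Q P : R -> X -> X,
    strongly_continuous t0 Q /\ Rbar_le (sup_norm t0 Q) 1 /\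
    is_volterra j Tm1 t0 Psi Q P /\ r = sup_norm t0 P).

(* Linearity of V_Psi is automatic, and its boundedness is contained in the
   bound on its norm. *)
Definition desch_schappacher {k : scalar_kind}
    {X Xm1 : CompleteNormedModule (scalars k)}
    (j : X -> Xm1) (Tm1 : R -> Xm1 -> Xm1) (t0 : R) (Psi : X -> Xm1) : Prop :=
  is_linear Psi /\
  (forall Q, strongly_continuous t0 Q ->
     exists P, strongly_continuous t0 P /\ is_volterra j Tm1 t0 Psi Q P) /\
  Rbar_lt (volterra_norm j Tm1 t0 Psi) 1.

(* A_D, the part of A_{-1} + D in X, where A_{-1} is the generator of Tm1. *)
Definition perturbed_generator {k : scalar_kind}
    {X Xm1 : CompleteNormedModule (scalars k)}
    (j : X -> Xm1) (Tm1 : R -> Xm1 -> Xm1) (D : X -> Xm1) (x y : X) : Prop :=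
  exists w : Xm1, generator Tm1 (j x) w /\ plus w (D x) = j y.

Definition is_input_map {k : scalar_kind}
    {X Xm1 U : CompleteNormedModule (scalars k)}
    (j : X -> Xm1) (TDm1 : R -> Xm1 -> Xm1) (B : U -> Xm1)
    (SD : R -> U -> X) : Prop :=
  forall t u, 0 <= t -> has_integral (fun s => TDm1 s (B u)) 0 t (j (SD t u)).

Definition is_solution {k : scalar_kind}
    {X U : CompleteNormedModule (scalars k)}
    (TD : R -> X -> X) (SD : R -> U -> X) (F : X -> U) (tau : R)
    (x0 : X) (x : R -> X) : Prop :=
  x 0 = x0 /\
  forall (n : nat) (t : R), 0 < t <= tau ->
    x (INR n * tau + t)
      = plus (TD t (x (INR n * tau))) (SD t (F (x (INR n * tau)))).

(* TD, TDm1 and SD are the objects T_D, (T_D)_{-1} and S_D attached to D: they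
   exist for every Desch-Schappacher perturbation D, and they are uniquely
   determined at nonnegative times by the properties listed here. *)
Definition exponentially_stable {k : scalar_kind}
    {X Xm1 U : CompleteNormedModule (scalars k)}
    (j : X -> Xm1) (Tm1 : R -> Xm1 -> Xm1)
    (B : U -> Xm1) (F : X -> U) (tau : R) (D : X -> Xm1) (omega : R) : Prop :=
  (exists t0, 0 < t0 /\ desch_schappacher j Tm1 t0 D) /\
  exists (TD : R -> X -> X) (TDm1 : R -> Xm1 -> Xm1) (SD : R -> U -> X),
    generates (perturbed_generator j Tm1 D) TD /\
    is_extension j TD TDm1 /\
    is_input_map j TDm1 B SD /\
    exists M omega', 1 <= M /\ omega < omega' /\
      forall (x0 : X) (x : R -> X), is_solution TD SD F tau x0 x ->
        forall t, 0 <= t -> norm (x t) <= M * exp (- omega' * t) * norm x0.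

(* Main.v *)
Require Import Defs.
From Stdlib Require Import Reals Lra Lia List Classical ClassicalChoice.
From Coquelicot Require Import Coquelicot.
Open Scope R_scope.

(** The state at the sampling times is governed by the powers of the bounded
    operator Delta_c = T_c(tau) + S_c(tau) F, where T_c is the semigroup for
    D = c D0 and S_c its input map.  Exponential stability with rate above omega
    says that the powers of Delta_0 decay like M a^n with a < exp (- omega tau).
    An operator eps-close to Delta_0 in norm has powers bounded by
    M (a + M eps)^n ([perturbed_iterates]), and between sampling times the solution
    is controlled by its value at the last one ([solution_decay]).  So the theorem
    reduces to norm estimates: Delta_c - Delta_0 is of order c
    ([perturbed_objects]).  Since T_c, its extrapolation and S_c have to be
    exhibited, the proof contains a generation theorem for small
    Desch-Schappacher perturbations.

    - The semigroup.  For small c the Volterra equation Q = T + c V Q is solved on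
      [0, t0] by iteration ([volterra_fixed_point]); the solution is within O(c) of
      T in operator norm.  The homogeneous equation has only the zero solution,
      hence the solution obeys the semigroup law on [0, t0] ([local_semigroup]) and
      extends to all times by powers ([extend_local_semigroup]).

    - The generator.  Multiplying the resolvent equation (l - A_{-1}) x = c D0 x + y
      by exp (- l s) T_{-1}(s) and integrating over [0, t0] gives
      x = exp (- l t0) T(t0) x + c p x + W y, where p is a contraction, being the
      Volterra operator applied to exp (- l (t0 - s)) I, and norm (W y) is at most a
      constant times the norm of y in the extrapolation space
      ([perturbed_resolvent_identity]).  For large l the first two terms contract.
      This one identity shows that l - A_D is injective, that its inverse R_c is
      bounded from the extrapolation space to X, and that R_c - R_0 is of order c
      ([perturbed_resolvent_bound]).  The generator of T_c is contained in A_D, and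
      l minus the generator is onto ([generator_range]), so they are equal
      ([perturbed_generates]).

    - The extension and the input map.  The norm of R_c y is equivalent to that of y
      in the extrapolation space and R_c commutes with T_c, so T_c extends there
      ([perturbed_extrapolation_bound]).  With x = R_c B u, the integral of the
      extended semigroup applied to B u is
      l times the integral of T_c x, minus T_c(t) x, plus x
      ([smoothing_integral]); this is an element of X and depends on c through T_c
      and R_c only, which gives the estimate for S_c - S_0.

    - The nominal system.  Its semigroup, extension and input map are those at c = 0,
      because a semigroup is determined by its generator
      ([generator_determines]). *)

(** * Vector identities *)

(* The structures are explicit so that an operation on a Banach space and the same
   operation on its underlying normed module are one term for rewriting. *)
Local Notation "x [+] y" := (@plus (NormedModule.AbelianGroup _ _) x y)
  (at level 50, left associativity).
Local Notation "x [-] y" := (@minus (NormedModule.AbelianGroup _ _) x y)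
  (at level 50, left associativity).
Local Notation "[0]" := (@zero (NormedModule.AbelianGroup _ _)).
Local Notation "a **: x" := (@scal _ (NormedModule.ModuleSpace _ _) a x)
  (at level 40, left associativity).
Local Notation "r *: x" := (ofR _ r **: x) (at level 40, left associativity).

Section RealScalars.
Context {k : scalar_kind} {V : NormedModule (scalars k)}.
Implicit Types (x y z : V) (r s : R).

Lemma rs_assoc r s x : r *: (s *: x) = (r * s) *: x.
Proof. exact (rscal_assoc V r s x). Qed.

Lemma rs_one x : 1 *: x = x.
Proof. exact (rscal_one V x). Qed.

Lemma rs_plus_r r x y : r *: (x [+] y) = r *: x [+] r *: y.
Proof. exact (rscal_distr_l V r x y). Qed.

Lemma rs_plus_l r s x : (r + s) *: x = r *: x [+] s *: x.
Proof. exact (rscal_distr_r V r s x). Qed.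

Lemma rs_zero_l x : 0 *: x = [0].
Proof. exact (@scal_zero_l R_AbsRing (restrict_scalars V) x). Qed.

Lemma rs_zero_r r : r *: ([0] : V) = [0].
Proof. exact (@scal_zero_r R_AbsRing (restrict_scalars V) r). Qed.

Lemma rs_opp x : (-1) *: x = opp x.
Proof.
exact (@scal_opp_one R_AbsRing (restrict_scalars V) x).
Qed.

(** The converse of the norm axiom is the axiom itself for the scalar / r. *)
Lemma norm_rs r x : norm (r *: x) = Rabs r * norm x.
Proof.
assert (le : forall r x, norm (r *: x) <= Rabs r * norm x)
  by (intros; apply (@norm_rscal k V)).
destruct (Req_dec r 0) as [-> | hr].
  rewrite rs_zero_l, Rabs_R0, Rmult_0_l; apply (@norm_zero _ V).
apply Rle_antisym; [apply le |].
assert (h := le (/ r) (r *: x)).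
rewrite rs_assoc, Rinv_l, rs_one, Rabs_inv in h by exact hr.
apply Rmult_le_reg_l with (/ Rabs r).
  apply Rinv_0_lt_compat, Rabs_pos_lt, hr.
rewrite <- Rmult_assoc, Rinv_l, Rmult_1_l by (apply Rabs_no_R0, hr).
exact h.
Qed.

(** Reflected vector expressions: an equality of vectors follows from identities
    between the real coefficients of its atoms, which [ring] or [field] proves.
    This is what the tactics [vring] and [vfield] below do. *)
Inductive vexp : Type :=
  | EVar (n : nat) | EZero | EPlus (a b : vexp) | EMinus (a b : vexp)
  | EOpp (a : vexp) | EScal (r : R) (a : vexp).

Fixpoint denote (env : list V) (e : vexp) : V :=
  match e with
  | EVar n => nth n env [0]
  | EZero => [0]
  | EPlus a b => denote env a [+] denote env b
  | EMinus a b => denote env a [-] denote env b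
  | EOpp a => opp (denote env a)
  | EScal r a => r *: denote env a
  end.

Fixpoint coef (i : nat) (e : vexp) : R :=
  match e with
  | EVar n => if Nat.eqb i n then 1 else 0
  | EZero => 0
  | EPlus a b => coef i a + coef i b
  | EMinus a b => coef i a - coef i b
  | EOpp a => - coef i a
  | EScal r a => r * coef i a
  end.

Fixpoint lincomb (env : list V) (f : nat -> R) : V :=
  match env with
  | nil => [0]
  | v :: l => f 0%nat *: v [+] lincomb l (fun i => f (S i))
  end.

Lemma lincomb_ext env f g :
  (forall i, (i < length env)%nat -> f i = g i) -> lincomb env f = lincomb env g.
Proof.
revert f g; induction env as [|v env IH]; intros f g h; simpl; [easy|].
rewrite (h 0%nat) by (simpl; lia).
rewrite (IH _ (fun i => g (S i))); [easy|].
intros i hi; apply h; simpl; lia.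
Qed.

Lemma lincomb_zero env : lincomb env (fun _ => 0) = [0].
Proof.
induction env as [|v env IH]; simpl; [easy|].
rewrite IH, rs_zero_l; apply plus_zero_l.
Qed.

Lemma lincomb_plus env f g :
  lincomb env (fun i => f i + g i) = lincomb env f [+] lincomb env g.
Proof.
revert f g; induction env as [|v env IH]; intros f g; simpl.
  symmetry; apply plus_zero_l.
rewrite IH, rs_plus_l, <- !plus_assoc; f_equal.
rewrite !plus_assoc; f_equal; apply plus_comm.
Qed.

Lemma lincomb_scal env r f :
  lincomb env (fun i => r * f i) = r *: lincomb env f.
Proof.
revert f; induction env as [|v env IH]; intros f; simpl.
  symmetry; apply rs_zero_r.
rewrite IH, rs_plus_r, rs_assoc; reflexivity.
Qed.

Lemma lincomb_var env n :
  lincomb env (fun i => if Nat.eqb i n then 1 else 0) = nth n env [0].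
Proof.
revert n; induction env as [|v env IH]; intros [|n]; simpl; try easy.
  rewrite rs_one, lincomb_zero; apply plus_zero_r.
rewrite rs_zero_l, plus_zero_l; apply IH.
Qed.

Lemma denote_lincomb env e : denote env e = lincomb env (fun i => coef i e).
Proof.
induction e; simpl.
- symmetry; apply lincomb_var.
- symmetry; apply lincomb_zero.
- rewrite IHe1, IHe2; symmetry; apply lincomb_plus.
- rewrite IHe1, IHe2; unfold minus; rewrite <- rs_opp, <- lincomb_scal,
    <- lincomb_plus.
  apply lincomb_ext; intros; ring.
- rewrite IHe, <- rs_opp, <- lincomb_scal; apply lincomb_ext; intros; ring.
- rewrite IHe; symmetry; apply lincomb_scal.
Qed.

Lemma denote_eq env e1 e2 :
  (forall i, (i < length env)%nat -> coef i e1 = coef i e2) ->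
  denote env e1 = denote env e2.
Proof. intros h; rewrite !denote_lincomb; apply lincomb_ext, h. Qed.

End RealScalars.

Ltac atom_in a l :=
  lazymatch l with
  | nil => constr:(false)
  | ?b :: ?l' =>
      match constr:(Set) with
      | _ => let _ := match constr:(Set) with _ => constr_eq a b end in
             constr:(true)
      | _ => atom_in a l'
      end
  end.

Ltac atoms_of e l :=
  lazymatch e with
  | plus ?a ?b => let l1 := atoms_of a l in atoms_of b l1
  | minus ?a ?b => let l1 := atoms_of a l in atoms_of b l1
  | opp ?a => atoms_of a l
  | scal (ofR _ _) ?a => atoms_of a l
  | zero => l
  | _ => lazymatch atom_in e l with true => l | false => constr:(e :: l) end
  end.

Ltac atom_index a l :=
  lazymatch l with
  | ?b :: ?l' =>
      match constr:(Set) with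
      | _ => let _ := match constr:(Set) with _ => constr_eq a b end in
             constr:(0%nat)
      | _ => let n := atom_index a l' in constr:(S n)
      end
  end.

Ltac reify e l :=
  lazymatch e with
  | plus ?a ?b => let u := reify a l in let v := reify b l in constr:(EPlus u v)
  | minus ?a ?b => let u := reify a l in let v := reify b l in constr:(EMinus u v)
  | opp ?a => let u := reify a l in constr:(EOpp u)
  | scal (ofR _ ?r) ?a => let u := reify a l in constr:(EScal r u)
  | zero => constr:(EZero)
  | _ => let n := atom_index e l in constr:(EVar n)
  end.

Ltac vreduce :=
  lazymatch goal with
  | |- @eq ?T ?a ?b =>
      let l0 := atoms_of a (@nil T) in
      let l := atoms_of b l0 in
      let u := reify a l in let v := reify b l in
      refine (@denote_eq _ _ l u v _);
      let i := fresh "i" in let hi := fresh "hi" in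
      intros i hi; cbn [length] in hi;
      repeat (destruct i as [|i]; [clear hi | try (exfalso; lia)]);
      cbn [coef Nat.eqb]
  end.

Ltac vring := vreduce; ring.
Ltac vfield := vreduce; field; try lra.

(** * Norms, bounded linear maps and completeness *)

Lemma half_pow_pos n : 0 < (/ 2) ^ n.
Proof. apply pow_lt; lra. Qed.

Lemma half_pow_small (C eps : R) : 0 < eps -> exists n, C * (/ 2) ^ n < eps.
Proof.
intros he.
destruct (pow_lt_1_zero (/ 2)) with (y := eps / (Rabs C + 1)) as [n hn].
- rewrite Rabs_pos_eq; lra.
- apply Rdiv_lt_0_compat; [easy | pose proof (Rabs_pos C); lra].
- exists n; specialize (hn n (le_n n)).
  rewrite Rabs_pos_eq in hn by (left; apply half_pow_pos).
  pose proof (Rabs_pos C); pose proof (half_pow_pos n); pose proof (Rle_abs C).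
  apply Rle_lt_trans with ((Rabs C + 1) * (/ 2) ^ n); [nra |].
  apply Rmult_lt_reg_l with (/ (Rabs C + 1)); [apply Rinv_0_lt_compat; lra |].
  rewrite <- Rmult_assoc, Rinv_l, Rmult_1_l by lra.
  unfold Rdiv in hn; lra.
Qed.

Lemma le_of_le_plus_eps (a b C : R) :
  (forall eps, 0 < eps -> a <= b + C * eps) -> a <= b.
Proof.
intros h; apply Rnot_lt_le; intros hab.
set (e := (a - b) / (2 * (Rabs C + 1))).
pose proof (Rabs_pos C); pose proof (Rle_abs C).
assert (he : 0 < e) by (apply Rdiv_lt_0_compat; lra).
specialize (h e he).
assert (heq : (Rabs C + 1) * e = (a - b) / 2) by (unfold e; field; lra).
nra.
Qed.

Section Norms.
Context {k : scalar_kind} {V : NormedModule (scalars k)}.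
Implicit Types (x y z : V).

Lemma scal_plus (a : scalars k) x y : a **: (x [+] y) = a **: x [+] a **: y.
Proof. apply (@scal_distr_l _ V). Qed.

Lemma scal_minus (a : scalars k) x y : a **: (x [-] y) = a **: x [-] a **: y.
Proof.
unfold minus; rewrite scal_plus; f_equal; apply (@scal_opp_r _ V).
Qed.

Lemma scal_zero (a : scalars k) : a **: ([0] : V) = [0].
Proof. apply (@scal_zero_r _ V). Qed.

Lemma norm_zero' : norm ([0] : V) = 0.
Proof. apply (@norm_zero _ V). Qed.

Lemma norm_nonneg x : 0 <= norm x.
Proof. apply (@norm_ge_0 _ V). Qed.

Lemma norm_plus_le x y : norm (x [+] y) <= norm x + norm y.
Proof. apply (@norm_triangle _ V). Qed.

Lemma norm_opp' x : norm (opp x) = norm x.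
Proof. apply (@norm_opp _ V). Qed.

Lemma norm_minus_le x y : norm (x [-] y) <= norm x + norm y.
Proof.
rewrite <- (norm_opp' y); apply norm_plus_le.
Qed.

Lemma norm_minus_sym x y : norm (x [-] y) = norm (y [-] x).
Proof. rewrite <- norm_opp'; f_equal; vring. Qed.

Lemma norm_minus_triangle x y z :
  norm (x [-] z) <= norm (x [-] y) + norm (y [-] z).
Proof.
replace (x [-] z) with ((x [-] y) [+] (y [-] z)) by vring; apply norm_plus_le.
Qed.

Lemma norm_le_minus x y : norm x <= norm (x [-] y) + norm y.
Proof.
replace x with ((x [-] y) [+] y) at 1 by vring; apply norm_plus_le.
Qed.

Lemma eq_of_norm_minus_le0 x y : norm (x [-] y) <= 0 -> x = y.
Proof.
intros h.
assert (h0 : x [-] y = [0]).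
  apply (@norm_eq_zero _ V), Rle_antisym; [exact h | apply norm_nonneg].
replace x with ((x [-] y) [+] y) by vring.
rewrite h0; vring.
Qed.

Lemma eq_of_norm_minus_small x y C :
  (forall eps, 0 < eps -> norm (x [-] y) <= C * eps) -> x = y.
Proof.
intros h; apply eq_of_norm_minus_le0, le_of_le_plus_eps with C.
intros e he; rewrite Rplus_0_l; auto.
Qed.

Lemma filterlim_iff_norm {S : Type} {F : (S -> Prop) -> Prop} {FF : Filter F}
    (f : S -> V) y :
  filterlim f F (locally y) <->
  forall eps, 0 < eps -> F (fun t => norm (f t [-] y) < eps).
Proof.
split.
- intros h eps he.
  exact (proj1 (filterlim_locally_ball_norm f y) h (mkposreal eps he)).
- intros h; apply filterlim_locally_ball_norm; intros eps.
  apply h, cond_pos.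
Qed.

End Norms.

Section Linear.
Context {k : scalar_kind} {V W : NormedModule (scalars k)} (L : V -> W).
Hypothesis hL : is_linear L.

Lemma lin_plus x y : L (x [+] y) = L x [+] L y.
Proof. apply (linear_plus _ hL). Qed.

Lemma lin_scal a x : L (a **: x) = a **: L x.
Proof. apply (linear_scal _ hL). Qed.

Lemma lin_zero : L [0] = [0].
Proof.
replace ([0] : V) with (0 *: ([0] : V)) by vring.
rewrite lin_scal; vring.
Qed.

Lemma lin_minus x y : L (x [-] y) = L x [-] L y.
Proof.
replace (x [-] y) with (x [+] (-1) *: y) by vring.
rewrite lin_plus, lin_scal; vring.
Qed.

Lemma lin_bound : exists C, 0 < C /\ forall x, norm (L x) <= C * norm x.
Proof. apply (linear_norm _ hL). Qed.

End Linear.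

Lemma is_linear_of_bound {k : scalar_kind} {V W : NormedModule (scalars k)}
    (L : V -> W) (C : R) :
  (forall x y : V, L (x [+] y) = L x [+] L y) ->
  (forall a x, L (a **: x) = a **: L x) ->
  (forall x, norm (L x) <= C * norm x) -> is_linear L.
Proof.
intros h1 h2 h3; split; [exact h1 | exact h2 |].
exists (Rabs C + 1); split; [pose proof (Rabs_pos C); lra |].
intros x; apply Rle_trans with (1 := h3 x).
pose proof (norm_nonneg x); pose proof (Rle_abs C); nra.
Qed.

Lemma scalars_comm {k : scalar_kind} (a b : scalars k) : mult a b = mult b a.
Proof. destruct k; [apply Rmult_comm | apply Cmult_comm]. Qed.

Lemma is_linear_compose {k : scalar_kind} {V W Z : NormedModule (scalars k)}
    (L : V -> W) (L' : W -> Z) :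
  is_linear L -> is_linear L' -> is_linear (fun x => L' (L x)).
Proof.
intros h h'.
destruct (lin_bound _ h) as [C [hC1 hC]], (lin_bound _ h') as [C' [hC1' hC']].
apply is_linear_of_bound with (C' * C).
- intros; rewrite (lin_plus _ h), (lin_plus _ h'); reflexivity.
- intros; rewrite (lin_scal _ h), (lin_scal _ h'); reflexivity.
- intros x; apply Rle_trans with (1 := hC' _).
  rewrite Rmult_assoc; apply Rmult_le_compat_l; [lra | apply hC].
Qed.

Lemma is_linear_scale {k : scalar_kind} {V : NormedModule (scalars k)}
    (a : scalars k) : is_linear (fun x : V => a **: x).
Proof. exact (is_linear_scal_r a scalars_comm). Qed.

Section LinearClosure.
Context {k : scalar_kind} {V W : NormedModule (scalars k)}.

Lemma is_linear_sum (L L' : V -> W) :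
  is_linear L -> is_linear L' -> is_linear (fun x => L x [+] L' x).
Proof.
intros h h'.
destruct (lin_bound _ h) as [C [hC1 hC]], (lin_bound _ h') as [C' [hC1' hC']].
apply is_linear_of_bound with (C + C').
- intros; rewrite (lin_plus _ h), (lin_plus _ h'); vring.
- intros; rewrite (lin_scal _ h), (lin_scal _ h').
  symmetry; apply scal_plus.
- intros x; apply Rle_trans with (1 := norm_plus_le _ _).
  specialize (hC x); specialize (hC' x); lra.
Qed.

Lemma is_linear_rs r (L : V -> W) :
  is_linear L -> is_linear (fun x => r *: L x).
Proof. intros h; apply (is_linear_compose L _ h (is_linear_scale (ofR k r))). Qed.

Lemma is_linear_minus (L L' : V -> W) :
  is_linear L -> is_linear L' -> is_linear (fun x => L x [-] L' x).
Proof.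
intros h h'.
assert (h1 := is_linear_sum _ _ h (is_linear_rs (-1) _ h')); cbv beta in h1.
destruct (lin_bound _ h1) as [C [hC1 hC]].
apply is_linear_of_bound with C.
- intros; rewrite (lin_plus _ h), (lin_plus _ h'); vring.
- intros; rewrite (lin_scal _ h), (lin_scal _ h').
  symmetry; apply scal_minus.
- intros x; replace (L x [-] L' x) with (L x [+] (-1) *: L' x) by vring.
  apply hC.
Qed.
End LinearClosure.

Lemma is_linear_id {k : scalar_kind} {V : NormedModule (scalars k)} :
  is_linear (fun x : V => x).
Proof. apply is_linear_of_bound with 1; intros; try reflexivity; lra. Qed.

Section Completeness.
Context {k : scalar_kind} {V : CompleteNormedModule (scalars k)}.

(** The form in which completeness is used throughout: it covers both a nested
    sequence of balls and a geometrically convergent sequence. *)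
Lemma nested_limit (x : nat -> V) (r : nat -> R) :
  (forall n, norm (x (S n) [-] x n) <= r n / 2) ->
  (forall n, r (S n) <= r n / 2) ->
  exists l : V, forall n, norm (l [-] x n) <= r n.
Proof.
intros hx hr.
assert (tail : forall m n, norm (x (m + n)%nat [-] x n) <= r n - r (m + n)%nat).
  induction m as [|m IH]; intros n; simpl.
    replace (x n [-] x n) with ([0] : V) by vring.
    rewrite norm_zero'; lra.
  apply Rle_trans with (1 := norm_minus_triangle _ (x (m + n)%nat) _).
  specialize (IH n); specialize (hx (m + n)%nat); specialize (hr (m + n)%nat).
  lra.
assert (rpos : forall n, 0 <= r n).
  intros n; specialize (hx n); pose proof (norm_nonneg (x (S n) [-] x n)); lra.
assert (tail' : forall m n, (n <= m)%nat -> norm (x m [-] x n) <= r n).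
  intros m n hmn; replace m with ((m - n) + n)%nat by lia.
  apply Rle_trans with (1 := tail _ _); specialize (rpos (m - n + n)%nat); lra.
assert (rpow : forall n, r n <= r 0%nat * (/ 2) ^ n).
  induction n as [|n IH]; [simpl; lra |].
  apply Rle_trans with (1 := hr n); simpl; lra.
destruct (proj1 (@filterlim_locally_cauchy nat V eventually _ x)) as [l hl].
  intros eps.
  destruct (half_pow_small (r 0%nat) (eps / 2)) as [N hN].
    pose proof (cond_pos eps); lra.
  exists (fun n => (N <= n)%nat); split; [exists N; auto |].
  intros u v hu hv; apply (@norm_compat1 _ V).
  apply Rle_lt_trans with (1 := norm_minus_triangle _ (x N) _).
  rewrite (norm_minus_sym (x N)).
  pose proof (tail' u N hu); pose proof (tail' v N hv); specialize (rpow N); lra.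
exists l; intros n.
apply le_of_le_plus_eps with 1; intros e he.
destruct (proj1 (filterlim_iff_norm x l) hl e he) as [N hN].
specialize (hN (max N n) (PeanoNat.Nat.le_max_l N n)).
apply Rle_trans with (1 := norm_minus_triangle _ (x (max N n)) _).
rewrite (norm_minus_sym l).
pose proof (tail' (max N n) n (PeanoNat.Nat.le_max_r N n)); lra.
Qed.

(** The Neumann series, summed as the limit of the iteration z := y + E z. *)
Lemma solve_contraction (E : V -> V) (y : V) :
  is_linear E -> (forall x, norm (E x) <= / 2 * norm x) ->
  exists z : V, z [-] E z = y.
Proof.
intros hE hb.
set (z := fix z n := match n with O => [0] | S n => y [+] E (z n) end).
destruct (nested_limit z (fun n => 2 * norm y * (/ 2) ^ n)) as [l hl].
- induction n as [|n IH].
    simpl; rewrite (lin_zero _ hE).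
    replace (y [+] [0] [-] [0]) with y by vring; lra.
  change (z (S (S n))) with (y [+] E (z (S n))).
  change (z (S n)) with (y [+] E (z n)) at 2.
  replace (y [+] E (z (S n)) [-] (y [+] E (z n))) with (E (z (S n) [-] z n))
    by (rewrite (lin_minus _ hE); vring).
  apply Rle_trans with (1 := hb _); simpl pow; lra.
- intros n; simpl; lra.
- exists l; apply eq_of_norm_minus_small with 2; intros e he.
  destruct (half_pow_small (2 * norm y) e he) as [n hn].
  replace (l [-] E l [-] y) with ((l [-] z (S n)) [-] E (l [-] z n))
    by (rewrite (lin_minus _ hE); simpl z; vring).
  apply Rle_trans with (1 := norm_minus_le _ _).
  pose proof (hb (l [-] z n)); pose proof (hl n); pose proof (hl (S n)) as h.
  simpl pow in h; pose proof (half_pow_pos n); lra.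
Qed.

(** For an unbounded family there would be nested closed balls on the n-th of
    which some member exceeds n, contradicting the bound at their common
    point. *)
Lemma uniform_boundedness {W : NormedModule (scalars k)}
    (Fam : (V -> W) -> Prop) :
  (forall L, Fam L -> is_linear L) ->
  (forall x, exists C, forall L, Fam L -> norm (L x) <= C) ->
  exists M, forall L x, Fam L -> norm (L x) <= M * norm x.
Proof.
intros hlin hpt; apply NNPP; intros hunb.
(* In every ball there is a smaller closed ball on which some member of the
   family is larger than n: of the two points x + xi and x - xi one is mapped
   to a vector at least as long as L xi. *)
assert (step : forall p : nat * (V * R), exists q : V * R,
  0 < snd (snd p) ->
  0 < snd q <= snd (snd p) / 2 /\
  norm (fst q [-] fst (snd p)) <= snd (snd p) / 2 /\
  exists L, Fam L /\
    forall z, norm (z [-] fst q) <= snd q -> INR (fst p) <= norm (L z)).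
{ intros [n [x r]]; simpl.
  destruct (Rlt_dec 0 r) as [hr | hr]; [| exists (x, r); intros; lra].
  set (M := 2 * (INR n + 1) / r).
  assert (hLx : exists L xi, Fam L /\ M * norm xi < norm (L xi)).
    apply NNPP; intros hn; apply hunb; exists M; intros L xi hL.
    apply Rnot_lt_le; intros hlt; apply hn; exists L, xi; auto.
  destruct hLx as [L [xi0 [hL hxi]]].
  assert (hl := hlin L hL).
  destruct (lin_bound _ hl) as [C [hC0 hC]].
  assert (hpos : 0 < norm xi0).
    destruct (norm_nonneg xi0) as [h | h]; [exact h |].
    specialize (hC xi0); rewrite <- h in *; lra.
  set (xi := (r / 2 / norm xi0) *: xi0).
  assert (hr2 : 0 < r / 2 / norm xi0) by (apply Rdiv_lt_0_compat; lra).
  assert (nxi : norm xi = r / 2).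
    unfold xi; rewrite norm_rs, Rabs_pos_eq by lra; field; lra.
  assert (big : INR n + 1 <= norm (L xi)).
    unfold xi; rewrite (lin_scal _ hl), norm_rs, Rabs_pos_eq by lra.
    replace (INR n + 1) with ((r / 2 / norm xi0) * (M * norm xi0))
      by (unfold M; field; lra).
    apply Rmult_le_compat_l; lra.
  assert (hx' : exists x', norm (x' [-] x) <= r / 2 /\ INR n + 1 <= norm (L x')).
    destruct (Rle_dec (INR n + 1) (norm (L (x [+] xi)))) as [h1 | h1].
      exists (x [+] xi); split; [| exact h1].
      replace (x [+] xi [-] x) with xi by vring; lra.
    exists (x [-] xi); split.
      rewrite norm_minus_sym; replace (x [-] (x [-] xi)) with xi by vring; lra.
    assert (h2 := norm_minus_le (L (x [+] xi)) (L (x [-] xi))).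
    rewrite <- (lin_minus _ hl) in h2.
    replace (x [+] xi [-] (x [-] xi)) with (2 *: xi) in h2 by vring.
    rewrite (lin_scal _ hl), norm_rs, Rabs_pos_eq in h2 by lra; lra.
  destruct hx' as [x' [hx1 hx2]].
  assert (hiC : 0 < / C) by (apply Rinv_0_lt_compat, hC0).
  exists (x', Rmin (r / 2) (/ C)); intros _; simpl; split; [split |].
  - apply Rmin_pos; lra.
  - apply Rmin_l.
  - split; [exact hx1 |]; exists L; split; [exact hL |]; intros z hz.
    assert (h3 := norm_le_minus (L x') (L z)).
    rewrite norm_minus_sym, <- (lin_minus _ hl) in h3.
    specialize (hC (z [-] x')).
    assert (hz' := Rle_trans _ _ _ hz (Rmin_r _ _)).
    assert (C * norm (z [-] x') <= C * / C) by (apply Rmult_le_compat_l; lra).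
    rewrite Rinv_r in H by lra; lra. }
destruct (choice _ step) as [f hf].
set (p := fix p n := match n with O => ([0] : V, 1) | S m => f (m, p m) end).
assert (ppos : forall n, 0 < snd (p n)).
  induction n as [|n IH]; [simpl; lra | simpl; apply (hf (n, p n)), IH].
destruct (nested_limit (fun n => fst (p n)) (fun n => snd (p n))) as [z hz].
- intros n; apply (hf (n, p n)), ppos.
- intros n; apply (hf (n, p n)), ppos.
- destruct (hpt z) as [C hC].
  destruct (INR_unbounded C) as [n hn].
  destruct (hf (n, p n) (ppos n)) as [_ [_ [L [hL hbig]]]].
  specialize (hbig z (hz (S n))); specialize (hC L hL); simpl in hbig; lra.
Qed.

End Completeness.

Section DenseExtension.
Context {k : scalar_kind} {V W : NormedModule (scalars k)}
  {Z : CompleteNormedModule (scalars k)}.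
Variables (j : V -> W) (hj : is_linear j).
Hypothesis dense : forall (y : W) eps, 0 < eps -> exists x, norm (y [-] j x) < eps.

(** The value g y is the unique point l with
    norm (l - f x) <= C * norm (y - j x) for all x; linearity is read off from
    this characterization by approximating the arguments. *)
Lemma dense_extension (f : V -> Z) (C : R) :
  is_linear f -> 0 <= C -> (forall x, norm (f x) <= C * norm (j x)) ->
  exists g : W -> Z, is_linear g /\ (forall x, g (j x) = f x) /\
    forall y, norm (g y) <= C * norm y.
Proof.
intros hf hC hb.
assert (hbd : forall x x', norm (f x [-] f x') <= C * norm (j x [-] j x')).
  intros x x'; rewrite <- (lin_minus _ hf), <- (lin_minus _ hj); apply hb.
assert (ex : forall y, exists l, forall x, norm (l [-] f x) <= C * norm (y [-] j x)).
{ intros y.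
  destruct (choice (fun n x => norm (y [-] j x) < (/ 2) ^ n / 4))
    as [x hx].
    intros n; apply dense; pose proof (half_pow_pos n); lra.
  destruct (nested_limit (fun n => f (x n)) (fun n => C * (/ 2) ^ n)) as [l hl].
  - intros n; apply Rle_trans with (1 := hbd _ _).
    pose proof (norm_minus_triangle (j (x (S n))) y (j (x n))) as h.
    rewrite (norm_minus_sym (j (x (S n))) y) in h.
    pose proof (hx n); pose proof (hx (S n)) as h'; simpl in h'.
    pose proof (half_pow_pos n).
    unfold Rdiv; rewrite Rmult_assoc; apply Rmult_le_compat_l; lra.
  - intros n; simpl; lra.
  - exists l; intros x'.
    apply le_of_le_plus_eps with (2 * C); intros e he.
    destruct (half_pow_small 1 e he) as [n hn].
    pose proof (norm_minus_triangle l (f (x n)) (f x')) as h1.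
    pose proof (norm_minus_triangle (j (x n)) y (j x')) as h2.
    rewrite (norm_minus_sym (j (x n)) y) in h2.
    pose proof (hl n) as h3; pose proof (hbd (x n) x') as h4.
    pose proof (hx n) as h5; pose proof (half_pow_pos n); nra. }
destruct (choice _ ex) as [g hg].
exists g.
assert (gj : forall x, g (j x) = f x).
  intros x; apply eq_of_norm_minus_le0; specialize (hg (j x) x).
  replace (j x [-] j x) with ([0] : W) in hg by vring.
  rewrite norm_zero' in hg; lra.
assert (gb : forall y, norm (g y) <= C * norm y).
  intros y; specialize (hg y [0]).
  rewrite (lin_zero _ hf), (lin_zero _ hj) in hg.
  replace (g y [-] [0]) with (g y) in hg by vring.
  replace (y [-] [0]) with y in hg by vring; exact hg.
split; [| auto].
apply is_linear_of_bound with C; [| | exact gb].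
- intros y y'; apply eq_of_norm_minus_small with (4 * C); intros e he.
  destruct (dense y e he) as [x hx], (dense y' e he) as [x' hx'].
  pose proof (hg y x); pose proof (hg y' x'); pose proof (hg (y [+] y') (x [+] x')) as h.
  rewrite (lin_plus _ hj), (lin_plus _ hf) in h.
  replace (y [+] y' [-] (j x [+] j x')) with ((y [-] j x) [+] (y' [-] j x')) in h
    by vring.
  pose proof (norm_plus_le (y [-] j x) (y' [-] j x')).
  replace (g (y [+] y') [-] (g y [+] g y')) with
    ((g (y [+] y') [-] (f x [+] f x')) [-] ((g y [-] f x) [+] (g y' [-] f x')))
    by vring.
  apply Rle_trans with (1 := norm_minus_le _ _).
  pose proof (norm_plus_le (g y [-] f x) (g y' [-] f x')).
  nra.
- intros a y; apply eq_of_norm_minus_small with (2 * abs a * C); intros e he.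
  destruct (dense y e he) as [x hx].
  pose proof (hg y x) as h1; pose proof (hg (a **: y) (a **: x)) as h2.
  rewrite (lin_scal _ hj), (lin_scal _ hf) in h2.
  assert (sm : forall (E : NormedModule (scalars k)) (u v : E),
    norm (a **: u [-] a **: v) <= abs a * norm (u [-] v)).
    intros E u v; rewrite <- scal_minus; apply @norm_scal.
  pose proof (sm _ y (j x)); pose proof (sm _ (g y) (f x)) as h3.
  pose proof (norm_minus_triangle (g (a **: y)) (a **: f x) (a **: g y)) as h4.
  rewrite (norm_minus_sym (a **: f x) (a **: g y)) in h4.
  assert (ha : 0 <= abs a) by apply abs_ge_0.
  assert (hC' : norm (y [-] j x) <= e) by lra.
  pose proof (Rmult_le_compat_l _ _ _ hC hC').
  pose proof (Rmult_le_compat_l _ _ _ ha hC').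
  nra.
Qed.

Lemma dense_linear_unique (f g : W -> Z) :
  is_linear f -> is_linear g -> (forall x, f (j x) = g (j x)) ->
  forall y, f y = g y.
Proof.
intros hf hg h y.
destruct (lin_bound _ hf) as [Cf [hCf hf']], (lin_bound _ hg) as [Cg [hCg hg']].
apply eq_of_norm_minus_small with (Cf + Cg); intros e he.
destruct (dense y e he) as [x hx].
replace (f y [-] g y) with (f (y [-] j x) [-] g (y [-] j x))
  by (rewrite (lin_minus _ hf), (lin_minus _ hg), h; vring).
apply Rle_trans with (1 := norm_minus_le _ _).
specialize (hf' (y [-] j x)); specialize (hg' (y [-] j x)); nra.
Qed.

Lemma dense_bound (f : W -> Z) (C : R) : is_linear f ->
  (forall x, norm (f (j x)) <= C * norm (j x)) -> forall y, norm (f y) <= C * norm y.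
Proof.
intros hf hC y; destruct (lin_bound _ hf) as [K [hK0 hK]].
apply le_of_le_plus_eps with (K + Rabs C); intros e he.
destruct (dense y e he) as [x hx].
apply Rle_trans with (1 := norm_le_minus _ (f (j x))).
rewrite <- (lin_minus _ hf).
specialize (hK (y [-] j x)); specialize (hC x).
pose proof (norm_triangle_inv (j x) y) as h.
change (Rabs (norm (j x) - norm y) <= norm (j x [-] y)) in h.
rewrite norm_minus_sym in h.
assert (C * (norm (j x) - norm y) <= Rabs C * e).
  apply Rle_trans with (1 := Rle_abs _); rewrite Rabs_mult.
  apply Rmult_le_compat_l; [apply Rabs_pos | lra].
assert (K * norm (y [-] j x) <= K * e) by (apply Rmult_le_compat_l; lra).
lra.
Qed.

End DenseExtension.

(** * Continuity and integrals of vector-valued functions *)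

Definition cts_on {k : scalar_kind} {V : NormedModule (scalars k)}
    (D : R -> Prop) (f : R -> V) : Prop :=
  forall t, D t -> forall eps, 0 < eps -> exists delta, 0 < delta /\
    forall s, D s -> Rabs (s - t) < delta -> norm (f s [-] f t) < eps.

Section Continuity.
Context {k : scalar_kind} {V W : NormedModule (scalars k)}.
Implicit Types (D E : R -> Prop) (f g : R -> V).

Lemma continuous_on_cts D f :
  continuous_on (D : R_UniformSpace -> Prop) f <-> cts_on D f.
Proof.
split.
- intros h t ht eps he.
  specialize (proj1 (filterlim_iff_norm f (f t)) (h t ht) eps he) as [d hd].
  exists d; split; [apply cond_pos |]; intros s hs hst; apply hd; easy.
- intros h t ht; apply filterlim_iff_norm; intros eps he.
  destruct (h t ht eps he) as [d [hd hd']].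
  exists (mkposreal d hd); intros s hst hs; apply hd'; easy.
Qed.

Lemma cts_on_subset D E f : (forall t, E t -> D t) -> cts_on D f -> cts_on E f.
Proof.
intros hDE h t ht eps he; destruct (h t (hDE t ht) eps he) as [d [hd hd']].
exists d; auto.
Qed.

Lemma cts_on_ext D f g : (forall t, D t -> f t = g t) -> cts_on D f -> cts_on D g.
Proof.
intros hfg h t ht eps he; destruct (h t ht eps he) as [d [hd hd']].
exists d; split; [easy |]; intros s hs hst; rewrite <- !hfg by easy; auto.
Qed.

Lemma cts_on_const D (v : V) : cts_on D (fun _ => v).
Proof.
intros t _ eps he; exists 1; split; [lra |]; intros s _ _.
replace (v [-] v) with ([0] : V) by vring; rewrite norm_zero'; lra.
Qed.

Lemma cts_on_comp D E f (u : R -> R) :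
  (forall s, E s -> D (u s)) ->
  (forall s t, E s -> E t -> Rabs (u s - u t) <= Rabs (s - t)) ->
  cts_on D f -> cts_on E (fun s => f (u s)).
Proof.
intros hu hlip h t ht eps he; destruct (h (u t) (hu t ht) eps he) as [d [hd hd']].
exists d; split; [easy |]; intros s hs hst; apply hd'; [auto |].
apply Rle_lt_trans with (2 := hst); auto.
Qed.

Lemma cts_on_plus D f g :
  cts_on D f -> cts_on D g -> cts_on D (fun t => f t [+] g t).
Proof.
intros hf hg t ht eps he.
destruct (hf t ht (eps / 2)) as [d [hd hd']]; [lra |].
destruct (hg t ht (eps / 2)) as [e [he1 he']]; [lra |].
exists (Rmin d e); split; [apply Rmin_pos; easy |]; intros s hs hst.
specialize (hd' s hs (Rlt_le_trans _ _ _ hst (Rmin_l _ _))).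
specialize (he' s hs (Rlt_le_trans _ _ _ hst (Rmin_r _ _))).
replace (f s [+] g s [-] (f t [+] g t)) with ((f s [-] f t) [+] (g s [-] g t))
  by vring.
apply Rle_lt_trans with (1 := norm_plus_le _ _); lra.
Qed.

Lemma cts_on_apply D (L : R -> V -> W) f (M : R) :
  (forall s, D s -> is_linear (L s)) ->
  (forall s x, D s -> norm (L s x) <= M * norm x) ->
  (forall x, cts_on D (fun s => L s x)) ->
  cts_on D f -> cts_on D (fun s => L s (f s)).
Proof.
intros hlin hM hL hf t ht eps he.
pose proof (Rabs_pos M); pose proof (Rle_abs M).
set (K := Rabs M + 1).
destruct (hf t ht (eps / 2 / K)) as [d [hd hd']].
  apply Rdiv_lt_0_compat; unfold K; lra.
destruct (hL (f t) t ht (eps / 2)) as [e [he1 he']]; [lra |].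
exists (Rmin d e); split; [apply Rmin_pos; easy |]; intros s hs hst.
specialize (hd' s hs (Rlt_le_trans _ _ _ hst (Rmin_l _ _))).
specialize (he' s hs (Rlt_le_trans _ _ _ hst (Rmin_r _ _))).
replace (L s (f s) [-] L t (f t)) with
  (L s (f s [-] f t) [+] (L s (f t) [-] L t (f t)))
  by (rewrite (lin_minus _ (hlin s hs)); vring).
apply Rle_lt_trans with (1 := norm_plus_le _ _).
assert (norm (L s (f s [-] f t)) <= eps / 2).
  apply Rle_trans with (1 := hM s _ hs).
  replace (eps / 2) with (K * (eps / 2 / K)) by (unfold K; field; lra).
  pose proof (norm_nonneg (f s [-] f t)).
  apply Rle_trans with (K * norm (f s [-] f t)).
    apply Rmult_le_compat_r; unfold K; lra.
  apply Rmult_le_compat_l; [unfold K |]; lra.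
lra.
Qed.

(** Composing with the clamp extends a function on [a, b] continuously to the whole
    line, where results on two-sided continuity apply. *)
Definition clamp (a b s : R) : R := Rmax a (Rmin s b).

Lemma clamp_in a b s : a <= b -> a <= clamp a b s <= b.
Proof. intros h; unfold clamp, Rmax, Rmin; repeat destruct Rle_dec; lra. Qed.

Lemma clamp_id a b s : a <= s <= b -> clamp a b s = s.
Proof. intros h; unfold clamp, Rmax, Rmin; repeat destruct Rle_dec; lra. Qed.

Lemma clamp_lip a b s t : Rabs (clamp a b s - clamp a b t) <= Rabs (s - t).
Proof.
unfold clamp, Rmax, Rmin, Rabs.
repeat (destruct Rle_dec || destruct Rcase_abs); lra.
Qed.

Lemma cts_on_clamp a b f : a <= b ->
  cts_on (fun t => a <= t <= b) f -> cts_on (fun _ => True) (fun s => f (clamp a b s)).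
Proof.
intros hab; apply cts_on_comp.
- intros; apply clamp_in, hab.
- intros; apply clamp_lip.
Qed.

Lemma cts_on_bounded a b f : a <= b -> cts_on (fun t => a <= t <= b) f ->
  exists C, forall t, a <= t <= b -> norm (f t) <= C.
Proof.
intros hab h.
assert (hc := cts_on_clamp a b f hab h).
destruct (continuity_ab_maj (fun s => norm (f (clamp a b s))) a b hab) as [m hm].
- intros t _ eps he.
  destruct (hc t I eps he) as [d [hd hd']].
  exists d; split; [easy |]; intros s [_ hs]; simpl in *; unfold R_dist in *.
  apply Rle_lt_trans with (2 := hd' s I hs).
  apply (@norm_triangle_inv _ V).
- exists (norm (f (clamp a b m))); intros t ht.
  destruct hm as [hm _]; specialize (hm t ht); cbv beta in hm.
  now rewrite (clamp_id a b t ht) in hm.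
Qed.

End Continuity.

Definition restrict_complete {k : scalar_kind}
    (V : CompleteNormedModule (scalars k)) : CompleteNormedModule R_AbsRing :=
  CompleteNormedModule.Pack R_AbsRing V
    (CompleteNormedModule.Class R_AbsRing V
       (NormedModule.class R_AbsRing (restrict_scalars V))
       (CompleteNormedModule.mixin _ V (CompleteNormedModule.class _ V))) V.

Section Integral.
Context {k : scalar_kind} {V : CompleteNormedModule (scalars k)}.
Implicit Types (f g : R -> V) (v : V).

Lemma integral_exists f a b : a <= b -> cts_on (fun t => a <= t <= b) f ->
  exists v, has_integral f a b v.
Proof.
intros hab h.
assert (hc := cts_on_clamp a b f hab h).
destruct (@ex_RInt_continuous (restrict_complete V) (fun s => f (clamp a b s)) a b)
  as [v hv].
- intros t _; apply (filterlim_iff_norm (fun s => f (clamp a b s))).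
  intros eps he; destruct (hc t I eps he) as [d [hd hd']].
  exists (mkposreal d hd); intros s hs; apply hd'; easy.
- exists v; apply (@is_RInt_ext (restrict_scalars V)) with (2 := hv).
  intros s hs; rewrite Rmin_left, Rmax_right in hs by lra.
  rewrite clamp_id by lra; reflexivity.
Qed.

Lemma integral_unique f a b v w :
  has_integral f a b v -> has_integral f a b w -> v = w.
Proof.
intros hv hw.
rewrite <- (@is_RInt_unique (restrict_complete V) f a b v hv).
apply (@is_RInt_unique (restrict_complete V) f a b w hw).
Qed.

Lemma integral_ext f g a b v : a <= b -> (forall s, a < s < b -> f s = g s) ->
  has_integral f a b v -> has_integral g a b v.
Proof.
intros hab h; apply (@is_RInt_ext (restrict_scalars V)).
intros s hs; rewrite Rmin_left, Rmax_right in hs by lra; auto.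
Qed.

Lemma integral_plus f g a b v w : has_integral f a b v -> has_integral g a b w ->
  has_integral (fun s => f s [+] g s) a b (v [+] w).
Proof. apply (@is_RInt_plus (restrict_scalars V)). Qed.

Lemma integral_minus f g a b v w : has_integral f a b v -> has_integral g a b w ->
  has_integral (fun s => f s [-] g s) a b (v [-] w).
Proof. apply (@is_RInt_minus (restrict_scalars V)). Qed.

Lemma integral_const a b v : has_integral (fun _ => v) a b ((b - a) *: v).
Proof. apply (@is_RInt_const (restrict_scalars V)). Qed.

Lemma integral_point f a : has_integral f a a [0].
Proof. apply (@is_RInt_point (restrict_scalars V)). Qed.

Lemma integral_chasles f a b c v w :
  has_integral f a b v -> has_integral f b c w -> has_integral f a c (v [+] w).
Proof. apply (@is_RInt_Chasles (restrict_scalars V)). Qed.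

Lemma integral_shift f a b c v : has_integral f (a + c) (b + c) v ->
  has_integral (fun s => f (s + c)) a b v.
Proof.
intros h.
assert (h' := @is_RInt_comp_lin (restrict_scalars V) f 1 c a b v).
rewrite !Rmult_1_l in h'; specialize (h' h).
apply (@is_RInt_ext (restrict_scalars V)) with (2 := h').
intros s _; rewrite Rmult_1_l; apply rs_one.
Qed.

Lemma integral_reflect f t v : has_integral f 0 t v ->
  has_integral (fun s => f (t - s)) 0 t v.
Proof.
intros h.
apply (@is_RInt_swap (restrict_scalars V)) in h.
assert (h' := @is_RInt_comp_lin (restrict_scalars V) f (-1) t 0 t (opp v)).
replace (-1 * 0 + t) with t in h' by ring.
replace (-1 * t + t) with 0 in h' by ring; specialize (h' h).
apply (@is_RInt_opp (restrict_scalars V)) in h'.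
replace v with (@opp (NormedModule.AbelianGroup _ V) (opp v)) by vring.
apply (@is_RInt_ext (restrict_scalars V)) with (2 := h').
intros s _; change (opp ((-1) *: f (-1 * s + t)) = f (t - s)).
replace (-1 * s + t) with (t - s) by ring; vring.
Qed.

Lemma integral_norm_le f a b v C : a <= b ->
  (forall s, a <= s <= b -> norm (f s) <= C) ->
  has_integral f a b v -> norm v <= (b - a) * C.
Proof. apply (@norm_RInt_le_const (restrict_scalars V)). Qed.

Lemma integral_near_const f (h : R) (u v : V) eps : 0 <= h ->
  (forall s, 0 <= s <= h -> norm (f s [-] u) <= eps) ->
  has_integral f 0 h v -> norm (v [-] h *: u) <= h * eps.
Proof.
intros hh hf hv.
assert (hi := integral_minus _ _ _ _ _ _ hv (integral_const 0 h u)).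
replace (h - 0) with h in hi by ring.
replace h with (h - 0) at 2 by ring.
apply integral_norm_le with (3 := hi); easy.
Qed.

(** Riemann sums commute with L, and L is continuous. *)
Lemma integral_linear {W : CompleteNormedModule (scalars k)} (L : V -> W) f a b v :
  is_linear L -> has_integral f a b v -> has_integral (fun s => L (f s)) a b (L v).
Proof.
intros hL hv.
assert (hsum : forall ptd,
  L (@Riemann_sum (restrict_scalars V) f ptd) =
  @Riemann_sum (restrict_scalars W) (fun s => L (f s)) ptd).
{ intros ptd; apply SF_cons_ind with (s := ptd).
  - intros x0; apply (lin_zero _ hL).
  - intros h s IH.
    rewrite (@Riemann_sum_cons (restrict_scalars V)).
    rewrite (@Riemann_sum_cons (restrict_scalars W)), <- IH.
    etransitivity; [apply (lin_plus _ hL) |]; f_equal; apply (lin_scal _ hL). }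
unfold has_integral, is_RInt.
apply filterlim_ext with (fun ptd => L (@scal _ (restrict_scalars V) (sign (b - a))
  (@Riemann_sum (restrict_scalars V) f ptd))).
  intros ptd; etransitivity; [apply (lin_scal _ hL) |]; rewrite hsum; reflexivity.
destruct (lin_bound _ hL) as [C [hC0 hC]].
apply (filterlim_iff_norm (V := W)); intros eps he.
assert (he' : 0 < eps / C) by (apply Rdiv_lt_0_compat; lra).
refine (filter_imp _ _ _ (proj1 (filterlim_iff_norm _ v) hv _ he')).
intros ptd hptd.
rewrite <- (lin_minus _ hL).
apply Rle_lt_trans with (1 := hC _).
replace eps with (C * (eps / C)) by (field; lra).
apply Rmult_lt_compat_l; easy.
Qed.

Lemma integral_rs r f a b v :
  has_integral f a b v -> has_integral (fun s => r *: f s) a b (r *: v).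
Proof. apply (@is_RInt_scal (restrict_scalars V)). Qed.

End Integral.

(** * Strongly continuous semigroups and their generators *)

Definition integral {k : scalar_kind} {V : CompleteNormedModule (scalars k)}
    (f : R -> V) (a b : R) : V := @RInt (restrict_complete V) f a b.

Lemma integral_correct {k : scalar_kind} {V : CompleteNormedModule (scalars k)}
    (f : R -> V) (a b : R) :
  a <= b -> cts_on (fun t => a <= t <= b) f ->
  has_integral f a b (integral f a b).
Proof.
intros hab hf; destruct (integral_exists f a b hab hf) as [v hv].
unfold integral; rewrite (@is_RInt_unique (restrict_complete V) f a b v hv).
exact hv.
Qed.

Definition right_limit {k : scalar_kind} {V : NormedModule (scalars k)}
    (f : R -> V) (y : V) : Prop :=
  forall eps, 0 < eps -> exists delta, 0 < delta /\
    forall h, 0 < h < delta -> norm (f h [-] y) < eps.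

Section RightLimit.
Context {k : scalar_kind} {V W : NormedModule (scalars k)}.
Implicit Types (f g : R -> V) (y z : V).

Lemma filterlim_at_right_iff f y :
  filterlim f (at_right 0) (locally y) <-> right_limit f y.
Proof.
rewrite filterlim_iff_norm; split; intros h eps he.
- destruct (h eps he) as [d hd]; exists d; split; [apply cond_pos |].
  intros t [ht ht']; apply hd; [| exact ht].
  change (Rabs (t - 0) < d); rewrite Rminus_0_r, Rabs_pos_eq; lra.
- destruct (h eps he) as [d [hd hd']]; exists (mkposreal d hd).
  intros t ht ht'; apply hd'.
  change (Rabs (t - 0) < d) in ht; rewrite Rminus_0_r, Rabs_pos_eq in ht; lra.
Qed.

Lemma right_limit_ext f g y delta : 0 < delta ->
  (forall h, 0 < h < delta -> f h = g h) -> right_limit f y -> right_limit g y.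
Proof.
intros hd hfg hf eps he; destruct (hf eps he) as [d [hd1 hd2]].
exists (Rmin d delta); split; [apply Rmin_pos; lra |]; intros h hh.
pose proof (Rmin_l d delta); pose proof (Rmin_r d delta).
rewrite <- hfg by lra; apply hd2; lra.
Qed.

Lemma right_limit_norm_le f y C delta : 0 < delta ->
  (forall h, 0 < h < delta -> norm (f h) <= C) -> right_limit f y -> norm y <= C.
Proof.
intros hd hC hf; apply le_of_le_plus_eps with 1; intros e he.
destruct (hf e he) as [d [hd1 hd2]].
pose proof (Rmin_l d delta); pose proof (Rmin_r d delta).
assert (0 < Rmin d delta) by (apply Rmin_pos; lra).
specialize (hC (Rmin d delta / 2)); specialize (hd2 (Rmin d delta / 2)).
rewrite norm_minus_sym in hd2.
pose proof (norm_le_minus y (f (Rmin d delta / 2))); lra.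
Qed.

Lemma right_limit_plus f g y z :
  right_limit f y -> right_limit g z -> right_limit (fun h => f h [+] g h) (y [+] z).
Proof.
intros hf hg eps he.
destruct (hf (eps / 2)) as [d [hd1 hd2]]; [lra |].
destruct (hg (eps / 2)) as [d' [hd1' hd2']]; [lra |].
exists (Rmin d d'); split; [apply Rmin_pos; lra |]; intros h hh.
pose proof (Rmin_l d d'); pose proof (Rmin_r d d').
replace (f h [+] g h [-] (y [+] z)) with ((f h [-] y) [+] (g h [-] z)) by vring.
apply Rle_lt_trans with (1 := norm_plus_le _ _).
specialize (hd2 h); specialize (hd2' h); lra.
Qed.

Lemma right_limit_linear (L : V -> W) f y : is_linear L ->
  right_limit f y -> right_limit (fun h => L (f h)) (L y).
Proof.
intros hL hf eps he; destruct (lin_bound _ hL) as [C [hC0 hC]].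
destruct (hf (eps / C)) as [d [hd1 hd2]]; [apply Rdiv_lt_0_compat; lra |].
exists d; split; [easy |]; intros h hh.
rewrite <- (lin_minus _ hL); apply Rle_lt_trans with (1 := hC _).
replace eps with (C * (eps / C)) by (field; lra).
apply Rmult_lt_compat_l; auto.
Qed.

Lemma right_limit_minus f g y z :
  right_limit f y -> right_limit g z -> right_limit (fun h => f h [-] g h) (y [-] z).
Proof.
intros hf hg eps he.
destruct (hf (eps / 2)) as [d [hd1 hd2]]; [lra |].
destruct (hg (eps / 2)) as [d' [hd1' hd2']]; [lra |].
exists (Rmin d d'); split; [apply Rmin_pos; lra |]; intros h hh.
pose proof (Rmin_l d d'); pose proof (Rmin_r d d').
replace (f h [-] g h [-] (y [-] z)) with ((f h [-] y) [-] (g h [-] z)) by vring.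
apply Rle_lt_trans with (1 := norm_minus_le _ _).
specialize (hd2 h); specialize (hd2' h); lra.
Qed.

Lemma right_limit_const y : right_limit (fun _ => y) y.
Proof.
intros eps he; exists 1; split; [lra |]; intros h _.
replace (y [-] y) with ([0] : V) by vring; rewrite norm_zero'; lra.
Qed.

Lemma right_limit_unique f y z : right_limit f y -> right_limit f z -> y = z.
Proof.
intros hy hz; apply eq_of_norm_minus_le0.
apply (right_limit_norm_le (fun h => f h [-] f h) (y [-] z) 0 1); [lra | |].
  intros h _; replace (f h [-] f h) with ([0] : V) by vring.
  rewrite norm_zero'; lra.
apply right_limit_minus; easy.
Qed.

Lemma right_limit_rs (phi : R -> R) (a : R) f y :
  right_limit f y ->
  (forall eps, 0 < eps -> exists delta, 0 < delta /\
     forall h, 0 < h < delta -> Rabs (phi h - a) < eps) ->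
  right_limit (fun h => phi h *: f h) (a *: y).
Proof.
intros hf hphi eps he.
pose proof (norm_nonneg y); pose proof (Rabs_pos a).
destruct (hphi (Rmin 1 (eps / 2 / (norm y + 1)))) as [d [hd1 hd2]].
  apply Rmin_pos; [lra | apply Rdiv_lt_0_compat; lra].
destruct (hf (eps / 2 / (Rabs a + 1))) as [d' [hd1' hd2']].
  apply Rdiv_lt_0_compat; lra.
exists (Rmin d d'); split; [apply Rmin_pos; lra |]; intros h hh.
pose proof (Rmin_l d d'); pose proof (Rmin_r d d').
specialize (hd2 h ltac:(lra)); specialize (hd2' h ltac:(lra)).
assert (h1 := Rlt_le_trans _ _ _ hd2 (Rmin_l _ _)).
assert (h2 := Rlt_le_trans _ _ _ hd2 (Rmin_r _ _)).
replace (phi h *: f h [-] a *: y) with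
  (phi h *: (f h [-] y) [+] (phi h - a) *: y) by vring.
apply Rle_lt_trans with (1 := norm_plus_le _ _); rewrite !norm_rs.
assert (h3 : Rabs (phi h) <= Rabs a + 1).
  replace (phi h) with (a + (phi h - a)) by ring.
  apply Rle_trans with (1 := Rabs_triang _ _); lra.
assert (Rabs (phi h) * norm (f h [-] y) < eps / 2).
  apply Rle_lt_trans with ((Rabs a + 1) * norm (f h [-] y)).
    apply Rmult_le_compat_r; [apply norm_nonneg | easy].
  replace (eps / 2) with ((Rabs a + 1) * (eps / 2 / (Rabs a + 1))) by (field; lra).
  apply Rmult_lt_compat_l; lra.
assert (Rabs (phi h - a) * norm y <= eps / 2).
  replace (eps / 2) with ((eps / 2 / (norm y + 1)) * (norm y + 1)) by (field; lra).
  apply Rmult_le_compat; try lra; apply Rabs_pos.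
lra.
Qed.
End RightLimit.

Lemma generator_iff {k : scalar_kind} {V : NormedModule (scalars k)}
    (S : R -> V -> V) (x y : V) :
  generator S x y <-> right_limit (fun h => / h *: (S h x [-] x)) y.
Proof. apply filterlim_at_right_iff. Qed.

Section Generator.
Context {k : scalar_kind} {V : NormedModule (scalars k)} (S : R -> V -> V).
Hypothesis lin : forall t, 0 <= t -> is_linear (S t).

Lemma generator_unique x y z : generator S x y -> generator S x z -> y = z.
Proof. rewrite !generator_iff; apply right_limit_unique. Qed.

Lemma generator_minus x y x' y' :
  generator S x y -> generator S x' y' -> generator S (x [-] x') (y [-] y').
Proof.
rewrite !generator_iff; intros h h'.
apply right_limit_ext with (3 := right_limit_minus _ _ _ _ h h') (delta := 1);
  [lra |].
intros t ht; rewrite (lin_minus _ (lin t ltac:(lra))); vring.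
Qed.

Lemma generator_rs r x y : generator S x y -> generator S (r *: x) (r *: y).
Proof.
rewrite !generator_iff; intros h.
apply right_limit_ext with (delta := 1)
  (3 := right_limit_linear _ _ _ (is_linear_rs r _ is_linear_id) h); [lra |].
intros t ht; rewrite (lin_scal _ (lin t ltac:(lra))); vring.
Qed.
End Generator.

Section Semigroup.
Context {k : scalar_kind} {V : CompleteNormedModule (scalars k)} (S : R -> V -> V).
Hypothesis hS : C0_semigroup S.

Lemma sg_linear t : 0 <= t -> is_linear (S t).
Proof. apply hS. Qed.

Lemma sg_zero x : S 0 x = x.
Proof. apply hS. Qed.

Lemma sg_plus s t x : 0 <= s -> 0 <= t -> S (s + t) x = S s (S t x).
Proof. apply hS. Qed.

Lemma sg_cts x : cts_on (fun t => 0 <= t) (fun t => S t x).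
Proof. apply continuous_on_cts, hS. Qed.

Lemma sg_cts_on a b x : 0 <= a -> cts_on (fun t => a <= t <= b) (fun t => S t x).
Proof. intros ha; apply cts_on_subset with (2 := sg_cts x); intros; lra. Qed.

(** Each orbit is bounded on a compact time interval, so the operators are
    bounded together by the uniform boundedness principle. *)
Lemma sg_bound b : 0 <= b -> exists M, 1 <= M /\
  forall t x, 0 <= t <= b -> norm (S t x) <= M * norm x.
Proof.
intros hb.
destruct (uniform_boundedness (fun L => exists t, 0 <= t <= b /\ L = S t))
  as [M hM].
- intros L [t [ht ->]]; apply sg_linear; lra.
- intros x; destruct (cts_on_bounded 0 b (fun t => S t x) hb) as [C hC].
    apply sg_cts_on; lra.
  exists C; intros L [t [ht ->]]; auto.
- exists (Rabs M + 1); pose proof (Rabs_pos M); pose proof (Rle_abs M).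
  split; [lra |]; intros t x ht.
  apply Rle_trans with (M * norm x); [apply hM; eauto |].
  apply Rmult_le_compat_r; [apply norm_nonneg | lra].
Qed.

Definition sg_int t x := integral (fun s => S s x) 0 t.

Lemma sg_int_correct t x : 0 <= t -> has_integral (fun s => S s x) 0 t (sg_int t x).
Proof. intros ht; apply integral_correct; [easy | apply sg_cts_on; lra]. Qed.

Lemma sg_int_norm_le t M x : 0 <= t ->
  (forall s x, 0 <= s <= t -> norm (S s x) <= M * norm x) ->
  norm (sg_int t x) <= t * M * norm x.
Proof.
intros ht hM; rewrite Rmult_assoc; replace t with (t - 0) at 2 by ring.
apply integral_norm_le with (3 := sg_int_correct t x ht); auto.
Qed.

Lemma sg_int_linear t : 0 <= t -> is_linear (sg_int t).
Proof.
intros ht; destruct (sg_bound t ht) as [M [_ hM]].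
apply is_linear_of_bound with (t * M).
- intros x y.
  apply integral_unique with (1 := sg_int_correct t _ ht).
  apply integral_ext with (fun s => S s x [+] S s y); [easy | |].
    intros s hs; rewrite (lin_plus _ (sg_linear s ltac:(lra))); reflexivity.
  apply integral_plus; apply sg_int_correct, ht.
- intros a x.
  apply integral_unique with (1 := sg_int_correct t _ ht).
  apply integral_ext with (fun s => a **: S s x); [easy | |].
    intros s hs; rewrite (lin_scal _ (sg_linear s ltac:(lra))); reflexivity.
  apply (integral_linear (fun y => a **: y)); [apply is_linear_scale |].
  apply sg_int_correct, ht.
- intros x; apply sg_int_norm_le; easy.
Qed.

(** Both sides are the integral of the orbit over [t, t + h] minus the integral
    over [0, h]. *)
Lemma sg_int_shift h t x : 0 <= h -> 0 <= t ->
  S h (sg_int t x) [-] sg_int t x = S t (sg_int h x) [-] sg_int h x.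
Proof.
assert (split : forall h t, 0 <= h -> 0 <= t ->
    sg_int (t + h) x = sg_int h x [+] S h (sg_int t x)).
{ clear h t; intros h t hh ht.
  apply integral_unique with (1 := sg_int_correct (t + h) x ltac:(lra)).
  apply integral_chasles with h; [apply sg_int_correct, hh |].
  set (g := fun s => S s x).
  assert (hg : has_integral g h (t + h) (integral g h (t + h))).
    apply integral_correct; [lra | apply sg_cts_on, hh].
  replace (S h (sg_int t x)) with (integral g h (t + h)); [exact hg |].
  assert (hg' := integral_shift g 0 t h (integral g h (t + h))).
  rewrite Rplus_0_l in hg'; specialize (hg' hg).
  apply integral_unique with (1 := hg').
  apply integral_ext with (fun s => S h (S s x)); [easy | |].
    intros s hs; unfold g; rewrite Rplus_comm, sg_plus by lra; reflexivity.
  apply integral_linear; [apply sg_linear, hh | apply sg_int_correct, ht]. }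
intros hh ht.
assert (e1 := split h t hh ht); assert (e2 := split t h ht hh).
rewrite Rplus_comm, e1 in e2.
replace (S h (sg_int t x)) with (sg_int t x [+] S t (sg_int h x) [-] sg_int h x)
  by (rewrite <- e2; vring).
vring.
Qed.

Lemma sg_int_mean x : right_limit (fun h => / h *: sg_int h x) x.
Proof.
intros eps he.
destruct (sg_cts x 0 ltac:(lra) (eps / 2)) as [d [hd hd']]; [lra |].
exists d; split; [easy |]; intros h hh.
assert (hn : norm (sg_int h x [-] h *: x) <= h * (eps / 2)).
  apply integral_near_const with (3 := sg_int_correct h x ltac:(lra)); [lra |].
  intros s hs; rewrite <- (sg_zero x) at 2; left; apply hd'; [lra |].
  rewrite Rminus_0_r, Rabs_pos_eq; lra.
replace (/ h *: sg_int h x [-] x) with (/ h *: (sg_int h x [-] h *: x)) by vfield.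
assert (0 < / h) by (apply Rinv_0_lt_compat; lra).
rewrite norm_rs, Rabs_pos_eq by lra.
apply Rle_lt_trans with (/ h * (h * (eps / 2))).
  apply Rmult_le_compat_l; lra.
rewrite <- Rmult_assoc, Rinv_l; lra.
Qed.

Lemma sg_int_shift_limit t x : 0 <= t ->
  right_limit (fun h => / h *: (S t (sg_int h x) [-] sg_int h x)) (S t x [-] x).
Proof.
intros ht.
assert (h := right_limit_minus _ _ _ _
  (right_limit_linear _ _ _ (sg_linear t ht) (sg_int_mean x)) (sg_int_mean x)).
apply right_limit_ext with (3 := h) (delta := 1); [lra |].
intros r hr; rewrite (lin_scal _ (sg_linear t ht)); vring.
Qed.

Lemma generator_sg_int t x : 0 <= t -> generator S (sg_int t x) (S t x [-] x).
Proof.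
intros ht; apply generator_iff.
apply right_limit_ext with (3 := sg_int_shift_limit t x ht) (delta := 1); [lra |].
intros h hh; rewrite (sg_int_shift h t) by lra; reflexivity.
Qed.

(** The difference quotient of x is averaged in two ways: directly it tends to
    the integral of the orbit of y, and after the shift identity it tends to
    S t x - x. *)
Lemma sg_int_of_generator t x y : 0 <= t -> generator S x y ->
  sg_int t y = S t x [-] x.
Proof.
intros ht hxy.
apply right_limit_unique with (2 := sg_int_shift_limit t x ht).
apply generator_iff in hxy.
apply right_limit_ext with (delta := 1)
  (3 := right_limit_linear _ _ _ (sg_int_linear t ht) hxy); [lra |].
intros h hh; rewrite <- (sg_int_shift h t) by lra.
rewrite (lin_scal _ (sg_int_linear t ht)), (lin_minus _ (sg_int_linear t ht)).
do 2 f_equal.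
apply integral_unique with (1 := sg_int_correct t _ ht).
apply integral_ext with (fun s => S h (S s x)); [easy | |].
  intros s hs; rewrite <- !sg_plus by lra; f_equal; lra.
apply integral_linear; [apply sg_linear; lra | apply sg_int_correct, ht].
Qed.

Lemma generator_orbit t x y : 0 <= t ->
  generator S x y -> generator S (S t x) (S t y).
Proof.
intros ht; rewrite !generator_iff; intros h.
apply right_limit_ext with (delta := 1)
  (3 := right_limit_linear _ _ _ (sg_linear t ht) h); [lra |].
intros r hr.
rewrite (lin_scal _ (sg_linear t ht)), (lin_minus _ (sg_linear t ht)),
  <- !sg_plus, Rplus_comm by lra; reflexivity.
Qed.

Lemma generator_dense (x : V) eps : 0 < eps -> exists h, 0 < h /\
  norm (x [-] / h *: sg_int h x) < eps.
Proof.
intros he; destruct (sg_int_mean x eps he) as [d [hd hd']].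
exists (d / 2); split; [lra |]; rewrite norm_minus_sym; apply hd'; lra.
Qed.

End Semigroup.

(** Left continuity comes for free: S t - S (t - h) = S (t - h) (S h - I), where
    S (t - h) is bounded uniformly in h. *)
Lemma C0_semigroup_intro {k : scalar_kind} {V : CompleteNormedModule (scalars k)}
    (S : R -> V -> V) :
  (forall t, 0 <= t -> is_linear (S t)) ->
  (forall x, S 0 x = x) ->
  (forall s t x, 0 <= s -> 0 <= t -> S (s + t) x = S s (S t x)) ->
  (forall b, 0 <= b -> exists M, forall t x, 0 <= t <= b ->
     norm (S t x) <= M * norm x) ->
  (forall x, right_limit (fun h => S h x) x) ->
  C0_semigroup S.
Proof.
intros hlin h0 hplus hb hr; repeat split; try easy.
1-3: apply hlin; easy.
intros x; apply continuous_on_cts; intros t ht eps he.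
destruct (hb (t + 1)) as [M hM]; [lra |].
pose proof (Rabs_pos M); pose proof (Rle_abs M).
destruct (hr x (eps / (Rabs M + 1))) as [d [hd hd']].
  apply Rdiv_lt_0_compat; lra.
assert (key : forall s h, 0 <= s <= t + 1 -> 0 <= h < d ->
    norm (S (s + h) x [-] S s x) < eps).
{ intros s h hs hh; destruct (Req_dec h 0) as [-> | hne].
    rewrite Rplus_0_r; replace (S s x [-] S s x) with ([0] : V) by vring.
    rewrite norm_zero'; easy.
  rewrite hplus by lra; rewrite <- (lin_minus _ (hlin s ltac:(lra))).
  apply Rle_lt_trans with (1 := hM s _ hs).
  replace eps with ((Rabs M + 1) * (eps / (Rabs M + 1))) by (field; lra).
  apply Rle_lt_trans with ((Rabs M + 1) * norm (S h x [-] x)).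
    apply Rmult_le_compat_r; [apply norm_nonneg | lra].
  apply Rmult_lt_compat_l; [lra |]; apply hd'; lra. }
exists (Rmin d 1); split; [apply Rmin_pos; lra |]; intros s hs hst.
assert (h1 := Rlt_le_trans _ _ _ hst (Rmin_l _ _)).
assert (h2 := Rlt_le_trans _ _ _ hst (Rmin_r _ _)).
destruct (Rle_dec t s) as [hts | hts].
  rewrite Rabs_pos_eq in h1, h2 by lra.
  replace s with (t + (s - t)) by ring; apply key; lra.
rewrite Rabs_left in h1, h2 by lra.
rewrite norm_minus_sym; replace t with (s + (t - s)) by ring; apply key; lra.
Qed.

Definition rescale {k : scalar_kind} {V : NormedModule (scalars k)} (l : R)
    (S : R -> V -> V) (t : R) (x : V) : V := exp (- l * t) *: S t x.

Section Rescale.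
Context {k : scalar_kind} {V : CompleteNormedModule (scalars k)} (S : R -> V -> V).
Hypothesis hS : C0_semigroup S.

Lemma exp_near_one l eps : 0 < eps -> exists delta, 0 < delta /\
  forall h, 0 < h < delta -> Rabs (exp (- l * h) - 1) < eps.
Proof.
intros he.
assert (hc : continuity_pt (fun h => exp (- l * h)) 0).
  apply derivable_continuous_pt; reg.
destruct (hc eps he) as [d [hd hd']].
exists d; split; [easy |]; intros h hh.
assert (h' := hd' h); simpl in h'; unfold R_dist in h'.
rewrite Rmult_0_r, exp_0 in h'; apply h'; split.
  split; [exact I | lra].
rewrite Rminus_0_r, Rabs_pos_eq; lra.
Qed.

Lemma exp_derive_zero l eps : 0 < eps -> exists delta, 0 < delta /\
  forall h, 0 < h < delta -> Rabs (/ h * (exp (- l * h) - 1) - - l) < eps.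
Proof.
intros he.
assert (hd : is_derive (fun h => exp (- l * h)) 0 (- l)).
  auto_derive; [easy |]; rewrite Rmult_0_r, exp_0; ring.
apply is_derive_Reals in hd; destruct (hd eps he) as [d hd'].
exists d; split; [apply cond_pos |]; intros h hh.
assert (h' := hd' h ltac:(lra) ltac:(rewrite Rabs_pos_eq; lra)).
rewrite Rplus_0_l, Rmult_0_r, exp_0 in h'.
replace (/ h * (exp (- l * h) - 1)) with ((exp (- l * h) - 1) / h)
  by (unfold Rdiv; ring); exact h'.
Qed.

Lemma rescale_C0 l : C0_semigroup (rescale l S).
Proof.
apply C0_semigroup_intro.
- intros t ht; apply is_linear_rs, sg_linear; easy.
- intros x; unfold rescale; rewrite (sg_zero S hS), Rmult_0_r, exp_0; vring.
- intros s t x hs ht; unfold rescale.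
  rewrite (sg_plus S hS), (lin_scal _ (sg_linear S hS s hs)) by easy.
  replace (- l * (s + t)) with (- l * s + - l * t) by ring.
  rewrite exp_plus; vring.
- intros b hb; destruct (sg_bound S hS b hb) as [M [hM1 hM]].
  exists (exp (Rabs l * b) * M); intros t x ht; unfold rescale.
  rewrite norm_rs, Rabs_pos_eq, Rmult_assoc by (left; apply exp_pos).
  apply Rmult_le_compat; [left; apply exp_pos | apply norm_nonneg | | auto].
  assert (hle : - l * t <= Rabs l * b).
    pose proof (Rabs_pos l); pose proof (Rle_abs (- l)) as hl.
    rewrite Rabs_Ropp in hl; nra.
  destruct hle as [hlt | ->]; [left; apply exp_increasing, hlt | right; easy].
- intros x; unfold rescale.
  assert (hx : right_limit (fun h => S h x) x).
    intros eps he.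
    destruct (sg_cts S hS x 0 ltac:(lra) eps he) as [d [hd hd']].
    exists d; split; [easy |]; intros h hh.
    rewrite <- (sg_zero S hS x) at 2; apply hd'; [lra |].
    rewrite Rminus_0_r, Rabs_pos_eq; lra.
  replace x with (1 *: x) at 1 by vring.
  apply right_limit_rs; [exact hx | apply exp_near_one].
Qed.

Lemma generator_rescale l x y :
  generator S x y -> generator (rescale l S) x (y [-] l *: x).
Proof.
rewrite !generator_iff; intros h.
replace (y [-] l *: x) with (1 *: y [+] (- l) *: x) by vring.
apply right_limit_ext with (delta := 1)
  (3 := right_limit_plus _ _ _ _ (right_limit_rs _ _ _ _ h (exp_near_one l))
          (right_limit_rs _ _ _ _ (right_limit_const x) (exp_derive_zero l)));
  [lra |].
intros t ht; unfold rescale; vfield.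
Qed.

End Rescale.

Lemma generator_ext {k : scalar_kind} {V : NormedModule (scalars k)}
    (S S' : R -> V -> V) x y :
  (forall t x, 0 <= t -> S t x = S' t x) -> generator S x y -> generator S' x y.
Proof.
intros h; rewrite !generator_iff.
apply right_limit_ext with 1; [lra |]; intros t ht; rewrite h by lra; reflexivity.
Qed.

Lemma generator_unrescale {k : scalar_kind} {V : CompleteNormedModule (scalars k)}
    (S : R -> V -> V) l x y : C0_semigroup S ->
  generator (rescale l S) x y -> generator S x (y [+] l *: x).
Proof.
intros hS h.
apply (generator_rescale _ (- l)) in h.
replace (y [-] (- l) *: x) with (y [+] l *: x) in h by vring.
apply generator_ext with (2 := h); intros t z ht; unfold rescale.
rewrite rs_assoc, <- exp_plus; replace (- - l * t + - l * t) with 0 by ring.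
rewrite exp_0; vring.
Qed.

(** When exp (- l t1) S t1 has norm at most 1/2, the operator
    (I - exp (- l t1) S t1)^-1 followed by the integral of exp (- l s) S s over
    [0, t1] is a right inverse of l - G: a resolvent without an improper
    integral. *)
Lemma generator_range {k : scalar_kind} {V : CompleteNormedModule (scalars k)}
    (S : R -> V -> V) (l t1 M : R) :
  C0_semigroup S -> 0 <= t1 -> (forall x, norm (S t1 x) <= M * norm x) ->
  exp (- l * t1) * M <= / 2 ->
  forall y : V, exists x, generator S x (l *: x [-] y).
Proof.
intros hS ht hM hl y.
assert (hR := rescale_C0 S hS l).
destruct (solve_contraction (rescale l S t1) y) as [z hz].
- apply sg_linear; easy.
- intros x; unfold rescale; rewrite norm_rs, Rabs_pos_eq by (left; apply exp_pos).
  apply Rle_trans with (exp (- l * t1) * (M * norm x)).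
    apply Rmult_le_compat_l; [left; apply exp_pos | apply hM].
  rewrite <- Rmult_assoc; apply Rmult_le_compat_r; [apply norm_nonneg | easy].
- exists (sg_int (rescale l S) t1 z).
  assert (hg := generator_sg_int _ hR t1 z ht).
  apply generator_unrescale in hg; [| exact hS].
  replace (l *: sg_int (rescale l S) t1 z [-] y) with
    (rescale l S t1 z [-] z [+] l *: sg_int (rescale l S) t1 z); [exact hg |].
  rewrite <- hz; vring.
Qed.

Section Uniqueness.
Context {k : scalar_kind} {V : CompleteNormedModule (scalars k)}.

(** The n increments over steps of length t / n add up to at most C t^2 / n. *)
Lemma constant_of_quadratic (phi : R -> V) (t C : R) : 0 <= t ->
  (forall s h, 0 <= s -> 0 <= h -> s + h <= t ->
     norm (phi (s + h) [-] phi s) <= C * (h * h)) ->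
  phi t = phi 0.
Proof.
intros ht hphi; apply eq_of_norm_minus_small with (Rabs C * (t * t)); intros e he.
destruct (INR_unbounded (/ e)) as [n hn].
assert (hie : 0 < / e) by (apply Rinv_0_lt_compat, he).
assert (hn0 : 0 < INR n) by lra.
assert (hq : / INR n < e).
  rewrite <- (Rinv_inv e); apply Rinv_lt_contravar; [apply Rmult_lt_0_compat |]; lra.
set (h := t / INR n).
assert (hh : 0 <= h) by (apply Rdiv_le_0_compat; lra).
assert (hnh : INR n * h = t) by (unfold h; field; lra).
assert (ind : forall i, (i <= n)%nat ->
    norm (phi (INR i * h) [-] phi 0) <= INR i * (Rabs C * (h * h))).
{ induction i as [|i IH]; intros hi.
    simpl; rewrite !Rmult_0_l.
    replace (phi 0 [-] phi 0) with ([0] : V) by vring; rewrite norm_zero'; lra.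
  rewrite S_INR; apply Rle_trans with (1 := norm_minus_triangle _ (phi (INR i * h)) _).
  specialize (IH ltac:(lia)).
  pose proof (le_INR _ _ hi) as hi'; rewrite S_INR in hi'.
  pose proof (pos_INR i).
  assert (h1 := hphi (INR i * h) h ltac:(nra) hh ltac:(nra)).
  replace ((INR i + 1) * h) with (INR i * h + h) by ring.
  pose proof (Rle_abs C); assert (0 <= h * h) by nra.
  assert (C * (h * h) <= Rabs C * (h * h)) by (apply Rmult_le_compat_r; easy).
  lra. }
specialize (ind n (le_n n)); rewrite hnh in ind.
apply Rle_trans with (1 := ind).
replace (INR n * (Rabs C * (h * h))) with (Rabs C * (t * t) * / INR n)
  by (unfold h; field; lra).
apply Rmult_le_compat_l; [| lra].
apply Rmult_le_pos; [apply Rabs_pos | nra].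
Qed.

(** The first-order Taylor remainder S h x - x - h y is the integral of S s y - y,
    and this is of order s because y is in the domain. *)
Lemma sg_second_order (S : R -> V -> V) (b M : R) (x y z : V) :
  C0_semigroup S -> 0 <= M ->
  (forall t x, 0 <= t <= b -> norm (S t x) <= M * norm x) ->
  generator S x y -> generator S y z ->
  forall h, 0 <= h <= b -> norm (S h x [-] x [-] h *: y) <= M * norm z * (h * h).
Proof.
intros hS hM0 hM hxy hyz h hh.
rewrite <- (sg_int_of_generator S hS h x y) by (easy || lra).
replace (M * norm z * (h * h)) with (h * (h * M * norm z)) by ring.
apply integral_near_const with (3 := sg_int_correct S hS h y ltac:(lra)); [lra |].
intros s hs; rewrite <- (sg_int_of_generator S hS s y z) by (easy || lra).
apply Rle_trans with (s * M * norm z).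
  apply sg_int_norm_le; [easy | lra |]; intros; apply hM; lra.
apply Rmult_le_compat_r; [apply norm_nonneg |]; nra.
Qed.

(** For x in the domain of the square of the generator of S, the function
    s |-> T (t - s) (S s x) has increments of second order, hence is constant;
    such x are dense. *)
Lemma generator_determines (S T : R -> V -> V) :
  C0_semigroup S -> C0_semigroup T ->
  (forall x y, generator S x y -> generator T x y) ->
  forall t x, 0 <= t -> S t x = T t x.
Proof.
intros hS hT hST t x ht.
destruct (sg_bound S hS t ht) as [M1 [hM1 hS']].
destruct (sg_bound T hT t ht) as [M2 [hM2 hT']].
assert (smooth : forall x y z, generator S x y -> generator S y z -> S t x = T t x).
{ clear x; intros x y z hxy hyz.
  set (phi := fun s => T (t - s) (S s x)).
  assert (hphi : phi t = phi 0).
  { apply constant_of_quadratic with (M2 * ((M1 + M2) * (M1 * norm z))); [easy |].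
    intros s h hs hh hsh; unfold phi.
    replace (s + h) with (h + s) by ring; rewrite (sg_plus S hS) by easy.
    replace (T (t - s) (S s x)) with (T (t - (h + s)) (T h (S s x)))
      by (rewrite <- (sg_plus T hT) by lra; f_equal; ring).
    assert (hts : 0 <= t - (h + s)) by lra.
    rewrite <- (lin_minus _ (sg_linear T hT _ hts)).
    eapply Rle_trans; [apply hT'; lra |].
    rewrite Rmult_assoc; apply Rmult_le_compat_l; [lra |].
    assert (g1 := generator_orbit S hS s _ _ hs hxy).
    assert (g2 := generator_orbit S hS s _ _ hs hyz).
    assert (e1 := sg_second_order S t M1 _ _ _ hS ltac:(lra) hS' g1 g2 h ltac:(lra)).
    assert (e2 := sg_second_order T t M2 _ _ _ hT ltac:(lra) hT'
      (hST _ _ g1) (hST _ _ g2) h ltac:(lra)).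
    replace (S h (S s x) [-] T h (S s x)) with
      ((S h (S s x) [-] S s x [-] h *: S s y) [-]
       (T h (S s x) [-] S s x [-] h *: S s y)) by vring.
    apply Rle_trans with (1 := norm_minus_le _ _).
    assert (hz := hS' s z ltac:(lra)).
    apply Rle_trans with ((M1 + M2) * norm (S s z) * (h * h)); [lra |].
    apply Rmult_le_compat_r; [nra |]; apply Rmult_le_compat_l; lra. }
  unfold phi in hphi; rewrite Rminus_0_r, (sg_zero S hS) in hphi.
  replace (t - t) with 0 in hphi by ring; rewrite (sg_zero T hT) in hphi; exact hphi. }
apply eq_of_norm_minus_small with (2 * (M1 + M2)); intros e he.
destruct (generator_dense S hS x e he) as [h [hh hx1]].
set (x1 := / h *: sg_int S h x) in *.
destruct (generator_dense S hS x1 e he) as [h' [hh' hx2]].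
set (x2 := / h' *: sg_int S h' x1) in *.
assert (g1 : generator S x1 (/ h *: (S h x [-] x))).
  apply generator_rs; [apply sg_linear, hS | apply generator_sg_int; [easy | lra]].
assert (g2 : generator S x2 (/ h' *: (S h' x1 [-] x1))).
  apply generator_rs; [apply sg_linear, hS | apply generator_sg_int; [easy | lra]].
assert (e2 : S t x2 = T t x2).
  apply smooth with (1 := g2) (z := / h' *: (S h' (/ h *: (S h x [-] x))
    [-] / h *: (S h x [-] x))).
  apply generator_rs; [apply sg_linear, hS |].
  apply generator_minus; [apply sg_linear, hS | | exact g1].
  apply generator_orbit; [easy | lra | exact g1].
assert (hx : norm (x [-] x2) <= 2 * e).
  apply Rle_trans with (1 := norm_minus_triangle _ x1 _); lra.
replace (S t x [-] T t x) with (S t (x [-] x2) [-] T t (x [-] x2)).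
  apply Rle_trans with (1 := norm_minus_le _ _).
  assert (i1 := hS' t (x [-] x2) ltac:(lra)).
  assert (i2 := hT' t (x [-] x2) ltac:(lra)).
  assert (M1 * norm (x [-] x2) <= M1 * (2 * e)) by (apply Rmult_le_compat_l; lra).
  assert (M2 * norm (x [-] x2) <= M2 * (2 * e)) by (apply Rmult_le_compat_l; lra).
  lra.
rewrite (lin_minus _ (sg_linear S hS t ht)), (lin_minus _ (sg_linear T hT t ht)), e2.
vring.
Qed.

End Uniqueness.

(** * The extrapolation space *)

Section Extrapolation.
Context {k : scalar_kind} {X Xm1 : CompleteNormedModule (scalars k)}
  {A : X -> X -> Prop} {T : R -> X -> X} {j : X -> Xm1} {Tm1 : R -> Xm1 -> Xm1}.
Hypotheses (hA : generates A T) (hj : is_extrapolation_space A j)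
  (hTm1 : is_extension j T Tm1).

Lemma base_C0 : C0_semigroup T.
Proof. apply hA. Qed.

Lemma j_linear : is_linear j.
Proof. apply hj. Qed.

Lemma j_dense : forall (y : Xm1) eps, 0 < eps -> exists x, norm (y [-] j x) < eps.
Proof. apply hj. Qed.

(** The norm of j x is that of a vector Rl x of the domain of A, from which x is
    recovered as mu Rl x - A (Rl x).  Since Rl commutes with T, bounds for T in X
    become bounds in the norm of the extrapolation space. *)
Lemma resolvent_norm : exists (mu : scalars k) (Rl : X -> X),
  is_linear Rl /\ (forall x, norm (j x) = norm (Rl x)) /\
  (forall x, generator T (Rl x) (mu **: Rl x [-] x)) /\
  (forall t x, 0 <= t -> Rl (T t x) = T t (Rl x)).
Proof.
destruct hj as [_ [[mu [Rl [[hR1 [hR2 hR3]] hn]]] _]].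
assert (hg : forall x, generator T (Rl x) (mu **: Rl x [-] x)).
  intros x; destruct (hR2 x) as [w [hw hx]].
  change (mu **: Rl x [-] w = x) in hx.
  replace (mu **: Rl x [-] x) with w by (rewrite <- hx at 2; vring).
  apply hA, hw.
exists mu, Rl; repeat split; try easy; try apply hR1.
intros t x ht.
assert (hTt := sg_linear T base_C0 t ht).
rewrite <- (hR3 (T t (Rl x)) (T t (mu **: Rl x [-] x))).
  f_equal; change (T t x = mu **: T t (Rl x) [-] T t (mu **: Rl x [-] x)).
  rewrite <- (lin_scal _ hTt), <- (lin_minus _ hTt); f_equal; vring.
apply hA, generator_orbit; [apply base_C0 | easy | apply hg].
Qed.

(** If Rl u = 0 then A (Rl u) = - u, but A maps 0 to 0. *)
Lemma j_injective x y : j x = j y -> x = y.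
Proof.
intros h; apply eq_of_norm_minus_le0.
destruct resolvent_norm as [mu [Rl [hR [hn [hg _]]]]].
assert (hz : Rl (x [-] y) = [0]).
  apply eq_of_norm_minus_le0.
  replace (Rl (x [-] y) [-] [0]) with (Rl (x [-] y)) by vring.
  rewrite <- hn, (lin_minus _ j_linear), h.
  replace (j y [-] j y) with ([0] : Xm1) by vring; rewrite norm_zero'; lra.
specialize (hg (x [-] y)); rewrite hz, scal_zero in hg.
assert (hw : [0] [-] (x [-] y) = [0]).
  apply generator_unique with (1 := hg).
  replace ([0] : X) with (0 *: ([0] : X)) at 1 by vring.
  replace ([0] : X) with (0 *: ([0] [-] (x [-] y))) at 2 by vring.
  apply generator_rs; [apply sg_linear, base_C0 | exact hg].
assert (hxy : x [-] y = [0]).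
  transitivity ([0] [-] ([0] [-] (x [-] y))); [vring | rewrite hw; vring].
rewrite hxy, norm_zero'; lra.
Qed.

Lemma j_semigroup_bound t M x : 0 <= t -> (forall x, norm (T t x) <= M * norm x) ->
  norm (j (T t x)) <= M * norm (j x).
Proof.
intros ht hM; destruct resolvent_norm as [mu [Rl [_ [hn [_ hc]]]]].
rewrite !hn, hc by easy; apply hM.
Qed.

Lemma Tm1_linear t : 0 <= t -> is_linear (Tm1 t).
Proof. intros ht; apply hTm1, ht. Qed.

Lemma Tm1_j t x : 0 <= t -> Tm1 t (j x) = j (T t x).
Proof. intros ht; apply hTm1, ht. Qed.

End Extrapolation.

(** Algebraic identities and bounds pass from the dense range of j to Y by
    continuity; strong continuity passes thanks to the local bound. *)
Lemma extension_C0_semigroup {k : scalar_kind} {X Y : CompleteNormedModule (scalars k)}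
    (j : X -> Y) (S : R -> X -> X) (S' : R -> Y -> Y) :
  is_linear j -> (forall (y : Y) eps, 0 < eps -> exists x, norm (y [-] j x) < eps) ->
  C0_semigroup S -> is_extension j S S' ->
  (forall b, 0 <= b -> exists M, forall t x, 0 <= t <= b ->
     norm (j (S t x)) <= M * norm (j x)) ->
  C0_semigroup S' /\
  forall b, 0 <= b -> forall M, (forall t x, 0 <= t <= b ->
     norm (j (S t x)) <= M * norm (j x)) ->
     forall t y, 0 <= t <= b -> norm (S' t y) <= M * norm y.
Proof.
intros hj hd hS hS' hb.
assert (hbd : forall b, 0 <= b -> forall M, (forall t x, 0 <= t <= b ->
     norm (j (S t x)) <= M * norm (j x)) ->
     forall t y, 0 <= t <= b -> norm (S' t y) <= M * norm y).
{ intros b hb0 M hM t y ht; destruct (hS' t) as [hl he]; [lra |].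
  apply (dense_bound j hd); [exact hl |]; intros x; rewrite he; auto. }
split; [| exact hbd].
apply C0_semigroup_intro.
- intros t ht; apply hS', ht.
- intros y; apply (dense_linear_unique j hd (S' 0) (fun y => y)).
  + apply hS'; lra.
  + apply is_linear_id.
  + intros x; rewrite (proj2 (hS' 0 ltac:(lra))), (sg_zero S hS); reflexivity.
- intros s t y hs ht.
  apply (dense_linear_unique j hd (S' (s + t)) (fun y => S' s (S' t y))).
  + apply hS'; lra.
  + apply is_linear_compose; apply hS'; easy.
  + intros x; rewrite (proj2 (hS' (s + t) ltac:(lra))), (proj2 (hS' t ht)),
      (proj2 (hS' s hs)), (sg_plus S hS) by easy; reflexivity.
- intros b hb0; destruct (hb b hb0) as [M hM]; exists M.
  apply (hbd b hb0 M hM).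
- intros y eps he.
  destruct (hb 1) as [M hM]; [lra |].
  assert (hM' := hbd 1 ltac:(lra) M hM).
  pose proof (Rabs_pos M); pose proof (Rle_abs M).
  destruct (lin_bound _ hj) as [C [hC0 hC]].
  destruct (hd y (eps / (2 * (Rabs M + 1)))) as [x hx].
    apply Rdiv_lt_0_compat; lra.
  destruct (sg_cts S hS x 0 ltac:(lra) (eps / (2 * C))) as [d [hd1 hd2]].
    apply Rdiv_lt_0_compat; lra.
  exists (Rmin d 1); split; [apply Rmin_pos; lra |]; intros h hh.
  pose proof (Rmin_l d 1); pose proof (Rmin_r d 1).
  destruct (hS' h) as [hl hex]; [lra |].
  replace (S' h y [-] y) with
    (S' h (y [-] j x) [+] (j (S h x [-] x) [-] (y [-] j x)))
    by (rewrite (lin_minus _ hl), hex, (lin_minus _ hj); vring).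
  apply Rle_lt_trans with (1 := norm_plus_le _ _).
  pose proof (norm_minus_le (j (S h x [-] x)) (y [-] j x)).
  assert (h1 := hM' h (y [-] j x) ltac:(lra)).
  assert (h2 := hC (S h x [-] x)).
  assert (h3 := hd2 h ltac:(lra) ltac:(rewrite Rminus_0_r, Rabs_pos_eq; lra)).
  rewrite (sg_zero S hS) in h3.
  assert (C * norm (S h x [-] x) < eps / 2).
    replace (eps / 2) with (C * (eps / (2 * C))) by (field; lra).
    apply Rmult_lt_compat_l; lra.
  assert (M * norm (y [-] j x) + norm (y [-] j x) <= eps / 2).
    replace (eps / 2) with ((Rabs M + 1) * (eps / (2 * (Rabs M + 1)))) by (field; lra).
    pose proof (norm_nonneg (y [-] j x)).
    apply Rle_trans with ((Rabs M + 1) * norm (y [-] j x)); [nra |].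
    apply Rmult_le_compat_l; lra.
  lra.
Qed.

Section ExtrapolatedSemigroup.
Context {k : scalar_kind} {X Xm1 : CompleteNormedModule (scalars k)}
  {A : X -> X -> Prop} {T : R -> X -> X} {j : X -> Xm1} {Tm1 : R -> Xm1 -> Xm1}.
Hypotheses (hA : generates A T) (hj : is_extrapolation_space A j)
  (hTm1 : is_extension j T Tm1).

Lemma Tm1_C0 : C0_semigroup Tm1.
Proof.
apply (extension_C0_semigroup j T Tm1 (j_linear hj) (j_dense hj) (base_C0 hA) hTm1).
intros b hb; destruct (sg_bound T (base_C0 hA) b hb) as [M [_ hM]].
exists M; intros t x ht; apply (j_semigroup_bound hA hj); [lra | auto].
Qed.

(** Through the resolvent, the difference quotients of Tm1 at j x have the norms of
    those of T at a vector of the domain of A, which are averages of an orbit. *)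
Lemma extrapolated_generator_bound : exists C, 0 <= C /\
  forall x w, generator Tm1 (j x) w -> norm w <= C * norm x.
Proof.
destruct (sg_bound T (base_C0 hA) 1) as [M [hM1 hM]]; [lra |].
destruct (resolvent_norm hA hj) as [mu [Rl [hR [hn [hg hc]]]]].
destruct (lin_bound _ (j_linear hj)) as [Cj [hCj0 hCj]].
assert (hab : 0 <= abs mu) by apply abs_ge_0.
pose proof (Rmult_le_pos _ _ hab (Rlt_le _ _ hCj0)) as hpos.
exists (M * (abs mu * Cj + 1)); split; [apply Rmult_le_pos; lra |].
intros x w hw; apply generator_iff in hw.
apply (right_limit_norm_le (fun h => / h *: (Tm1 h (j x) [-] j x)) w _ 1);
  [lra | | exact hw].
intros h hh.
rewrite (Tm1_j hTm1), <- (lin_minus _ (j_linear hj)) by lra.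
assert (hi : 0 < / h) by (apply Rinv_0_lt_compat; lra).
rewrite norm_rs, Rabs_pos_eq, hn, (lin_minus _ hR), hc by lra.
rewrite <- (sg_int_of_generator T (base_C0 hA) h _ _ ltac:(lra) (hg x)).
apply Rmult_le_reg_l with h; [lra |].
rewrite <- Rmult_assoc, Rinv_r, Rmult_1_l by lra.
apply Rle_trans with (h * M * norm (mu **: Rl x [-] x)).
  apply sg_int_norm_le; [apply (base_C0 hA) | lra |]; intros; apply hM; lra.
rewrite !Rmult_assoc; apply Rmult_le_compat_l; [lra |].
apply Rmult_le_compat_l; [lra |].
apply Rle_trans with (1 := norm_minus_le _ _).
assert (norm (mu **: Rl x) <= abs mu * (Cj * norm x)).
  apply Rle_trans with (1 := @norm_scal _ X mu (Rl x)).
  apply Rmult_le_compat_l; [easy |]; rewrite <- hn; apply hCj.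
lra.
Qed.

(** By parts: with y = mu z - A z and norm z = norm (j y), the integral of the
    orbit of A z is a difference of orbit values. *)
Lemma rescaled_integral_bound (l t : R) : 0 <= t -> exists C, 0 <= C /\
  forall y, norm (sg_int (rescale l T) t y) <= C * norm (j y).
Proof.
intros ht.
destruct (resolvent_norm hA hj) as [mu [Rl [hR [hn [hg hc]]]]].
assert (hr := rescale_C0 T (base_C0 hA) l).
destruct (sg_bound _ hr t ht) as [M [hM1 hM]].
assert (hab : 0 <= abs mu) by apply abs_ge_0.
pose proof (Rabs_pos l) as hl.
assert (htM : 0 <= t * M) by (apply Rmult_le_pos; lra).
pose proof (Rmult_le_pos _ _ htM hab); pose proof (Rmult_le_pos _ _ hl htM).
exists (t * M * abs mu + (M + 1) + Rabs l * (t * M)); split; [lra |].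
intros y; rewrite hn; set (z := Rl y).
assert (hgz := generator_rescale T l _ _ (hg y)); fold z in hgz.
assert (hi := sg_int_of_generator _ hr t _ _ ht hgz).
assert (hlin := sg_int_linear _ hr t ht).
rewrite !(lin_minus _ hlin), !(lin_scal _ hlin) in hi.
replace (sg_int (rescale l T) t y) with
  (mu **: sg_int (rescale l T) t z [-]
   (rescale l T t z [-] z) [-] l *: sg_int (rescale l T) t z)
  by (rewrite <- hi; vring).
assert (h1 := sg_int_norm_le _ hr t M z ht hM).
assert (h2 := hM t z ltac:(lra)).
assert (h3 : norm (mu **: sg_int (rescale l T) t z) <= abs mu * (t * M * norm z)).
  apply Rle_trans with (1 := @norm_scal _ X mu _).
  apply Rmult_le_compat_l; easy.
assert (h4 : norm (l *: sg_int (rescale l T) t z) <= Rabs l * (t * M * norm z)).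
  rewrite norm_rs; apply Rmult_le_compat_l; easy.
apply Rle_trans with (1 := norm_minus_le _ _).
assert (h5 := norm_minus_le (mu **: sg_int (rescale l T) t z) (rescale l T t z [-] z)).
assert (h6 := norm_minus_le (rescale l T t z) z).
lra.
Qed.

End ExtrapolatedSemigroup.

(** * The Volterra equation of a Desch-Schappacher perturbation *)

Lemma op_norm_le {k : scalar_kind} {V W : NormedModule (scalars k)}
    (L : V -> W) (C : R) : (forall y, norm y <= 1 -> norm (L y) <= C) ->
  Rbar_le (op_norm L) C.
Proof.
intros h; apply (proj2 (Lub_Rbar_correct _)); intros r [y [hy ->]]; apply h, hy.
Qed.

Lemma op_norm_ge {k : scalar_kind} {V W : NormedModule (scalars k)}
    (L : V -> W) (C : R) y : Rbar_le (op_norm L) C -> norm y <= 1 -> norm (L y) <= C.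
Proof.
intros h hy.
assert (h' : Rbar_le (norm (L y)) (op_norm L)).
  apply (proj1 (Lub_Rbar_correct _)); exists y; auto.
exact (Rbar_le_trans _ _ _ h' h).
Qed.

Lemma sup_norm_le {k : scalar_kind} {V : NormedModule (scalars k)} t0
    (Q : R -> V -> V) (C : R) :
  (forall t y, 0 <= t <= t0 -> norm y <= 1 -> norm (Q t y) <= C) ->
  Rbar_le (sup_norm t0 Q) C.
Proof.
intros h; apply (proj2 (proj2_sig (Rbar_ex_lub _))); intros r [t [ht ->]].
apply op_norm_le; auto.
Qed.

Lemma sup_norm_ge {k : scalar_kind} {V : NormedModule (scalars k)} t0
    (Q : R -> V -> V) (C : R) t y : Rbar_le (sup_norm t0 Q) C -> 0 <= t <= t0 ->
  norm y <= 1 -> norm (Q t y) <= C.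
Proof.
intros h ht; apply op_norm_ge; apply Rbar_le_trans with (2 := h).
apply (proj1 (proj2_sig (Rbar_ex_lub _))); exists t; auto.
Qed.

Lemma norm_le_of_unit_ball {k : scalar_kind} {V W : NormedModule (scalars k)}
    (L : V -> W) C : (forall r x, L (r *: x) = r *: L x) ->
  (forall y, norm y <= 1 -> norm (L y) <= C) -> forall x, norm (L x) <= C * norm x.
Proof.
intros hh hb x; destruct (norm_nonneg x) as [hx | hx].
- assert (hi : 0 < / norm x) by (apply Rinv_0_lt_compat; easy).
  assert (h := hb (/ norm x *: x)).
  rewrite hh, !norm_rs, Rabs_pos_eq, Rinv_l in h by lra.
  specialize (h (Rle_refl 1)).
  apply Rmult_le_reg_l with (/ norm x); [easy |].
  replace (/ norm x * (C * norm x)) with C by (field; lra); exact h.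
- assert (x = [0]).
    apply eq_of_norm_minus_le0; replace (x [-] [0]) with x by vring; lra.
  replace x with (0 *: x) at 1 by (subst x; vring).
  rewrite hh, norm_rs, Rabs_R0, <- hx; lra.
Qed.

Lemma strongly_continuous_iff {k : scalar_kind} {V : NormedModule (scalars k)} t0
    (Q : R -> V -> V) :
  strongly_continuous t0 Q <->
  (forall t, 0 <= t <= t0 -> is_linear (Q t)) /\
  forall x, cts_on (fun t => 0 <= t <= t0) (fun t => Q t x).
Proof.
split; intros [h1 h2]; (split; [exact h1 |]); intros x; apply continuous_on_cts, h2.
Qed.

Lemma is_linear_limit {k : scalar_kind} {V W : NormedModule (scalars k)}
    (L : V -> W) (Ln : nat -> V -> W) (C : R) :
  (forall n, is_linear (Ln n)) ->
  (forall n x, norm (L x [-] Ln n x) <= C * (/ 2) ^ n * norm x) -> is_linear L.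
Proof.
intros hLn hlim.
destruct (lin_bound _ (hLn O)) as [C0 [_ hC0]].
assert (small : forall a e, 0 < e -> exists n, C * (/ 2) ^ n * a <= e).
  intros a e he; destruct (half_pow_small (C * a) e he) as [n hn]; exists n; lra.
apply is_linear_of_bound with (C0 + C).
- intros x y; apply eq_of_norm_minus_small with 1; intros e he.
  destruct (small (norm (x [+] y) + norm x + norm y) e he) as [n hn].
  replace (L (x [+] y) [-] (L x [+] L y)) with
    ((L (x [+] y) [-] Ln n (x [+] y)) [-] ((L x [-] Ln n x) [+] (L y [-] Ln n y)))
    by (rewrite (lin_plus _ (hLn n)); vring).
  apply Rle_trans with (1 := norm_minus_le _ _).
  pose proof (norm_plus_le (L x [-] Ln n x) (L y [-] Ln n y)).
  pose proof (hlim n x); pose proof (hlim n y); pose proof (hlim n (x [+] y)); lra.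
- intros a x; apply eq_of_norm_minus_small with 1; intros e he.
  destruct (small (norm (a **: x) + abs a * norm x) e he) as [n hn].
  replace (L (a **: x) [-] a **: L x) with
    ((L (a **: x) [-] Ln n (a **: x)) [-] a **: (L x [-] Ln n x))
    by (rewrite (lin_scal _ (hLn n)), scal_minus; vring).
  apply Rle_trans with (1 := norm_minus_le _ _).
  pose proof (@norm_scal _ W a (L x [-] Ln n x)).
  assert (0 <= abs a) by apply abs_ge_0.
  pose proof (Rmult_le_compat_l _ _ _ H0 (hlim n x)).
  pose proof (hlim n (a **: x)); lra.
- intros x; specialize (hlim O x); simpl in hlim; specialize (hC0 x).
  pose proof (norm_le_minus (L x) (Ln O x)); lra.
Qed.

Lemma cts_on_limit {k : scalar_kind} {V : NormedModule (scalars k)} (D : R -> Prop)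
    (f : R -> V) (fn : nat -> R -> V) (C : R) :
  (forall n, cts_on D (fn n)) ->
  (forall n t, D t -> norm (f t [-] fn n t) <= C * (/ 2) ^ n) -> cts_on D f.
Proof.
intros hfn hlim t ht eps he.
destruct (half_pow_small C (eps / 3)) as [n hn]; [lra |].
destruct (hfn n t ht (eps / 3)) as [d [hd hd']]; [lra |].
exists d; split; [easy |]; intros s hs hst.
replace (f s [-] f t) with
  ((f s [-] fn n s) [+] ((fn n s [-] fn n t) [-] (f t [-] fn n t))) by vring.
apply Rle_lt_trans with (1 := norm_plus_le _ _).
pose proof (norm_minus_le (fn n s [-] fn n t) (f t [-] fn n t)).
pose proof (hlim n s hs); pose proof (hlim n t ht); specialize (hd' s hs hst); lra.
Qed.

Section Volterra.
Context {k : scalar_kind} {X Xm1 : CompleteNormedModule (scalars k)}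
  {A : X -> X -> Prop} {T : R -> X -> X} {j : X -> Xm1} {Tm1 : R -> Xm1 -> Xm1}.
Hypotheses (hA : generates A T) (hj : is_extrapolation_space A j)
  (hTm1 : is_extension j T Tm1).

Implicit Types (D : X -> Xm1) (Q P : R -> X -> X).

Lemma volterra_minus t0 D Q P Q' P' : is_linear D ->
  is_volterra j Tm1 t0 D Q P -> is_volterra j Tm1 t0 D Q' P' ->
  is_volterra j Tm1 t0 D (fun t x => Q t x [-] Q' t x) (fun t x => P t x [-] P' t x).
Proof.
intros hD h h' t x ht.
rewrite (lin_minus _ (j_linear hj)).
apply integral_ext with (3 := integral_minus _ _ _ _ _ _ (h t x ht) (h' t x ht)).
  lra.
intros s hs; rewrite (lin_minus _ hD), (lin_minus _ (Tm1_linear hTm1 (t - s) ltac:(lra))).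
reflexivity.
Qed.

Lemma volterra_rs t0 D Q P r : is_linear D -> is_volterra j Tm1 t0 D Q P ->
  is_volterra j Tm1 t0 D (fun t x => r *: Q t x) (fun t x => r *: P t x).
Proof.
intros hD h t x ht.
rewrite (lin_scal _ (j_linear hj)).
apply integral_ext with (3 := integral_rs r _ _ _ _ (h t x ht)); [lra |].
intros s hs; rewrite (lin_scal _ hD), (lin_scal _ (Tm1_linear hTm1 (t - s) ltac:(lra))).
reflexivity.
Qed.

Lemma volterra_scale_operator t0 D Q P r : is_volterra j Tm1 t0 D Q P ->
  is_volterra j Tm1 t0 (fun x => r *: D x) Q (fun t x => r *: P t x).
Proof.
intros h t x ht.
rewrite (lin_scal _ (j_linear hj)).
apply integral_ext with (3 := integral_rs r _ _ _ _ (h t x ht)); [lra |].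
intros s hs; rewrite (lin_scal _ (Tm1_linear hTm1 (t - s) ltac:(lra))).
reflexivity.
Qed.

Lemma volterra_unique t0 D Q P P' t x : 0 <= t <= t0 ->
  is_volterra j Tm1 t0 D Q P -> is_volterra j Tm1 t0 D Q P' -> P t x = P' t x.
Proof.
intros ht h h'; apply (j_injective hA hj).
exact (integral_unique _ _ _ _ _ (h t x ht) (h' t x ht)).
Qed.

Lemma volterra_homogeneous t0 D Q P t r x : is_linear D ->
  strongly_continuous t0 Q -> is_volterra j Tm1 t0 D Q P -> 0 <= t <= t0 ->
  P t (r *: x) = r *: P t x.
Proof.
intros hD hQ h ht; apply (j_injective hA hj).
apply (integral_unique _ _ _ _ _ (h t (r *: x) ht)).
rewrite (lin_scal _ (j_linear hj)).
apply integral_ext with (3 := integral_rs r _ _ _ _ (h t x ht)); [lra |].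
intros s hs.
rewrite (lin_scal _ (proj1 hQ s ltac:(lra))), (lin_scal _ hD),
  (lin_scal _ (Tm1_linear hTm1 (t - s) ltac:(lra))).
reflexivity.
Qed.

Lemma volterra_integrand_cts t0 D Q t x : is_linear D -> strongly_continuous t0 Q ->
  0 <= t <= t0 ->
  cts_on (fun s => 0 <= s <= t) (fun s => Tm1 (t - s) (D (Q s x))).
Proof.
intros hD hQ ht; apply strongly_continuous_iff in hQ.
assert (hC := Tm1_C0 hA hj hTm1).
destruct (sg_bound Tm1 hC t) as [M [_ hM]]; [lra |].
apply (cts_on_apply _ (fun s => Tm1 (t - s)) (fun s => D (Q s x)) M).
- intros s hs; apply (Tm1_linear hTm1); lra.
- intros s y hs; apply hM; lra.
- intros y; apply (cts_on_comp (fun s => 0 <= s) _ (fun s => Tm1 s y) (fun s => t - s)).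
  + intros; lra.
  + intros s r _ _; replace (t - s - (t - r)) with (- (s - r)) by ring.
    rewrite Rabs_Ropp; lra.
  + apply (sg_cts Tm1 hC).
- destruct (lin_bound _ hD) as [C [hC0 hCD]].
  apply (cts_on_apply _ (fun _ => D) (fun s => Q s x) C); auto.
  + intros y; apply cts_on_const.
  + apply cts_on_subset with (2 := proj2 hQ x); intros; lra.
Qed.

Section Contraction.
Variables (t0 : R) (D0 : X -> Xm1).
Hypothesis hD0 : desch_schappacher j Tm1 t0 D0.

Lemma ds_linear : is_linear D0.
Proof. apply hD0. Qed.

Lemma ds_exists Q : strongly_continuous t0 Q ->
  exists P, strongly_continuous t0 P /\ is_volterra j Tm1 t0 D0 Q P.
Proof. apply hD0. Qed.

(** Membership in the class of perturbations enters the estimates only through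
    this bound.  The general K is reached from the unit ball of Q by scaling. *)
Lemma ds_bound Q P K : 0 < K ->
  strongly_continuous t0 Q -> is_volterra j Tm1 t0 D0 Q P ->
  (forall t x, 0 <= t <= t0 -> norm (Q t x) <= K * norm x) ->
  forall t x, 0 <= t <= t0 -> norm (P t x) <= K * norm x.
Proof.
intros hK hQ hP hb t x ht.
assert (hiK : 0 < / K) by (apply Rinv_0_lt_compat, hK).
assert (hV : Rbar_le (volterra_norm j Tm1 t0 D0) 1) by apply Rbar_lt_le, hD0.
assert (hQ' : strongly_continuous t0 (fun t x => / K *: Q t x)).
{ apply strongly_continuous_iff in hQ; apply strongly_continuous_iff.
  split; [intros s hs; apply is_linear_rs, hQ, hs |].
  intros y; apply (cts_on_apply _ (fun _ z => / K *: z) (fun s => Q s y) (/ K)).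
  - intros; apply (is_linear_rs (/ K) (fun z : X => z)), is_linear_id.
  - intros; rewrite norm_rs, Rabs_pos_eq; lra.
  - intros; apply cts_on_const.
  - apply hQ. }
assert (hP' : Rbar_le (sup_norm t0 (fun t x => / K *: P t x)) 1).
{ apply Rbar_le_trans with (2 := hV).
  apply (proj1 (proj2_sig (Rbar_ex_lub _))).
  exists (fun t x => / K *: Q t x), (fun t x => / K *: P t x).
  split; [exact hQ' |]; split; [| split; [| reflexivity]].
  2:{ apply volterra_rs; [apply ds_linear | easy]. }
  apply sup_norm_le; intros s y hs hy.
  rewrite norm_rs, Rabs_pos_eq by lra.
  apply Rmult_le_reg_l with K; [easy |].
  rewrite <- Rmult_assoc, Rinv_r, Rmult_1_l, Rmult_1_r by lra.
  apply Rle_trans with (1 := hb s y hs).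
  rewrite <- (Rmult_1_r K) at 2; apply Rmult_le_compat_l; lra. }
apply norm_le_of_unit_ball.
- intros r y; apply volterra_homogeneous with (2 := hQ) (3 := hP) (4 := ht), ds_linear.
- intros y hy; assert (h := sup_norm_ge _ _ _ t y hP' ht hy).
  cbv beta in h; rewrite norm_rs, Rabs_pos_eq in h by lra.
  apply Rmult_le_reg_l with (/ K); [easy |]; rewrite Rinv_l; lra.
Qed.

Lemma ds_scale c : 0 <= c <= / 2 ->
  desch_schappacher j Tm1 t0 (fun x => c *: D0 x).
Proof.
intros hc; split; [apply is_linear_rs, ds_linear |]; split.
- intros Q hQ; destruct (ds_exists Q hQ) as [P [hP hP']].
  exists (fun t x => c *: P t x); split; [| apply volterra_scale_operator, hP'].
  apply strongly_continuous_iff in hP; apply strongly_continuous_iff.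
  split; [intros s hs; apply is_linear_rs, hP, hs |].
  intros y; apply (cts_on_apply _ (fun _ z => c *: z) (fun s => P s y) c).
  + intros; apply (is_linear_rs c (fun z : X => z)), is_linear_id.
  + intros; rewrite norm_rs, Rabs_pos_eq; lra.
  + intros; apply cts_on_const.
  + apply hP.
- apply Rbar_le_lt_trans with (Finite (/ 2)); [| simpl; lra].
  apply (proj2 (proj2_sig (Rbar_ex_lub _))); intros r [Q [P [hQ [hQ1 [hP ->]]]]].
  apply sup_norm_le; intros t y ht hy.
  destruct (ds_exists Q hQ) as [P0 [_ hP0]].
  rewrite (volterra_unique _ _ _ _ _ t y ht hP (volterra_scale_operator _ _ _ _ c hP0)).
  rewrite norm_rs, Rabs_pos_eq by lra.
  assert (h : norm (P0 t y) <= 1 * norm y).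
    apply (ds_bound Q P0 1); try easy; [lra |].
    intros s x hs; apply norm_le_of_unit_ball.
      intros; apply (lin_scal _ (proj1 hQ s hs)).
    intros z hz; apply (sup_norm_ge _ _ _ s z hQ1 hs hz).
  apply Rle_trans with (/ 2 * 1); [| lra].
  apply Rmult_le_compat; try lra; apply norm_nonneg.
Qed.

(** Picard iteration for Q = T + c V Q.  The limit satisfies the equation because
    the Volterra operator itself is bounded: no integral has to be exchanged
    with a limit. *)
Lemma volterra_fixed_point c M : 0 <= c <= / 2 -> 0 < M ->
  (forall t x, 0 <= t <= t0 -> norm (T t x) <= M * norm x) ->
  exists Y, strongly_continuous t0 Y /\
    is_volterra j Tm1 t0 (fun x => c *: D0 x) Y (fun t x => Y t x [-] T t x) /\
    forall t x, 0 <= t <= t0 -> norm (Y t x) <= 2 * M * norm x /\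
      norm (Y t x [-] T t x) <= 2 * M * c * norm x.
Proof.
intros hc hM hT.
assert (hC0 := base_C0 hA).
destruct (choice (fun Q P => strongly_continuous t0 Q ->
  strongly_continuous t0 P /\ is_volterra j Tm1 t0 D0 Q P)) as [V hV].
{ intros Q; destruct (classic (strongly_continuous t0 Q)) as [hQ | hQ].
    destruct (ds_exists Q hQ) as [P hP]; exists P; auto.
  exists Q; easy. }
assert (hTs : strongly_continuous t0 T).
  apply strongly_continuous_iff; split.
    intros t ht; apply (sg_linear T hC0); lra.
  intros x; apply (sg_cts_on T hC0); lra.
assert (hscale : forall Q, strongly_continuous t0 Q ->
    strongly_continuous t0 (fun t x => T t x [+] c *: Q t x)).
{ intros Q hQ; apply strongly_continuous_iff in hQ; apply strongly_continuous_iff.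
  split.
    intros s hs; apply is_linear_sum; [apply hTs, hs |].
    apply is_linear_rs, hQ, hs.
  intros y; apply cts_on_plus; [apply (sg_cts_on T hC0); lra |].
  apply (cts_on_apply _ (fun _ z => c *: z) (fun s => Q s y) c).
  + intros; apply (is_linear_rs c (fun z : X => z)), is_linear_id.
  + intros; rewrite norm_rs, Rabs_pos_eq; lra.
  + intros; apply cts_on_const.
  + apply hQ. }
set (Y := fix Y n := match n with
  | O => T | S n => fun t x => T t x [+] c *: V (Y n) t x end).
assert (hY : forall n, strongly_continuous t0 (Y n)).
  induction n as [|n IH]; [exact hTs |].
  apply hscale; apply hV, IH.
assert (hminus : forall Q Q' K, 0 < K ->
    strongly_continuous t0 Q -> strongly_continuous t0 Q' ->
    (forall t x, 0 <= t <= t0 -> norm (Q t x [-] Q' t x) <= K * norm x) ->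
    forall t x, 0 <= t <= t0 -> norm (V Q t x [-] V Q' t x) <= K * norm x).
{ intros Q Q' K hK hQ hQ' hb.
  apply (ds_bound (fun t x => Q t x [-] Q' t x)
           (fun t x => V Q t x [-] V Q' t x) K); try easy.
  - apply strongly_continuous_iff in hQ, hQ'; apply strongly_continuous_iff.
    split; [intros s hs; apply is_linear_minus; [apply hQ | apply hQ']; easy |].
    intros y.
    apply cts_on_ext with (fun t => Q t y [+] (-1) *: Q' t y); [intros; vring |].
    apply cts_on_plus; [apply hQ |].
    apply (cts_on_apply _ (fun _ z => (-1) *: z) (fun s => Q' s y) 1).
    + intros; apply (is_linear_rs (-1) (fun z : X => z)), is_linear_id.
    + intros; rewrite norm_rs, Rabs_left; lra.
    + intros; apply cts_on_const.
    + apply hQ'.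
  - apply volterra_minus; [apply ds_linear | apply hV, hQ | apply hV, hQ']. }
assert (hstep : forall n t x, 0 <= t <= t0 ->
    norm (Y (S n) t x [-] Y n t x) <= M * (/ 2) ^ n / 2 * norm x).
{ induction n as [|n IH]; intros t x ht.
  - replace (Y 1%nat t x [-] Y O t x) with (c *: V T t x) by (simpl; vring).
    rewrite norm_rs, Rabs_pos_eq by lra.
    assert (h := ds_bound T (V T) M hM hTs (proj2 (hV T hTs)) hT t x ht).
    pose proof (norm_nonneg (V T t x)).
    simpl; apply Rle_trans with (/ 2 * norm (V T t x)); [| lra].
    apply Rmult_le_compat_r; lra.
  - replace (Y (S (S n)) t x [-] Y (S n) t x) with
      (c *: (V (Y (S n)) t x [-] V (Y n) t x)) by (simpl; vring).
    rewrite norm_rs, Rabs_pos_eq by lra.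
    assert (hp : 0 < M * (/ 2) ^ n / 2) by (pose proof (half_pow_pos n); nra).
    assert (h := hminus _ _ _ hp (hY (S n)) (hY n) IH t x ht).
    pose proof (norm_nonneg (V (Y (S n)) t x [-] V (Y n) t x)).
    simpl pow; apply Rle_trans with (/ 2 * norm (V (Y (S n)) t x [-] V (Y n) t x)).
      apply Rmult_le_compat_r; lra.
    lra. }
destruct (choice (fun (p : R * X) (l : X) => 0 <= fst p <= t0 -> forall n,
  norm (l [-] Y n (fst p) (snd p)) <= M * (/ 2) ^ n * norm (snd p))) as [L hL].
{ intros [t x]; simpl.
  destruct (classic (0 <= t <= t0)) as [ht | ht]; [| exists [0]; easy].
  destruct (nested_limit (fun n => Y n t x) (fun n => M * (/ 2) ^ n * norm x))
    as [l hl].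
  - intros n; apply Rle_trans with (1 := hstep n t x ht); lra.
  - intros n; simpl; lra.
  - exists l; auto. }
set (Z := fun t x => L (t, x)).
assert (hZ : forall t x n, 0 <= t <= t0 ->
    norm (Z t x [-] Y n t x) <= M * (/ 2) ^ n * norm x).
  intros t x n ht; apply (hL (t, x)), ht.
assert (hZs : strongly_continuous t0 Z).
{ apply strongly_continuous_iff; split.
  - intros t ht; apply is_linear_limit with (fun n => Y n t) M.
      intros n; apply hY, ht.
    intros n x; apply hZ, ht.
  - intros x; apply cts_on_limit with (fun n t => Y n t x) (M * norm x).
      intros n; apply (proj1 (strongly_continuous_iff _ _) (hY n)).
    intros n t ht; specialize (hZ t x n ht); lra. }
assert (hfix : forall t x, 0 <= t <= t0 -> Z t x [-] T t x = c *: V Z t x).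
{ intros t x ht; apply eq_of_norm_minus_small with 1; intros e he.
  destruct (half_pow_small (M * norm x) e he) as [n hn].
  replace (Z t x [-] T t x [-] c *: V Z t x) with
    ((Z t x [-] Y (S n) t x) [-] c *: (V Z t x [-] V (Y n) t x))
    by (simpl; vring).
  apply Rle_trans with (1 := norm_minus_le _ _).
  rewrite norm_rs, Rabs_pos_eq by lra.
  assert (hp : 0 < M * (/ 2) ^ n) by (pose proof (half_pow_pos n); nra).
  assert (h1 := hZ t x (S n) ht); simpl pow in h1.
  assert (h2 := hminus _ _ _ hp hZs (hY n) (fun t x => hZ t x n) t x ht).
  pose proof (norm_nonneg (V Z t x [-] V (Y n) t x)).
  assert (c * norm (V Z t x [-] V (Y n) t x) <=
    / 2 * norm (V Z t x [-] V (Y n) t x)) by (apply Rmult_le_compat_r; lra).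
  lra. }
assert (hZb : forall t x, 0 <= t <= t0 -> norm (Z t x) <= 2 * M * norm x).
  intros t x ht; specialize (hZ t x O ht); specialize (hT t x ht); simpl in hZ.
  pose proof (norm_le_minus (Z t x) (T t x)); lra.
exists Z; split; [exact hZs |]; split.
- intros t x ht; rewrite hfix by easy.
  apply (volterra_scale_operator _ _ _ _ c (proj2 (hV Z hZs)) t x ht).
- intros t x ht; split; [auto |].
  rewrite hfix, norm_rs, Rabs_pos_eq by lra.
  assert (h := ds_bound Z (V Z) (2 * M) ltac:(lra) hZs (proj2 (hV Z hZs)) hZb t x ht).
  apply Rle_trans with (c * (2 * M * norm x)); [| lra].
  apply Rmult_le_compat_l; lra.
Qed.

(** A solution of the homogeneous equation is its own image under a map of norm
    at most 1/2.  On a shorter interval it is continued by its last value. *)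
Lemma volterra_homogeneous_zero c t1 Q K : 0 <= c <= / 2 -> 0 <= t1 <= t0 -> 0 < K ->
  strongly_continuous t1 Q ->
  (forall t x, 0 <= t <= t1 -> norm (Q t x) <= K * norm x) ->
  is_volterra j Tm1 t1 (fun x => c *: D0 x) Q Q ->
  forall t x, 0 <= t <= t1 -> Q t x = [0].
Proof.
intros hc ht1 hK hQ hb hV t x ht.
set (Q' := fun s => Q (clamp 0 t1 s)).
assert (hQ' : strongly_continuous t0 Q').
{ apply strongly_continuous_iff in hQ; apply strongly_continuous_iff; split.
  - intros s _; apply hQ, clamp_in; lra.
  - intros y; apply cts_on_subset with (fun _ => True); [easy |].
    apply (cts_on_clamp 0 t1 (fun s => Q s y)); [lra | apply hQ]. }
destruct (ds_exists Q' hQ') as [P [_ hP]].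
assert (hQP : forall s y, 0 <= s <= t1 -> Q s y = c *: P s y).
{ intros s y hs; apply (j_injective hA hj).
  apply (integral_unique _ _ _ _ _ (hV s y hs)).
  apply integral_ext with
    (3 := volterra_scale_operator _ _ _ _ c hP s y ltac:(lra)); [lra |].
  intros r hr; unfold Q'; rewrite clamp_id by lra; reflexivity. }
assert (hn : forall n s y, 0 <= s <= t1 -> norm (Q s y) <= K * (/ 2) ^ n * norm y).
{ induction n as [|n IH]; intros s y hs.
    simpl; rewrite Rmult_1_r; auto.
  assert (hp : 0 < K * (/ 2) ^ n) by (pose proof (half_pow_pos n); nra).
  assert (h := ds_bound Q' P _ hp hQ' hP
    (fun r z _ => IH (clamp 0 t1 r) z (clamp_in 0 t1 r (proj1 ht1))) s y ltac:(lra)).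
  rewrite hQP, norm_rs, Rabs_pos_eq by lra; simpl pow.
  apply Rle_trans with (/ 2 * (K * (/ 2) ^ n * norm y)); [| lra].
  apply Rmult_le_compat; try lra; apply norm_nonneg. }
apply eq_of_norm_minus_small with 1; intros e he.
destruct (half_pow_small (K * norm x) e he) as [n hn'].
replace (Q t x [-] [0]) with (Q t x) by vring; specialize (hn n t x ht); lra.
Qed.

(** For fixed s the difference t |-> Y (t + s) - Y t Y s solves the homogeneous
    Volterra equation on [0, t0 - s]. *)
Lemma local_semigroup c Y L : 0 <= c <= / 2 -> 0 < L ->
  strongly_continuous t0 Y ->
  (forall t x, 0 <= t <= t0 -> norm (Y t x) <= L * norm x) ->
  is_volterra j Tm1 t0 (fun x => c *: D0 x) Y (fun t x => Y t x [-] T t x) ->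
  forall s t x, 0 <= s -> 0 <= t -> t + s <= t0 -> Y (t + s) x = Y t (Y s x).
Proof.
intros hc hL hY hb hV s t x hs ht hts.
set (D := fun x => c *: D0 x) in *.
assert (hD : is_linear D) by apply is_linear_rs, ds_linear.
assert (hYs : is_linear (Y s)) by (apply hY; lra).
assert (hYc := proj2 (proj1 (strongly_continuous_iff _ _) hY)).
set (Q := fun r x => Y (r + s) x [-] Y r (Y s x)).
assert (hQ : Q t x = [0]).
{ apply (volterra_homogeneous_zero c (t0 - s) Q (L + L * L)); try lra; try nra.
  - apply strongly_continuous_iff; split.
      intros r hr; apply is_linear_minus; [apply hY; lra |].
      apply is_linear_compose; [exact hYs | apply hY; lra].
    intros y; apply cts_on_ext with (fun r => Y (r + s) y [+] (-1) *: Y r (Y s y)).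
      intros; unfold Q; vring.
    apply cts_on_plus.
      apply (cts_on_comp (fun r => 0 <= r <= t0) _ (fun r => Y r y)
               (fun r => r + s)); [intros; lra | | apply hYc].
      intros a b _ _; replace (a + s - (b + s)) with (a - b) by ring; lra.
    apply (cts_on_apply _ (fun _ z => (-1) *: z) (fun r => Y r (Y s y)) 1).
    + intros; apply (is_linear_rs (-1) (fun z : X => z)), is_linear_id.
    + intros; rewrite norm_rs, Rabs_left; lra.
    + intros; apply cts_on_const.
    + apply cts_on_subset with (2 := hYc (Y s y)); intros; lra.
  - intros r y hr; unfold Q; apply Rle_trans with (1 := norm_minus_le _ _).
    assert (h1 := hb (r + s) y ltac:(lra)); assert (h2 := hb r (Y s y) ltac:(lra)).
    assert (h3 := hb s y ltac:(lra)).
    assert (L * norm (Y s y) <= L * (L * norm y)) by (apply Rmult_le_compat_l; lra).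
    lra.
  - intros r y hr.
    change (has_integral (fun q => Tm1 (r - q) (D (Q q y))) 0 r (j (Q r y))).
    (* The equation for Y (r + s) is cut at time s: the part before s is the image
       of the equation for Y s under Tm1 r. *)
    set (f := fun q => Tm1 (r + s - q) (D (Y q y))).
    assert (hf : cts_on (fun q => 0 <= q <= r + s) f).
      apply volterra_integrand_cts with t0; try easy; lra.
    assert (hrs : 0 <= r + s) by lra.
    assert (hf2 : has_integral f s (r + s) (integral f s (r + s))).
      apply integral_correct; [lra |].
      apply cts_on_subset with (2 := hf); intros; lra.
    assert (hf1 : has_integral f 0 s (Tm1 r (j (Y s y [-] T s y)))).
    { apply integral_ext with (fun q => Tm1 r (Tm1 (s - q) (D (Y q y)))); [lra | |].
        intros q hq; unfold f; rewrite <- (sg_plus Tm1 (Tm1_C0 hA hj hTm1)) by lra.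
        f_equal; ring.
      apply integral_linear; [apply (Tm1_linear hTm1); lra |].
      apply hV; lra. }
    assert (hf0 : has_integral f 0 (r + s) (j (Y (r + s) y [-] T (r + s) y))).
      apply hV; lra.
    assert (e := integral_unique _ _ _ _ _ hf0 (integral_chasles _ _ _ _ _ _ hf1 hf2)).
    assert (hf3 : has_integral (fun q => f (q + s)) 0 r (integral f s (r + s))).
      apply integral_shift; rewrite Rplus_0_l; exact hf2.
    assert (hf4 := hV r (Y s y) ltac:(lra)); cbv beta in hf4.
    assert (e' : j (Q r y) = integral f s (r + s) [-] j (Y r (Y s y) [-] T r (Y s y))).
    { unfold Q.
      rewrite (Tm1_j hTm1) in e by lra; rewrite !(lin_minus _ (j_linear hj)) in *.
      rewrite (lin_minus _ (sg_linear T (base_C0 hA) r ltac:(lra))),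
        (lin_minus _ (j_linear hj)), (sg_plus T (base_C0 hA)) in e by lra.
      replace (j (Y (r + s) y)) with
        (j (Y (r + s) y) [-] j (T r (T s y)) [+] j (T r (T s y))) by vring.
      rewrite e; vring. }
    rewrite e'.
    apply integral_ext with (3 := integral_minus _ _ _ _ _ _ hf3 hf4); [lra |].
    intros q hq; unfold f, Q.
    replace (r + s - (q + s)) with (r - q) by ring.
    rewrite (lin_minus _ hD), (lin_minus _ (Tm1_linear hTm1 (r - q) ltac:(lra))).
    reflexivity. }
unfold Q in hQ; apply eq_of_norm_minus_le0; rewrite hQ, norm_zero'; lra.
Qed.

End Contraction.
End Volterra.

(** * The perturbed semigroup and its generator *)

Section LocalSemigroup.
Context {k : scalar_kind} {X : CompleteNormedModule (scalars k)}
  (Y : R -> X -> X) (t0 L : R).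
Hypotheses (ht0 : 0 < t0) (hL : 0 <= L)
  (lin : forall t, 0 <= t <= t0 -> is_linear (Y t))
  (bound : forall t x, 0 <= t <= t0 -> norm (Y t x) <= L * norm x)
  (Y0 : forall x, Y 0 x = x)
  (law : forall s t x, 0 <= s -> 0 <= t -> t + s <= t0 -> Y (t + s) x = Y t (Y s x))
  (right0 : forall x, right_limit (fun h => Y h x) x).

Definition steps (n : nat) (h : R) (x : X) : X := Nat.iter n (Y h) x.

Lemma steps_mult_time n h x : 0 <= h -> INR n * h <= t0 ->
  steps n h x = Y (INR n * h) x.
Proof.
intros hh; induction n as [|n IH]; intros hn.
  simpl; rewrite Rmult_0_l, Y0; reflexivity.
rewrite S_INR in *; simpl; change (Y h (steps n h x) = Y ((INR n + 1) * h) x).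
pose proof (pos_INR n); assert (0 <= INR n * h) by (apply Rmult_le_pos; lra).
rewrite IH, <- law by lra; f_equal; ring.
Qed.

Lemma steps_mult n m h x : 0 <= h -> INR m * h <= t0 ->
  steps n (INR m * h) x = steps (n * m) h x.
Proof.
intros hh hm; induction n as [|n IH]; [reflexivity |].
simpl; change (Y (INR m * h) (steps n (INR m * h) x) = steps (m + n * m) h x).
rewrite IH, <- steps_mult_time by easy; unfold steps.
symmetry; apply Nat.iter_add.
Qed.

Lemma steps_independent n m t x : 0 <= t -> (0 < n)%nat -> (0 < m)%nat ->
  t <= INR n * t0 -> t <= INR m * t0 -> steps n (t / INR n) x = steps m (t / INR m) x.
Proof.
intros ht hn hm hnt hmt.
assert (hn' := lt_0_INR n hn); assert (hm' := lt_0_INR m hm).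
set (h := t / (INR n * INR m)).
assert (hh : 0 <= h) by (apply Rdiv_le_0_compat; nra).
replace (t / INR n) with (INR m * h) by (unfold h; field; lra).
replace (t / INR m) with (INR n * h) by (unfold h; field; lra).
rewrite !steps_mult; [f_equal; lia | easy | | easy |].
- apply Rmult_le_reg_l with (INR m); [easy |].
  replace (INR m * (INR n * h)) with t by (unfold h; field; lra); lra.
- apply Rmult_le_reg_l with (INR n); [easy |].
  replace (INR n * (INR m * h)) with t by (unfold h; field; lra); lra.
Qed.

Lemma steps_commute n a b x : 0 <= a -> 0 <= b -> a + b <= t0 ->
  steps n a (Y b x) = Y b (steps n a x).
Proof.
intros ha hb hab; induction n as [|n IH]; [reflexivity |].
simpl; change (Y a (steps n a (Y b x)) = Y b (Y a (steps n a x))).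
rewrite IH, <- !law by lra; f_equal; ring.
Qed.

Lemma steps_plus n a b x : 0 <= a -> 0 <= b -> a + b <= t0 ->
  steps n (a + b) x = steps n a (steps n b x).
Proof.
intros ha hb hab; induction n as [|n IH]; [reflexivity |].
simpl.
change (Y (a + b) (steps n (a + b) x) = Y a (steps n a (Y b (steps n b x)))).
rewrite IH, law, steps_commute by lra; reflexivity.
Qed.

Lemma steps_linear n h : 0 <= h <= t0 -> is_linear (steps n h).
Proof.
intros hh; induction n as [|n IH]; [apply is_linear_id |].
apply (is_linear_compose (steps n h) (Y h)); auto.
Qed.

Lemma steps_bound n h x : 0 <= h <= t0 -> norm (steps n h x) <= L ^ n * norm x.
Proof.
intros hh; induction n as [|n IH]; [simpl; lra |].
simpl pow; apply Rle_trans with (1 := bound h (steps n h x) hh).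
rewrite Rmult_assoc; apply Rmult_le_compat_l; easy.
Qed.

Lemma enough_steps b : exists n, (0 < n)%nat /\ b <= INR n * t0.
Proof.
destruct (INR_unbounded (Rabs (b / t0))) as [n hn].
exists (S n); split; [lia |].
rewrite S_INR; pose proof (Rle_abs (b / t0)).
apply Rle_trans with (b / t0 * t0); [right; field; lra |].
apply Rmult_le_compat_r; lra.
Qed.

Lemma div_steps n t : 0 <= t -> (0 < n)%nat -> t <= INR n * t0 ->
  0 <= t / INR n <= t0.
Proof.
intros ht hn h; assert (hn' := lt_0_INR n hn); split.
  apply Rdiv_le_0_compat; easy.
apply Rmult_le_reg_l with (INR n); [easy |].
replace (INR n * (t / INR n)) with t by (field; lra); easy.
Qed.

(** S t is the n-th power of Y (t / n) for any n with t <= n t0.  Two choices of n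
    agree through their common refinement, and since the steps commute a common n
    for s, t and s + t gives the semigroup law. *)
Lemma extend_local_semigroup : exists S : R -> X -> X, C0_semigroup S /\
  forall t x, 0 <= t <= t0 -> S t x = Y t x.
Proof.
destruct (choice (fun b n => (0 < n)%nat /\ b <= INR n * t0) enough_steps)
  as [N hN].
set (S := fun t x => steps (N t) (t / INR (N t)) x).
assert (hS : forall n t x, 0 <= t -> (0 < n)%nat -> t <= INR n * t0 ->
    S t x = steps n (t / INR n) x).
  intros n t x ht hn hnt; apply steps_independent; try easy; apply hN.
assert (hSY : forall t x, 0 <= t <= t0 -> S t x = Y t x).
  intros t x ht; rewrite (hS 1%nat) by (simpl; lra || lia).
  simpl; rewrite Rdiv_1_r; reflexivity.
exists S; split; [| exact hSY].
apply C0_semigroup_intro.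
- intros t ht; destruct (hN t) as [h1 h2].
  apply (steps_linear (N t)), div_steps; easy.
- intros x; rewrite hSY, Y0 by lra; reflexivity.
- intros s t x hs ht; destruct (hN (s + t)) as [h1 h2].
  assert (hn := lt_0_INR _ h1); set (n := N (s + t)) in *.
  rewrite !(hS n) by lra || easy.
  replace ((s + t) / INR n) with (s / INR n + t / INR n) by (field; lra).
  apply steps_plus; try (apply Rdiv_le_0_compat; easy).
  rewrite <- Rdiv_plus_distr; apply div_steps; lra || easy.
- intros b hb; destruct (hN b) as [h1 h2].
  exists (L ^ N b); intros t x ht.
  rewrite (hS (N b)) by lra || easy.
  apply steps_bound, div_steps; lra || easy.
- intros x; apply right_limit_ext with (2 := fun h hh =>
    eq_sym (hSY h x (conj (Rlt_le _ _ (proj1 hh)) (Rlt_le _ _ (proj2 hh))))); auto.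
Qed.

End LocalSemigroup.

Section Perturbation.
Context {k : scalar_kind} {X Xm1 : CompleteNormedModule (scalars k)}
  {A : X -> X -> Prop} {T : R -> X -> X} {j : X -> Xm1} {Tm1 : R -> Xm1 -> Xm1}.
Hypotheses (hA : generates A T) (hj : is_extrapolation_space A j)
  (hTm1 : is_extension j T Tm1).
Variables (t0 : R) (D0 : X -> Xm1).
Hypotheses (ht0 : 0 < t0) (hD0 : desch_schappacher j Tm1 t0 D0).

Lemma perturbed_semigroup c M : 0 <= c <= / 2 -> 0 < M ->
  (forall t x, 0 <= t <= t0 -> norm (T t x) <= M * norm x) ->
  exists S, C0_semigroup S /\
    is_volterra j Tm1 t0 (fun x => c *: D0 x) S (fun t x => S t x [-] T t x) /\
    forall t x, 0 <= t <= t0 -> norm (S t x) <= 2 * M * norm x /\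
      norm (S t x [-] T t x) <= 2 * M * c * norm x.
Proof.
intros hc hM hT.
destruct (volterra_fixed_point hA hj hTm1 t0 D0 hD0 c M hc hM hT)
  as [Y [hY [hV hb]]].
assert (hYc := proj2 (proj1 (strongly_continuous_iff _ _) hY)).
assert (hY0 : forall x, Y 0 x = x).
{ intros x; assert (h := hV 0 x ltac:(lra)).
  assert (e := integral_unique _ _ _ _ _ h (integral_point _ 0)).
  rewrite <- (lin_zero _ (j_linear hj)) in e; apply (j_injective hA hj) in e.
  rewrite (sg_zero T (base_C0 hA)) in e.
  replace (Y 0 x) with (Y 0 x [-] x [+] x) by vring; rewrite e; vring. }
destruct (extend_local_semigroup Y t0 (2 * M)) as [S [hS hSY]]; try lra; try easy.
- apply hY.
- intros t x ht; apply hb, ht.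
- apply (local_semigroup hA hj hTm1 t0 D0 hD0 c Y (2 * M)); try easy; [lra |].
  intros t x ht; apply hb, ht.
- intros x eps he; destruct (hYc x 0 ltac:(lra) eps he) as [d [hd hd']].
  exists (Rmin d t0); split; [apply Rmin_pos; easy |]; intros h hh.
  pose proof (Rmin_l d t0); pose proof (Rmin_r d t0).
  rewrite <- (hY0 x) at 2; apply hd'; [lra |].
  rewrite Rminus_0_r, Rabs_pos_eq; lra.
- exists S; split; [exact hS |]; split.
  + intros t x ht; rewrite hSY by easy.
    apply integral_ext with (3 := hV t x ht); [lra |].
    intros s hs; rewrite hSY by lra; reflexivity.
  + intros t x ht; rewrite hSY by easy; apply hb, ht.
Qed.

(** The Laplace transform of Tm1 s D0 truncated to [0, t0] takes values in X and is
    a contraction there: it is the Volterra operator at time t0, applied to the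
    scalar function s |-> exp (- l (t0 - s)) times the identity. *)
Lemma volterra_of_exponential l : 0 <= l -> exists p : X -> X, forall x,
  norm (p x) <= norm x /\ sg_int (rescale l Tm1) t0 (D0 x) = j (p x).
Proof.
intros hl.
set (Q := fun (s : R) (x : X) => exp (- l * (t0 - s)) *: x).
assert (hcts : forall x, cts_on (fun t => 0 <= t <= t0) (fun s => Q s x)).
{ intros x t _ eps he; pose proof (norm_nonneg x).
  assert (hc : continuity_pt (fun s => exp (- l * (t0 - s))) t).
    apply derivable_continuous_pt; reg.
  destruct (hc (eps / (norm x + 1))) as [d [hd hd']].
    apply Rdiv_lt_0_compat; lra.
  exists d; split; [easy |]; intros s _ hst; unfold Q.
  destruct (Req_dec t s) as [-> | hne].
    match goal with |- norm (?a [-] ?a) < _ =>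
      replace (a [-] a) with ([0] : X) by vring end.
    rewrite norm_zero'; easy.
  assert (h := hd' s (conj (conj I hne) hst)); simpl in h; unfold R_dist in h.
  match goal with |- norm (?a *: x [-] ?b *: x) < _ =>
    replace (a *: x [-] b *: x) with ((a - b) *: x) by vring end.
  rewrite norm_rs.
  replace eps with (eps / (norm x + 1) * (norm x + 1)) by (field; lra).
  apply Rle_lt_trans with (eps / (norm x + 1) * norm x).
    apply Rmult_le_compat_r; [easy | left; exact h].
  apply Rmult_lt_compat_l; [apply Rdiv_lt_0_compat |]; lra. }
assert (hQ : strongly_continuous t0 Q).
{ apply strongly_continuous_iff; split; [| exact hcts].
  intros t _; apply (is_linear_rs _ (fun x : X => x)), is_linear_id. }
destruct (ds_exists t0 D0 hD0 Q hQ) as [P [_ hP]].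
exists (P t0); intros x; split.
- rewrite <- (Rmult_1_l (norm x)).
  apply (ds_bound hA hj hTm1 t0 D0 hD0 Q P 1); try easy; try lra.
  intros t y ht; unfold Q; rewrite norm_rs, Rabs_pos_eq by (left; apply exp_pos).
  apply Rmult_le_compat_r; [apply norm_nonneg |].
  rewrite <- exp_0.
  assert (hle : - l * (t0 - t) <= 0) by nra.
  destruct hle as [hlt | ->]; [left; apply exp_increasing, hlt | right; easy].
- assert (hr := rescale_C0 Tm1 (Tm1_C0 hA hj hTm1) l).
  apply (integral_unique _ _ _ _ _ (sg_int_correct _ hr t0 (D0 x) ltac:(lra))).
  assert (h := integral_reflect _ _ _ (hP t0 x ltac:(lra))).
  apply integral_ext with (3 := h); [lra |].
  intros s hs; unfold Q, rescale.
  replace (t0 - (t0 - s)) with s by ring.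
  rewrite (lin_scal _ (ds_linear t0 D0 hD0)), (lin_scal _ (Tm1_linear hTm1 s ltac:(lra))).
  reflexivity.
Qed.

Notation AD c := (perturbed_generator j Tm1 (fun x => c *: D0 x)).

(** The resolvent equation of the perturbed operator, integrated over [0, t0]
    against exp (- l s) T s. *)
Lemma perturbed_resolvent_identity l : 0 <= l -> exists p : X -> X,
  (forall x, norm (p x) <= norm x) /\
  forall c (x y : X), AD c x (l *: x [-] y) ->
    x = exp (- l * t0) *: T t0 x [+] c *: p x [+] sg_int (rescale l T) t0 y.
Proof.
intros hl; destruct (volterra_of_exponential l hl) as [p hp].
exists p; split; [intros x; apply hp |]; intros c x y [w [hw hx]].
change (w [+] c *: D0 x = j (l *: x [-] y)) in hx.
assert (hC := Tm1_C0 hA hj hTm1).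
assert (hr := rescale_C0 Tm1 hC l).
assert (hi := sg_int_of_generator _ hr t0 _ _ ltac:(lra)
  (generator_rescale Tm1 l _ _ hw)).
assert (hlin := sg_int_linear _ hr t0 ltac:(lra)).
replace (w [-] l *: j x) with ((-1) *: j y [-] c *: D0 x) in hi.
2:{ rewrite (lin_minus _ (j_linear hj)), (lin_scal _ (j_linear hj)) in hx.
    replace w with (w [+] c *: D0 x [-] c *: D0 x) by vring; rewrite hx; vring. }
rewrite (lin_minus _ hlin), !(lin_scal _ hlin), (proj2 (hp x)) in hi.
assert (hy : sg_int (rescale l Tm1) t0 (j y) = j (sg_int (rescale l T) t0 y)).
{ apply (integral_unique _ _ _ _ _ (sg_int_correct _ hr t0 (j y) ltac:(lra))).
  apply integral_ext with (fun s => j (rescale l T s y)); [lra | |].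
    intros s hs; unfold rescale.
    rewrite (lin_scal _ (j_linear hj)), (Tm1_j hTm1) by lra; reflexivity.
  apply integral_linear; [apply (j_linear hj) |].
  apply sg_int_correct; [apply rescale_C0, (base_C0 hA) | lra]. }
rewrite hy in hi; unfold rescale at 2 in hi; rewrite (Tm1_j hTm1) in hi by lra.
apply (j_injective hA hj).
rewrite !(lin_plus _ (j_linear hj)), !(lin_scal _ (j_linear hj)).
replace (j x) with (exp (- l * t0) *: j (T t0 x) [-]
  (exp (- l * t0) *: j (T t0 x) [-] j x)) by vring.
rewrite <- hi; vring.
Qed.

Section LargeLambda.
Variables (M l : R).
Hypotheses (hM : 0 < M) (hT : forall t x, 0 <= t <= t0 -> norm (T t x) <= M * norm x)
  (hl : 0 <= l) (hlM : exp (- l * t0) * (2 * M) <= / 4).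

Lemma exp_T_bound x : norm (exp (- l * t0) *: T t0 x) <= / 8 * norm x.
Proof.
rewrite norm_rs, Rabs_pos_eq by (left; apply exp_pos).
assert (h := hT t0 x ltac:(lra)); pose proof (exp_pos (- l * t0)).
pose proof (norm_nonneg x).
apply Rle_trans with (exp (- l * t0) * (M * norm x)).
  apply Rmult_le_compat_l; lra.
rewrite <- Rmult_assoc; apply Rmult_le_compat_r; lra.
Qed.

(** Both estimates compare x with its own image in the integrated equation,
    whose terms other than the datum y are contractions. *)
Lemma perturbed_resolvent_bound : exists C, 0 <= C /\
  (forall c (x y : X), 0 <= c <= / 4 -> AD c x (l *: x [-] y) ->
     norm x <= C * norm (j y)) /\
  (forall c (x x' y : X), 0 <= c <= / 4 ->
     AD c x (l *: x [-] y) -> AD 0 x' (l *: x' [-] y) ->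
     norm (x [-] x') <= C * c * norm (j y)).
Proof.
destruct (perturbed_resolvent_identity l hl) as [p [hp hid]].
destruct (rescaled_integral_bound hA hj l t0) as [C [hC0 hC]]; [lra |].
assert (h1 : forall c (x y : X), 0 <= c <= / 4 -> AD c x (l *: x [-] y) ->
    norm x <= 2 * C * norm (j y)).
{ intros c x y hc hx.
  pose proof (Rmult_le_pos _ _ hC0 (norm_nonneg (j y))).
  assert (hle : norm x <= / 8 * norm x + / 4 * norm x + C * norm (j y)); [| lra].
  rewrite (hid c x y hx) at 1.
  apply Rle_trans with (1 := norm_plus_le _ _).
  apply Rplus_le_compat; [| apply hC].
  apply Rle_trans with (1 := norm_plus_le _ _).
  apply Rplus_le_compat; [apply exp_T_bound |].
  rewrite norm_rs, Rabs_pos_eq by lra.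
  apply Rmult_le_compat; try lra; [apply norm_nonneg | apply hp]. }
exists (4 * C); split; [lra |]; split.
- intros c x y hc hx; apply Rle_trans with (1 := h1 c x y hc hx).
  pose proof (Rmult_le_pos _ _ hC0 (norm_nonneg (j y))); lra.
- intros c x x' y hc hx hx'.
  assert (e : x [-] x' = exp (- l * t0) *: T t0 (x [-] x') [+] c *: p x).
  { rewrite (lin_minus _ (sg_linear T (base_C0 hA) t0 ltac:(lra))).
    rewrite (hid c x y hx) at 1; rewrite (hid 0 x' y hx') at 1; vring. }
  assert (b := h1 c x y hc hx).
  assert (hle : norm (x [-] x') <= / 8 * norm (x [-] x') + c * norm x).
  { rewrite e at 1; apply Rle_trans with (1 := norm_plus_le _ _).
    apply Rplus_le_compat; [apply exp_T_bound |].
    rewrite norm_rs, Rabs_pos_eq by lra.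
    apply Rmult_le_compat_l; [lra | apply hp]. }
  assert (c * norm x <= c * (2 * C * norm (j y))) by (apply Rmult_le_compat_l; lra).
  pose proof (norm_nonneg (x [-] x')).
  pose proof (Rmult_le_pos _ _ (proj1 hc) (Rmult_le_pos _ _ hC0 (norm_nonneg (j y)))).
  lra.
Qed.

Lemma perturbed_generator_minus c (x y x' y' : X) :
  AD c x y -> AD c x' y' -> AD c (x [-] x') (y [-] y').
Proof.
intros [w [hw hx]] [w' [hw' hx']].
change (w [+] c *: D0 x = j y) in hx; change (w' [+] c *: D0 x' = j y') in hx'.
exists (w [-] w'); split.
  rewrite (lin_minus _ (j_linear hj)).
  apply generator_minus; [apply (Tm1_linear hTm1) | easy | easy].
change (w [-] w' [+] c *: D0 (x [-] x') = j (y [-] y')).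
rewrite (lin_minus _ (ds_linear t0 D0 hD0)), (lin_minus _ (j_linear hj)), <- hx, <- hx'.
vring.
Qed.

Lemma perturbed_resolvent_unique c (x x' y : X) : 0 <= c <= / 4 ->
  AD c x (l *: x [-] y) -> AD c x' (l *: x' [-] y) -> x = x'.
Proof.
intros hc hx hx'.
destruct perturbed_resolvent_bound as [C [hC [hb _]]].
apply eq_of_norm_minus_le0.
replace 0 with (C * norm (j [0]))
  by (rewrite (lin_zero _ (j_linear hj)), norm_zero'; ring).
apply (hb c); [easy |].
replace (l *: (x [-] x') [-] [0]) with (l *: x [-] y [-] (l *: x' [-] y)) by vring.
apply perturbed_generator_minus; easy.
Qed.

(** In the Volterra equation at time h, divided by h, the mean of the integrand
    tends to D x in the extrapolation space; hence the difference quotient of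
    Tm1 at j x converges when that of S at x does. *)
Lemma generator_perturbed c S : 0 <= c <= / 2 -> C0_semigroup S ->
  is_volterra j Tm1 t0 (fun x => c *: D0 x) S (fun t x => S t x [-] T t x) ->
  forall x y, generator S x y -> AD c x y.
Proof.
intros hc hS hV x y hg.
set (D := fun x => c *: D0 x) in *.
assert (hD : is_linear D) by apply is_linear_rs, (ds_linear t0 D0 hD0).
exists (j y [-] D x); split; [| change (j y [-] D x [+] D x = j y); vring].
apply generator_iff in hg; apply generator_iff.
assert (hC := Tm1_C0 hA hj hTm1).
assert (hmean : right_limit (fun h => / h *: j (S h x [-] T h x)) (D x)).
{ intros eps he.
  destruct (sg_bound Tm1 hC t0) as [N [hN1 hN]]; [lra |].
  destruct (lin_bound _ hD) as [K [hK0 hK]].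
  assert (hNK : 0 < N * K) by (apply Rmult_lt_0_compat; lra).
  destruct (sg_cts S hS x 0 ltac:(lra) (eps / 4 / (N * K))) as [d1 [hd1 hd1']].
    apply Rdiv_lt_0_compat; lra.
  destruct (sg_cts Tm1 hC (D x) 0 ltac:(lra) (eps / 4)) as [d2 [hd2 hd2']]; [lra |].
  exists (Rmin (Rmin d1 d2) t0); split; [repeat apply Rmin_pos; easy |].
  intros h hh.
  pose proof (Rmin_l (Rmin d1 d2) t0); pose proof (Rmin_r (Rmin d1 d2) t0).
  pose proof (Rmin_l d1 d2); pose proof (Rmin_r d1 d2).
  assert (hn : norm (j (S h x [-] T h x) [-] h *: D x) <= h * (eps / 2)).
  { apply integral_near_const with (3 := hV h x ltac:(lra)); [lra |].
    intros s hs.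
    assert (hts : 0 <= h - s) by lra.
    replace (Tm1 (h - s) (D (S s x)) [-] D x) with
      (Tm1 (h - s) (D (S s x [-] x)) [+] (Tm1 (h - s) (D x) [-] D x))
      by (rewrite (lin_minus _ hD), (lin_minus _ (Tm1_linear hTm1 (h - s) hts)); vring).
    apply Rle_trans with (1 := norm_plus_le _ _).
    assert (b1 := hN (h - s) (D (S s x [-] x)) ltac:(lra)).
    assert (b2 := hK (S s x [-] x)).
    assert (b3 := hd1' s ltac:(lra) ltac:(rewrite Rminus_0_r, Rabs_pos_eq; lra)).
    assert (b4 := hd2' (h - s) hts ltac:(rewrite Rminus_0_r, Rabs_pos_eq; lra)).
    rewrite (sg_zero S hS) in b3; rewrite (sg_zero Tm1 hC) in b4.
    assert (b5 : N * norm (D (S s x [-] x)) <= N * (K * norm (S s x [-] x)))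
      by (apply Rmult_le_compat_l; lra).
    assert (b6 : N * K * norm (S s x [-] x) <= N * K * (eps / 4 / (N * K)))
      by (apply Rmult_le_compat_l; lra).
    replace (N * K * (eps / 4 / (N * K))) with (eps / 4) in b6 by (field; lra).
    lra. }
  replace (/ h *: j (S h x [-] T h x) [-] D x) with
    (/ h *: (j (S h x [-] T h x) [-] h *: D x)) by vfield.
  assert (0 < / h) by (apply Rinv_0_lt_compat; lra).
  rewrite norm_rs, Rabs_pos_eq by lra.
  apply Rle_lt_trans with (/ h * (h * (eps / 2))).
    apply Rmult_le_compat_l; lra.
  rewrite <- Rmult_assoc, Rinv_l; lra. }
apply right_limit_ext with (delta := 1)
  (3 := right_limit_minus _ _ _ _ (right_limit_linear j _ _ (j_linear hj) hg) hmean);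
  [lra |].
intros h hh; rewrite (Tm1_j hTm1) by lra.
rewrite (lin_scal _ (j_linear hj)), !(lin_minus _ (j_linear hj)); vring.
Qed.

(** The generator of S is contained in the perturbed operator; since l minus the
    former is onto and l minus the latter is injective, they coincide. *)
Lemma perturbed_generates c S : 0 <= c <= / 4 -> C0_semigroup S ->
  is_volterra j Tm1 t0 (fun x => c *: D0 x) S (fun t x => S t x [-] T t x) ->
  (forall x, norm (S t0 x) <= 2 * M * norm x) ->
  generates (AD c) S.
Proof.
intros hc hS hV hb; split; [exact hS |].
assert (hsub := generator_perturbed c S ltac:(lra) hS hV).
intros x y; split; [intros hx | apply hsub].
destruct (generator_range S l t0 (2 * M) hS ltac:(lra) hb ltac:(lra) (l *: x [-] y))
  as [x' hx'].
assert (e : x = x').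
  apply (perturbed_resolvent_unique c _ _ (l *: x [-] y)); [easy | | apply hsub, hx'].
  replace (l *: x [-] (l *: x [-] y)) with y by vring; exact hx.
rewrite <- e in hx'.
replace y with (l *: x [-] (l *: x [-] y)) by vring; exact hx'.
Qed.

End LargeLambda.
End Perturbation.

(** * Dependence on the size of the perturbation *)

Section Powers.
Context {k : scalar_kind} {X : CompleteNormedModule (scalars k)}.

Lemma sg_power_bound (S : R -> X -> X) h L n x : C0_semigroup S -> 0 <= h -> 0 <= L ->
  (forall y, norm (S h y) <= L * norm y) ->
  norm (S (INR n * h) x) <= L ^ n * norm x.
Proof.
intros hS hh hL hb; induction n as [|n IH].
  simpl; rewrite Rmult_0_l, (sg_zero S hS); lra.
rewrite S_INR; replace ((INR n + 1) * h) with (h + INR n * h) by ring.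
rewrite (sg_plus S hS) by (try apply Rmult_le_pos; easy || apply pos_INR).
apply Rle_trans with (1 := hb _); simpl; rewrite Rmult_assoc.
apply Rmult_le_compat_l; easy.
Qed.

Lemma sg_power_difference (S S' : R -> X -> X) h L eps n x :
  C0_semigroup S -> C0_semigroup S' -> 0 <= h -> 1 <= L -> 0 <= eps ->
  (forall y, norm (S h y) <= L * norm y) ->
  (forall y, norm (S' h y) <= L * norm y) ->
  (forall y, norm (S h y [-] S' h y) <= eps * norm y) ->
  norm (S (INR n * h) x [-] S' (INR n * h) x) <= INR n * L ^ n * eps * norm x.
Proof.
intros hS hS' hh hL he hb hb' hd; induction n as [|n IH].
  simpl; rewrite !Rmult_0_l, (sg_zero S hS), (sg_zero S' hS').
  replace (x [-] x) with ([0] : X) by vring; rewrite norm_zero'; lra.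
assert (hn := pos_INR n); assert (hnh : 0 <= INR n * h) by (apply Rmult_le_pos; easy).
rewrite S_INR; replace ((INR n + 1) * h) with (h + INR n * h) by ring.
rewrite (sg_plus S hS), (sg_plus S' hS') by easy.
replace (S h (S (INR n * h) x) [-] S' h (S' (INR n * h) x)) with
  (S h (S (INR n * h) x [-] S' (INR n * h) x) [+]
   (S h (S' (INR n * h) x) [-] S' h (S' (INR n * h) x)))
  by (rewrite (lin_minus _ (sg_linear S hS h hh)); vring).
apply Rle_trans with (1 := norm_plus_le _ _).
assert (h1 := hb (S (INR n * h) x [-] S' (INR n * h) x)).
assert (h2 := hd (S' (INR n * h) x)).
assert (h3 := sg_power_bound S' h L n x hS' hh ltac:(lra) hb').
assert (h4 : L * norm (S (INR n * h) x [-] S' (INR n * h) x) <=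
  L * (INR n * L ^ n * eps * norm x)) by (apply Rmult_le_compat_l; lra).
assert (h5 : eps * norm (S' (INR n * h) x) <= eps * (L ^ n * norm x))
  by (apply Rmult_le_compat_l; easy).
assert (h6 : eps * (L ^ n * norm x) <= L * (eps * (L ^ n * norm x))).
  rewrite <- (Rmult_1_l (eps * _)) at 1; apply Rmult_le_compat_r; [| easy].
  apply Rmult_le_pos; [easy |].
  apply Rmult_le_pos; [apply pow_le; lra | apply norm_nonneg].
simpl pow; lra.
Qed.

Lemma sg_int_difference (S S' : R -> X -> X) t K x :
  C0_semigroup S -> C0_semigroup S' -> 0 <= t ->
  (forall s, 0 <= s <= t -> norm (S s x [-] S' s x) <= K) ->
  norm (sg_int S t x [-] sg_int S' t x) <= t * K.
Proof.
intros hS hS' ht hb; replace t with (t - 0) at 3 by ring.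
apply integral_norm_le with
  (3 := integral_minus _ _ _ _ _ _ (sg_int_correct S hS t x ht)
          (sg_int_correct S' hS' t x ht)); auto.
Qed.

End Powers.

Section PerturbedFamily.
Context {k : scalar_kind} {X Xm1 : CompleteNormedModule (scalars k)}
  {A : X -> X -> Prop} {T : R -> X -> X} {j : X -> Xm1} {Tm1 : R -> Xm1 -> Xm1}.
Hypotheses (hA : generates A T) (hj : is_extrapolation_space A j)
  (hTm1 : is_extension j T Tm1).
Variables (t0 : R) (D0 : X -> Xm1).
Hypotheses (ht0 : 0 < t0) (hD0 : desch_schappacher j Tm1 t0 D0).

Notation AD c := (perturbed_generator j Tm1 (fun x => c *: D0 x)).

(** One real l works for all c in [0, 1/4], so resolvents for different c can be
    compared at the same point. *)
Lemma perturbed_semigroups_resolvents : exists (l L C : R)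
    (S : R -> R -> X -> X) (Rl : R -> Xm1 -> X),
  0 <= l /\ 1 <= L /\ 0 <= C /\ forall c, 0 <= c <= / 4 ->
    generates (AD c) (S c) /\
    (forall t x, 0 <= t <= t0 -> norm (S c t x) <= L * norm x /\
       norm (S c t x [-] S 0 t x) <= L * c * norm x) /\
    is_linear (Rl c) /\
    (forall y : X, AD c (Rl c (j y)) (l *: Rl c (j y) [-] y)) /\
    (forall x y : X, AD c x (l *: x [-] y) -> x = Rl c (j y)) /\
    forall v, norm (Rl c v) <= C * norm v /\
      norm (Rl c v [-] Rl 0 v) <= C * c * norm v.
Proof.
destruct (sg_bound T (base_C0 hA) t0) as [M [hM1 hM]]; [lra |].
assert (hM0 : 0 < M) by lra.
(* With exp (8 M) >= 8 M this gives exp (- l t0) * 2 M <= 1/4. *)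
set (l := 8 * M / t0).
assert (hl : 0 <= l) by (apply Rdiv_le_0_compat; lra).
assert (hlM : exp (- l * t0) * (2 * M) <= / 4).
{ replace (- l * t0) with (- (8 * M)) by (unfold l; field; lra).
  rewrite exp_Ropp.
  assert (he := exp_ineq1_le (8 * M)).
  assert (/ exp (8 * M) <= / (8 * M)) by (apply Rinv_le_contravar; lra).
  apply Rle_trans with (/ (8 * M) * (2 * M)).
    apply Rmult_le_compat_r; lra.
  right; field; lra. }
destruct (choice (fun c S => 0 <= c <= / 4 -> C0_semigroup S /\
    is_volterra j Tm1 t0 (fun x => c *: D0 x) S (fun t x => S t x [-] T t x) /\
    forall t x, 0 <= t <= t0 -> norm (S t x) <= 2 * M * norm x /\
      norm (S t x [-] T t x) <= 2 * M * c * norm x)) as [S hS].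
{ intros c; destruct (classic (0 <= c <= / 4)) as [hc | hc]; [| exists T; easy].
  destruct (perturbed_semigroup hA hj hTm1 t0 D0 ht0 hD0 c M ltac:(lra) hM0 hM)
    as [S hS]; exists S; auto. }
assert (hgen : forall c, 0 <= c <= / 4 -> generates (AD c) (S c)).
{ intros c hc; destruct (hS c hc) as [h1 [h2 h3]].
  apply (perturbed_generates hA hj hTm1 t0 D0 ht0 hD0 M l); try easy.
  intros x; apply h3; lra. }
destruct (perturbed_resolvent_bound hA hj hTm1 t0 D0 ht0 hD0 M l hM hl hlM)
  as [C [hC0 [hC hC']]].
assert (huniq := perturbed_resolvent_unique hA hj hTm1 t0 D0 ht0 hD0 M l hM hl hlM).
assert (hex : exists R1 : R -> X -> X, forall c y, 0 <= c <= / 4 ->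
    AD c (R1 c y) (l *: R1 c y [-] y)).
{ destruct (choice (fun (p : R * X) (x : X) => 0 <= fst p <= / 4 ->
      AD (fst p) x (l *: x [-] snd p))) as [R1 hR1].
  { intros [c y]; simpl.
    destruct (classic (0 <= c <= / 4)) as [hc | hc]; [| exists y; easy].
    destruct (hS c hc) as [h1 [h2 h3]].
    destruct (generator_range (S c) l t0 (2 * M) h1 ltac:(lra)
      (fun x => proj1 (h3 t0 x ltac:(lra))) ltac:(lra) y) as [x hx].
    exists x; intros _; apply (hgen c hc), hx. }
  exists (fun c y => R1 (c, y)); intros c y hc; apply (hR1 (c, y)), hc. }
destruct hex as [R1 hR1].
destruct (choice (fun c (Q : Xm1 -> X) => 0 <= c <= / 4 ->
    is_linear Q /\ (forall y, Q (j y) = R1 c y) /\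
    forall v, norm (Q v) <= C * norm v)) as [Rl hRl].
{ intros c; destruct (classic (0 <= c <= / 4)) as [hc | hc];
    [| exists (fun _ => [0]); easy].
  destruct (dense_extension j (j_linear hj) (j_dense hj) (fun y => R1 c y) C)
    as [Q hQ]; [| easy | | exists Q; auto].
  - assert (hb : forall y, norm (R1 c y) <= C * norm (j y)).
      intros y; apply (hC c); [easy | apply hR1, hc].
    destruct (lin_bound _ (j_linear hj)) as [Cj [_ hCj]].
    assert (hgc := hgen c hc).
    assert (lin := sg_linear (S c) (proj1 hgc)).
    apply is_linear_of_bound with (C * Cj).
    + intros y z; symmetry; apply (huniq c _ _ (y [+] z) hc); [| apply hR1, hc].
      assert (hg := fun u => proj1 (proj2 hgc _ _) (hR1 c u hc)).
      assert (h := generator_minus (S c) lin _ _ _ _ (hg y)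
        (generator_rs (S c) lin (-1) _ _ (hg z))).
      replace (R1 c y [-] (-1) *: R1 c z) with (R1 c y [+] R1 c z) in h
        by vring.
      replace (l *: R1 c y [-] y [-] (-1) *: (l *: R1 c z [-] z)) with
        (l *: (R1 c y [+] R1 c z) [-] (y [+] z)) in h by vring.
      apply hgc, h.
    + intros a y; symmetry; apply (huniq c _ _ (a **: y) hc); [| apply hR1, hc].
      apply hgc.
      assert (hg := proj1 (proj2 hgc _ _) (hR1 c y hc)).
      apply generator_iff in hg; apply generator_iff.
      assert (ha := is_linear_scale (V := X) a).
      replace (l *: (a **: R1 c y) [-] a **: y) with
        (a **: (l *: R1 c y [-] y))
        by (rewrite (lin_minus _ ha), (lin_scal _ ha); reflexivity).
      apply right_limit_ext with (delta := 1) (3 := right_limit_linear _ _ _ ha hg);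
        [lra |].
      intros h hh.
      rewrite (lin_scal _ ha), (lin_minus _ ha), (lin_scal _ (lin h ltac:(lra))).
      reflexivity.
    + intros y; apply Rle_trans with (1 := hb y); rewrite Rmult_assoc.
      apply Rmult_le_compat_l; auto.
  - intros y; apply (hC c); [easy | apply hR1, hc]. }
assert (h00 : 0 <= 0 <= / 4) by lra.
exists l, (2 * M), C, S, Rl; split; [easy |]; split; [lra |]; split; [easy |].
intros c hc.
destruct (hS c hc) as [_ [_ hb]], (hS 0 h00) as [_ [_ hb0]].
destruct (hRl c hc) as [hlin [hj1 hn]], (hRl 0 h00) as [hlin0 [hj0 _]].
split; [apply hgen, hc |]; split; [| split; [exact hlin | split; [| split]]].
- intros t x ht; split; [apply hb, ht |].
  replace (S c t x [-] S 0 t x) with ((S c t x [-] T t x) [-] (S 0 t x [-] T t x))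
    by vring.
  apply Rle_trans with (1 := norm_minus_le _ _).
  assert (e := proj2 (hb t x ht)); assert (e0 := proj2 (hb0 t x ht)); lra.
- intros y; rewrite hj1; apply hR1, hc.
- intros x y hx; rewrite hj1; apply (huniq c _ _ y hc hx), hR1, hc.
- intros v; split; [apply hn |]; revert v.
  apply (dense_bound j (j_dense hj) (fun v => Rl c v [-] Rl 0 v)).
    apply is_linear_minus; easy.
  intros y; rewrite hj1, hj0.
  apply (hC' c); [easy | apply hR1, hc | apply hR1, h00].
Qed.

End PerturbedFamily.

(** * Extrapolated perturbed semigroups and input maps *)

Section PerturbedObjects.
Context {k : scalar_kind} {X Xm1 : CompleteNormedModule (scalars k)}
  {A : X -> X -> Prop} {T : R -> X -> X} {j : X -> Xm1} {Tm1 : R -> Xm1 -> Xm1}.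
Hypotheses (hA : generates A T) (hj : is_extrapolation_space A j)
  (hTm1 : is_extension j T Tm1).

Section OnePerturbation.
Variables (D : X -> Xm1) (S : R -> X -> X) (Rl : Xm1 -> X) (l C : R).
Hypotheses (hD : is_linear D) (hl : 0 <= l) (hC : 0 <= C)
  (hgen : generates (perturbed_generator j Tm1 D) S)
  (hRl : is_linear Rl) (hRlC : forall v, norm (Rl v) <= C * norm v)
  (hRl1 : forall y : X,
     perturbed_generator j Tm1 D (Rl (j y)) (l *: Rl (j y) [-] y))
  (hRl2 : forall x y : X,
     perturbed_generator j Tm1 D x (l *: x [-] y) -> x = Rl (j y)).

Let hS : C0_semigroup S := proj1 hgen.

(** The norm of j y is equivalent to that of the perturbed resolvent of y, and the
    perturbed resolvent commutes with the perturbed semigroup. *)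
Lemma perturbed_extrapolation_bound b : 0 <= b ->
  exists M, forall t x, 0 <= t <= b -> norm (j (S t x)) <= M * norm (j x).
Proof.
intros hb.
destruct (extrapolated_generator_bound hA hj hTm1) as [CE [hCE0 hCE]].
destruct (lin_bound _ hD) as [CD [hCD0 hCD]].
destruct (lin_bound _ (j_linear hj)) as [Cj [hCj0 hCj]].
assert (hlow : forall y, norm (j y) <= (l * Cj + CE + CD) * norm (Rl (j y))).
{ intros y; destruct (hRl1 y) as [w [hw hx]].
  change (w [+] D (Rl (j y)) = j (l *: Rl (j y) [-] y)) in hx.
  rewrite (lin_minus _ (j_linear hj)), (lin_scal _ (j_linear hj)) in hx.
  replace (j y) with (l *: j (Rl (j y)) [-] w [-] D (Rl (j y))) at 1.
  2:{ replace (l *: j (Rl (j y)) [-] w [-] D (Rl (j y))) with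
        (l *: j (Rl (j y)) [-] (w [+] D (Rl (j y)))) by vring.
      rewrite hx; vring. }
  apply Rle_trans with (1 := norm_minus_le _ _).
  assert (h1 := norm_minus_le (l *: j (Rl (j y))) w).
  rewrite norm_rs, Rabs_pos_eq in h1 by easy.
  assert (h2 := hCE _ _ hw); assert (h3 := hCD (Rl (j y))).
  assert (l * norm (j (Rl (j y))) <= l * (Cj * norm (Rl (j y))))
    by (apply Rmult_le_compat_l; easy).
  lra. }
destruct (sg_bound S hS b hb) as [M [hM1 hM]].
set (C2 := l * Cj + CE + CD) in *.
assert (hC2 : 0 <= C2).
  unfold C2; pose proof (Rmult_le_pos _ _ hl (Rlt_le _ _ hCj0)); lra.
exists (C2 * (M * C)); intros t x ht.
assert (e : S t (Rl (j x)) = Rl (j (S t x))).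
{ apply hRl2, hgen.
  assert (hg := generator_orbit S hS t _ _ (proj1 ht) (proj1 (proj2 hgen _ _) (hRl1 x))).
  rewrite (lin_minus _ (sg_linear S hS t (proj1 ht))),
    (lin_scal _ (sg_linear S hS t (proj1 ht))) in hg; exact hg. }
apply Rle_trans with (1 := hlow _); rewrite <- e.
rewrite !Rmult_assoc; apply Rmult_le_compat_l; [easy |].
apply Rle_trans with (1 := hM _ _ ht); apply Rmult_le_compat_l; [lra | apply hRlC].
Qed.

Lemma perturbed_extension_exists : exists S', is_extension j S S'.
Proof.
destruct (choice (fun t (L : Xm1 -> Xm1) => 0 <= t ->
  is_linear L /\ forall x, L (j x) = j (S t x))) as [S' hS'].
{ intros t; destruct (Rle_dec 0 t) as [ht | ht]; [| exists (fun _ => [0]); easy].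
  destruct (perturbed_extrapolation_bound t ht) as [M hM].
  destruct (dense_extension j (j_linear hj) (j_dense hj) (fun x => j (S t x)) (Rabs M))
    as [L [h1 [h2 _]]]; [| apply Rabs_pos | | exists L; auto].
    apply is_linear_compose; [apply (sg_linear S hS t ht) | apply (j_linear hj)].
  intros x; apply Rle_trans with (1 := hM t x ltac:(lra)).
  apply Rmult_le_compat_r; [apply norm_nonneg | apply Rle_abs]. }
exists S'; intros t ht; apply hS', ht.
Qed.

(** The integral over [0, t] of an orbit of the extended semigroup, written in X:
    v is (l - A_D) x with x = Rl v, and the part A_D x integrates to
    S t x - x. *)
Definition smoothing (t : R) (v : Xm1) : X :=
  l *: sg_int S t (Rl v) [-] S t (Rl v) [+] Rl v.

Lemma smoothing_linear t : 0 <= t -> is_linear (smoothing t).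
Proof.
intros ht; unfold smoothing.
apply is_linear_sum; [| exact hRl]; apply is_linear_minus.
  apply is_linear_rs, (is_linear_compose Rl (sg_int S t)); [exact hRl |].
  apply sg_int_linear; easy.
apply (is_linear_compose Rl (S t)); [exact hRl | apply sg_linear; easy].
Qed.

Lemma smoothing_integral S' t v : is_extension j S S' -> 0 <= t ->
  has_integral (fun s => S' s v) 0 t (j (smoothing t v)).
Proof.
intros hS' ht.
assert (hC0 : C0_semigroup S').
  apply (extension_C0_semigroup j S S' (j_linear hj) (j_dense hj) hS hS').
  apply perturbed_extrapolation_bound.
replace (j (smoothing t v)) with (sg_int S' t v); [apply sg_int_correct; easy |].
revert v; apply (dense_linear_unique j (j_dense hj)).
- apply sg_int_linear; easy.
- apply is_linear_compose; [apply smoothing_linear, ht | apply (j_linear hj)].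
- intros y; apply (integral_unique _ _ _ _ _ (sg_int_correct S' hC0 t (j y) ht)).
  apply integral_ext with (fun s => j (S s y)); [easy | |].
    intros s hs; symmetry; apply hS'; lra.
  apply integral_linear; [apply (j_linear hj) |].
  replace (smoothing t (j y)) with (sg_int S t y); [apply sg_int_correct; easy |].
  assert (h := sg_int_of_generator S hS t _ _ ht (proj1 (proj2 hgen _ _) (hRl1 y))).
  assert (hlin := sg_int_linear S hS t ht).
  rewrite (lin_minus _ hlin), (lin_scal _ hlin) in h.
  unfold smoothing.
  replace (sg_int S t y) with
    (l *: sg_int S t (Rl (j y)) [-] (l *: sg_int S t (Rl (j y)) [-] sg_int S t y))
    by vring.
  rewrite h; vring.
Qed.

Lemma smoothing_bound t K v : 0 <= t -> 0 <= K ->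
  (forall s x, 0 <= s <= t -> norm (S s x) <= K * norm x) ->
  norm (smoothing t v) <= (l * t * K + K + 1) * C * norm v.
Proof.
intros ht hK hb.
assert (h1 := sg_int_norm_le S hS t K (Rl v) ht hb).
assert (h2 := hb t (Rl v) ltac:(lra)); assert (h3 := hRlC v).
unfold smoothing; apply Rle_trans with (1 := norm_plus_le _ _).
assert (h4 := norm_minus_le (l *: sg_int S t (Rl v)) (S t (Rl v))).
rewrite norm_rs, Rabs_pos_eq in h4 by easy.
assert (h5 : l * norm (sg_int S t (Rl v)) <= l * (t * K * norm (Rl v)))
  by (apply Rmult_le_compat_l; easy).
apply Rle_trans with ((l * t * K + K + 1) * norm (Rl v)); [lra |].
rewrite (Rmult_assoc _ C); apply Rmult_le_compat_l; [| easy].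
assert (0 <= l * t * K) by (repeat apply Rmult_le_pos; easy); lra.
Qed.

End OnePerturbation.

Lemma smoothing_difference (S S1 : R -> X -> X) (Rl Rl1 : Xm1 -> X) l C K eps t v :
  C0_semigroup S -> C0_semigroup S1 -> 0 <= l -> 0 <= C -> 0 <= K -> 0 <= t ->
  0 <= eps ->
  (forall s x, 0 <= s <= t -> norm (S s x) <= K * norm x) ->
  (forall s x, 0 <= s <= t -> norm (S s x [-] S1 s x) <= K * eps * norm x) ->
  norm (Rl1 v) <= C * norm v ->
  norm (Rl v [-] Rl1 v) <= C * eps * norm v ->
  norm (smoothing S Rl l t v [-] smoothing S1 Rl1 l t v) <=
    (2 * (l * t * K) + 2 * K + 1) * C * eps * norm v.
Proof.
intros hS hS1 hl hC hK ht he hb hd hR hRd.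
set (x := Rl v) in *; set (x1 := Rl1 v) in *.
assert (hlin := sg_int_linear S hS t ht); assert (hlin' := sg_linear S hS t ht).
unfold smoothing; fold x x1.
replace (l *: sg_int S t x [-] S t x [+] x [-] (l *: sg_int S1 t x1 [-] S1 t x1 [+] x1))
  with (l *: (sg_int S t (x [-] x1) [+] (sg_int S t x1 [-] sg_int S1 t x1)) [-]
        (S t (x [-] x1) [+] (S t x1 [-] S1 t x1)) [+] (x [-] x1))
  by (rewrite (lin_minus _ hlin), (lin_minus _ hlin'); vring).
apply Rle_trans with (1 := norm_plus_le _ _).
match goal with |- norm (?a [-] ?b) + _ <= _ =>
  assert (h1 := norm_minus_le a b) end.
rewrite norm_rs, Rabs_pos_eq in h1 by easy.
assert (h2 := norm_plus_le (sg_int S t (x [-] x1)) (sg_int S t x1 [-] sg_int S1 t x1)).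
assert (h3 := norm_plus_le (S t (x [-] x1)) (S t x1 [-] S1 t x1)).
assert (h4 := sg_int_norm_le S hS t K (x [-] x1) ht hb).
assert (h5 : norm (sg_int S t x1 [-] sg_int S1 t x1) <= t * (K * eps * norm x1)).
  apply sg_int_difference; try easy; intros s hs; apply hd, hs.
assert (h6 := hb t (x [-] x1) ltac:(lra)).
assert (h7 := hd t x1 ltac:(lra)).
set (e := C * eps * norm v) in *.
assert (he1 : eps * norm x1 <= e).
  unfold e; rewrite (Rmult_comm C), Rmult_assoc; apply Rmult_le_compat_l; easy.
assert (hlt : 0 <= l * t * K) by (repeat apply Rmult_le_pos; easy).
assert (i1 : K * norm (x [-] x1) <= K * e) by (apply Rmult_le_compat_l; easy).
assert (i2 : K * (eps * norm x1) <= K * e) by (apply Rmult_le_compat_l; easy).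
assert (i3 : l * t * (K * norm (x [-] x1)) <= l * t * (K * e)).
  apply Rmult_le_compat_l; [apply Rmult_le_pos |]; easy.
assert (i4 : l * t * (K * (eps * norm x1)) <= l * t * (K * e)).
  apply Rmult_le_compat_l; [apply Rmult_le_pos |]; easy.
assert (i5 : l * norm (sg_int S t (x [-] x1) [+] (sg_int S t x1 [-] sg_int S1 t x1)) <=
  l * (t * K * norm (x [-] x1) + t * (K * eps * norm x1))).
  apply Rmult_le_compat_l; [easy | lra].
replace ((2 * (l * t * K) + 2 * K + 1) * C * eps * norm v) with
  ((2 * (l * t * K) + 2 * K + 1) * e) by (unfold e; ring).
lra.
Qed.

Variables (t0 : R) (D0 : X -> Xm1).
Hypotheses (ht0 : 0 < t0) (hD0 : desch_schappacher j Tm1 t0 D0).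

Notation AD c := (perturbed_generator j Tm1 (fun x => c *: D0 x)).

(** What the stability argument uses: up to the sampling time, the semigroup and
    the input map converge in operator norm, linearly in c, as c tends to 0. *)
Lemma perturbed_objects tau : 0 <= tau -> exists (S : R -> R -> X -> X)
    (S' : R -> R -> Xm1 -> Xm1) (I : R -> R -> Xm1 -> X) (K : R),
  0 <= K /\ forall c, 0 <= c <= / 4 ->
    generates (AD c) (S c) /\ is_extension j (S c) (S' c) /\
    (forall t v, 0 <= t -> has_integral (fun s => S' c s v) 0 t (j (I c t v))) /\
    (forall t, 0 <= t -> is_linear (I c t)) /\
    forall t, 0 <= t <= tau ->
      (forall x, norm (S c t x) <= K * norm x /\
         norm (S c t x [-] S 0 t x) <= K * c * norm x) /\
      (forall v, norm (I c t v) <= K * norm v /\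
         norm (I c t v [-] I 0 t v) <= K * c * norm v).
Proof.
intros htau.
destruct (perturbed_semigroups_resolvents hA hj hTm1 t0 D0 ht0 hD0)
  as [l [L [C [S [Rl [hl [hL [hC hall]]]]]]]].
assert (hDc : forall c, is_linear (fun x => c *: D0 x))
  by (intros; apply is_linear_rs, (ds_linear t0 D0 hD0)).
destruct (choice (fun c S' => 0 <= c <= / 4 -> is_extension j (S c) S')) as [S' hS'].
{ intros c; destruct (classic (0 <= c <= / 4)) as [hc | hc]; [| exists Tm1; easy].
  destruct (hall c hc) as [h1 [h2 [h3 [h4 [h5 h6]]]]].
  destruct (perturbed_extension_exists (fun x => c *: D0 x) (S c) (Rl c) l C)
    as [S' hS']; try easy; [apply h6 | exists S'; auto]. }
(* Estimates on [0, t0] are carried to [0, tau] by n-th powers. *)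
destruct (enough_steps t0 ht0 tau) as [n [hn htn]].
assert (hn' := lt_0_INR n hn).
assert (hLn : 1 <= L ^ n) by (apply pow_R1_Rle, hL).
set (K := INR n * L ^ n * L + L ^ n).
assert (hK1 : 0 <= INR n * L ^ n * L) by (repeat apply Rmult_le_pos; lra).
assert (h00 : 0 <= 0 <= / 4) by lra.
assert (htime : forall c t, 0 <= c <= / 4 -> 0 <= t <= tau -> forall x,
    norm (S c t x) <= K * norm x /\ norm (S c t x [-] S 0 t x) <= K * c * norm x).
{ intros c t hc ht x.
  destruct (hall c hc) as [h1 [h2 _]], (hall 0 h00) as [h1' [h2' _]].
  assert (hh := div_steps t0 n t (proj1 ht) hn ltac:(lra)).
  replace t with (INR n * (t / INR n)) by (field; lra).
  set (h := t / INR n) in *.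
  pose proof (norm_nonneg x); split.
  - apply Rle_trans with (L ^ n * norm x).
      apply sg_power_bound; [apply h1 | easy | lra |]; intros; apply h2, hh.
    apply Rmult_le_compat_r; [easy | unfold K; lra].
  - apply Rle_trans with (INR n * L ^ n * (L * c) * norm x).
      apply sg_power_difference; try easy; [apply h1 | apply h1' | nra | | |];
        intros; try apply h2, hh; apply h2', hh.
    apply Rmult_le_compat_r; [easy |].
    rewrite <- Rmult_assoc; apply Rmult_le_compat_r; [easy | unfold K; lra]. }
set (K2 := (2 * (l * tau * K) + 2 * K + 1) * C).
assert (hK : 0 <= K) by (unfold K; lra).
assert (hlt : 0 <= l * tau * K) by (repeat apply Rmult_le_pos; easy).
assert (hK2 : 0 <= K2) by (apply Rmult_le_pos; lra).
exists S, S', (fun c => smoothing (S c) (Rl c) l), (K + K2); split; [lra |].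
intros c hc.
destruct (hall c hc) as [h1 [h2 [h3 [h4 [h5 h6]]]]].
destruct (hall 0 h00) as [h1' [_ [_ [_ [_ h6']]]]].
split; [exact h1 |]; split; [apply hS', hc |]; split; [| split].
- intros t v ht.
  apply (smoothing_integral (fun x => c *: D0 x) (S c) (Rl c) l C); try easy.
    apply h6.
  apply hS', hc.
- intros t ht; apply (smoothing_linear (fun x => c *: D0 x)); easy.
- intros t ht.
  assert (hsub : l * t * K <= l * tau * K).
    apply Rmult_le_compat_r; [easy |]; apply Rmult_le_compat_l; lra.
  split.
  + intros x; destruct (htime c t hc ht x) as [e1 e2].
    pose proof (norm_nonneg x); pose proof (Rmult_le_pos _ _ hK2 H).
    assert (0 <= K2 * norm x * c) by (apply Rmult_le_pos; easy); lra.
  + intros v; pose proof (norm_nonneg v) as hv.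
    assert (hKv := Rmult_le_pos _ _ hK hv); split.
    * apply Rle_trans with ((l * t * K + K + 1) * C * norm v).
        apply (smoothing_bound (fun x => c *: D0 x)); try easy; [apply h6 |].
        intros s x hs; apply htime; lra || easy.
      apply Rmult_le_compat_r; [easy |].
      apply Rle_trans with K2; [| lra].
      apply Rmult_le_compat_r; lra.
    * apply Rle_trans with ((2 * (l * t * K) + 2 * K + 1) * C * c * norm v).
        apply smoothing_difference; try easy; try (apply h1 || apply h1' || apply h6').
          intros s x hs; apply htime; lra || easy.
        intros s x hs; apply htime; lra || easy.
        apply h6.
      apply Rmult_le_compat_r; [easy |]; apply Rmult_le_compat_r; [easy |].
      apply Rle_trans with K2; [| lra].
      apply Rmult_le_compat_r; lra.
Qed.

End PerturbedObjects.

(** * Sampled-data systems *)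

Lemma exp_mult_nat a n : exp (a * INR n) = exp a ^ n.
Proof.
induction n as [|n IH]; [simpl; rewrite Rmult_0_r; apply exp_0 |].
rewrite S_INR, Rmult_plus_distr_l, Rmult_1_r, exp_plus, IH; simpl; ring.
Qed.

Lemma iter_linear {k : scalar_kind} {V : NormedModule (scalars k)} (L : V -> V) n :
  is_linear L -> is_linear (Nat.iter n L).
Proof.
intros hL; induction n as [|n IH]; [apply is_linear_id |].
apply (is_linear_compose (Nat.iter n L) L); easy.
Qed.

(** The induction on n carries along all powers of L.  Replacing L' y by
    L y + (L' y - L y) inside the m-th power costs a factor a for the first term,
    from the (m + 1)-st power, and M eps for the second, from the case m = 0. *)
Lemma perturbed_iterates {k : scalar_kind} {V : NormedModule (scalars k)}
    (L L' : V -> V) (M a eps : R) :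
  is_linear L -> 0 <= M -> 0 <= a -> 0 <= eps ->
  (forall n x, norm (Nat.iter n L x) <= M * a ^ n * norm x) ->
  (forall x, norm (L' x [-] L x) <= eps * norm x) ->
  forall n m x, norm (Nat.iter m L (Nat.iter n L' x)) <=
    M * a ^ m * (a + M * eps) ^ n * norm x.
Proof.
intros hL hM ha he hp hd; induction n as [|n IH]; intros m x.
  simpl; rewrite Rmult_1_r; apply hp.
set (y := Nat.iter n L' x).
change (Nat.iter (S n) L' x) with (L' y).
replace (Nat.iter m L (L' y)) with
  (Nat.iter (S m) L y [+] Nat.iter m L (L' y [-] L y)).
2:{ rewrite Nat.iter_succ_r, <- (lin_plus _ (iter_linear L m hL)); f_equal; vring. }
apply Rle_trans with (1 := norm_plus_le _ _).
assert (h1 := IH (S m) x); assert (h2 := hp m (L' y [-] L y)).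
assert (h3 := hd y); assert (h4 := IH O x); fold y in h1, h4.
simpl in h4; rewrite Rmult_1_r in h4.
assert (hMa : 0 <= M * a ^ m) by (apply Rmult_le_pos; [easy | apply pow_le, ha]).
assert (h5 : eps * norm y <= eps * (M * (a + M * eps) ^ n * norm x))
  by (apply Rmult_le_compat_l; easy).
assert (h6 : M * a ^ m * norm (L' y [-] L y) <=
  M * a ^ m * (eps * (M * (a + M * eps) ^ n * norm x)))
  by (apply Rmult_le_compat_l; [easy | lra]).
simpl pow in *; lra.
Qed.

Section SampledData.
Context {k : scalar_kind} {X U : CompleteNormedModule (scalars k)}
  (TD : R -> X -> X) (SD : R -> U -> X) (F : X -> U) (tau : R).
Hypothesis htau : 0 < tau.

Definition sampled (t : R) (x : X) : X := TD t x [+] SD t (F x).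

Lemma solution_at_samples x0 x n : is_solution TD SD F tau x0 x ->
  x (INR n * tau) = Nat.iter n (sampled tau) x0.
Proof.
intros [h0 hs]; induction n as [|n IH].
  simpl; rewrite Rmult_0_l; exact h0.
rewrite S_INR; replace ((INR n + 1) * tau) with (INR n * tau + tau) by ring.
rewrite hs, IH by lra; reflexivity.
Qed.

Lemma sampling_interval t : 0 < t ->
  exists n s, 0 < s <= tau /\ t = INR n * tau + s.
Proof.
intros ht.
destruct (INR_unbounded (t / tau)) as [N hN].
assert (h : t <= INR N * tau).
  replace t with (t / tau * tau) by (field; lra).
  apply Rmult_le_compat_r; lra.
clear hN; induction N as [|N IH].
  simpl in h; lra.
destruct (Rle_dec t (INR N * tau)) as [hle | hgt]; [auto |].
rewrite S_INR in h; exists N, (t - INR N * tau); split; [lra | ring].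
Qed.

Lemma sampling_interval_unique n m s r : 0 < s <= tau -> 0 < r <= tau ->
  INR n * tau + s = INR m * tau + r -> n = m.
Proof.
assert (hlt : forall n m s r, 0 < s <= tau -> 0 < r <= tau ->
    INR n * tau + s = INR m * tau + r -> ~ (n < m)%nat).
{ clear n m s r; intros n m s r hs hr e hnm.
  apply le_INR in hnm; rewrite S_INR in hnm.
  assert ((INR n + 1) * tau <= INR m * tau) by (apply Rmult_le_compat_r; lra); lra. }
intros hs hr e.
assert (h1 := hlt n m s r hs hr e); assert (h2 := hlt m n r s hr hs (eq_sym e)); lia.
Qed.

Lemma solution_exists x0 : exists x, is_solution TD SD F tau x0 x.
Proof.
set (y := fun n => Nat.iter n (sampled tau) x0).
destruct (choice (fun t v => (t = 0 -> v = x0) /\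
  forall n s, 0 < s <= tau -> t = INR n * tau + s -> v = sampled s (y n)))
  as [x hx].
{ intros t.
  destruct (classic (exists n s, 0 < s <= tau /\ t = INR n * tau + s))
    as [[n [s [hs ht]]] | hno].
  - exists (sampled s (y n)); split.
      intros h0; pose proof (Rmult_le_pos _ _ (pos_INR n) (Rlt_le _ _ htau)); lra.
    intros m r hr ht'.
    assert (e := sampling_interval_unique n m s r hs hr (eq_trans (eq_sym ht) ht')).
    subst m; replace r with s by lra; reflexivity.
  - exists x0; split; [easy |]; intros n s hs ht; destruct hno; eauto. }
assert (hy : forall n, x (INR n * tau) = y n).
{ intros [|n]; [simpl; rewrite Rmult_0_l; apply hx; reflexivity |].
  apply (proj2 (hx _) n tau); [lra | rewrite S_INR; ring]. }
exists x; split; [apply hx; reflexivity |]; intros n t ht.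
rewrite hy; apply (proj2 (hx _) n t ht); reflexivity.
Qed.

(** The factor exp (om * tau) pays for the time elapsed since the last sample. *)
Lemma solution_decay (M K b om : R) : 0 <= om -> 1 <= M -> 0 <= K ->
  b = exp (- om * tau) ->
  (forall n x, norm (Nat.iter n (sampled tau) x) <= M * b ^ n * norm x) ->
  (forall t x, 0 < t <= tau -> norm (sampled t x) <= K * norm x) ->
  forall x0 x, is_solution TD SD F tau x0 x -> forall t, 0 <= t ->
    norm (x t) <= (1 + K * M * exp (om * tau)) * exp (- om * t) * norm x0.
Proof.
intros hom hM hK hb hn hs x0 x hx t ht.
assert (hKM : 0 <= K * M) by (apply Rmult_le_pos; lra).
assert (hKMe : 0 <= K * M * exp (om * tau))
  by (apply Rmult_le_pos; [easy | left; apply exp_pos]).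
pose proof (norm_nonneg x0) as hx0.
destruct (Req_dec t 0) as [-> | hne].
  rewrite (proj1 hx), Rmult_0_r, exp_0, Rmult_1_r.
  assert (0 <= K * M * exp (om * tau) * norm x0) by (apply Rmult_le_pos; easy); lra.
destruct (sampling_interval t) as [n [s [hs1 ht1]]]; [lra |].
rewrite ht1 at 1; rewrite (proj2 hx n s hs1), (solution_at_samples x0 x n hx).
change (norm (sampled s (Nat.iter n (sampled tau) x0)) <=
  (1 + K * M * exp (om * tau)) * exp (- om * t) * norm x0).
apply Rle_trans with (1 := hs s _ hs1).
apply Rle_trans with (K * (M * b ^ n * norm x0)); [apply Rmult_le_compat_l; auto |].
assert (he : b ^ n <= exp (om * tau) * exp (- om * t)).
{ rewrite hb, <- exp_mult_nat, <- exp_plus.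
  assert (hle : - om * tau * INR n <= om * tau + - om * t).
    assert (om * s <= om * tau) by (apply Rmult_le_compat_l; lra).
    rewrite ht1; lra.
  destruct hle as [hlt | ->]; [left; apply exp_increasing, hlt | right; easy]. }
apply Rle_trans with (K * M * (exp (om * tau) * exp (- om * t)) * norm x0).
  replace (K * (M * b ^ n * norm x0)) with (K * M * b ^ n * norm x0) by ring.
  apply Rmult_le_compat_r; [easy |]; apply Rmult_le_compat_l; easy.
apply Rmult_le_compat_r; [easy |].
pose proof (exp_pos (- om * t)); lra.
Qed.

End SampledData.

Theorem theorem3p1 (k : scalar_kind)
    (X U Xm1 : CompleteNormedModule (scalars k))
    (A : X -> X -> Prop) (T : R -> X -> X)
    (hA : generates A T)
    (j : X -> Xm1) (hj : is_extrapolation_space A j)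
    (Tm1 : R -> Xm1 -> Xm1) (hTm1 : is_extension j T Tm1)
    (tau : R) (htau : 0 < tau)
    (B : U -> Xm1) (hB : is_linear B)
    (F : X -> U) (hF : is_linear F)
    (t0 : R) (ht0 : 0 < t0)
    (D0 : X -> Xm1) (hD0 : desch_schappacher j Tm1 t0 D0)
    (omega : R) (homega : 0 <= omega)
    (hnominal :
       exponentially_stable j Tm1 B F tau (fun _ : X => zero) omega) :
  exists cstar : R, 0 < cstar /\
    forall c : R, 0 <= c <= cstar ->
      exponentially_stable j Tm1 B F tau
        (fun x : X => scal (ofR k c) (D0 x)) omega.
Proof.
destruct hnominal as [_ [TN [TNm1 [SN [hgenN [hextN [hinpN hdecay]]]]]]].
destruct hdecay as [M [om' [hM1 [hom hstab]]]].
destruct (perturbed_objects hA hj hTm1 t0 D0 ht0 hD0 tau (Rlt_le _ _ htau))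
  as [S [S' [Ic [K [hK hall]]]]].
destruct (lin_bound _ hB) as [KB [hKB0 hKB]], (lin_bound _ hF) as [KF [hKF0 hKF]].
assert (hBF : forall x, norm (B (F x)) <= KB * KF * norm x).
{ intros x; apply Rle_trans with (1 := hKB _); rewrite Rmult_assoc.
  apply Rmult_le_compat_l; [lra | apply hKF]. }
assert (hKBF : 0 <= KB * KF) by (apply Rmult_le_pos; lra).
set (E := K + K * (KB * KF)).
assert (hE : 0 <= E) by (pose proof (Rmult_le_pos _ _ hK hKBF); unfold E; lra).
assert (h00 : 0 <= 0 <= / 4) by lra.
set (step := fun c => sampled (S c) (fun t u => Ic c t (B u)) F).
assert (hstep : forall c t x, 0 <= c <= / 4 -> 0 <= t <= tau ->
    norm (step c t x) <= E * norm x /\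
    norm (step c t x [-] step 0 t x) <= E * c * norm x).
{ intros c t x hc ht.
  destruct (hall c hc) as [_ [_ [_ [_ h]]]]; destruct (h t ht) as [h1 h2].
  destruct (h1 x) as [h3 h4]; destruct (h2 (B (F x))) as [h5 h6].
  assert (i : K * norm (B (F x)) <= K * (KB * KF * norm x))
    by (apply Rmult_le_compat_l; auto).
  unfold step, sampled; split.
  - apply Rle_trans with (1 := norm_plus_le _ _); unfold E; lra.
  - match goal with |- norm (plus ?a ?b [-] plus ?a' ?b') <= _ =>
      replace (a [+] b [-] (a' [+] b')) with ((a [-] a') [+] (b [-] b')) by vring end.
    apply Rle_trans with (1 := norm_plus_le _ _).
    assert (c * (K * norm (B (F x))) <= c * (K * (KB * KF * norm x)))
      by (apply Rmult_le_compat_l; easy).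
    unfold E; lra. }
destruct (hall 0 h00) as [hgen0 [hext0 [hinp0 [hlin0 _]]]].
(* The nominal semigroup, its extension and its input map are only given through
   their characteristic properties; these identify them with the ones at c = 0. *)
assert (hA0 : forall x y, perturbed_generator j Tm1 (fun _ => zero) x y ->
    perturbed_generator j Tm1 (fun x => 0 *: D0 x) x y).
{ intros x y [w [hw hx]]; exists w; split; [exact hw |].
  change (w [+] [0] = j y) in hx; change (w [+] 0 *: D0 x = j y).
  rewrite <- hx; vring. }
assert (eT : forall t x, 0 <= t -> TN t x = S 0 t x).
{ intros t x ht; apply generator_determines; [apply hgenN | apply hgen0 | | exact ht].
  intros u v huv; apply hgen0, hA0, hgenN, huv. }
assert (eTm1 : forall t v, 0 <= t -> TNm1 t v = S' 0 t v).
{ intros t v ht; revert v; apply (dense_linear_unique j (j_dense hj)).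
  - apply hextN, ht.
  - apply hext0, ht.
  - intros x; rewrite (proj2 (hextN t ht)), (proj2 (hext0 t ht)), eT by easy; easy. }
assert (eS : forall t u, 0 <= t -> SN t u = Ic 0 t (B u)).
{ intros t u ht; apply (j_injective hA hj).
  apply (integral_unique _ _ _ _ _ (hinpN t u ht)).
  apply integral_ext with (3 := hinp0 t (B u) ht); [easy |].
  intros s hs; symmetry; apply eTm1; lra. }
set (a := exp (- om' * tau)).
assert (ha : 0 < a) by apply exp_pos.
assert (hpow : forall n x, norm (Nat.iter n (step 0 tau) x) <= M * a ^ n * norm x).
{ intros n x.
  destruct (solution_exists TN SN F tau htau x) as [y hy].
  assert (e : forall m, Nat.iter m (sampled TN SN F tau) x = Nat.iter m (step 0 tau) x).
  { induction m as [|m IH]; [reflexivity |].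
    simpl; rewrite IH; unfold step, sampled; rewrite eT, eS by lra; reflexivity. }
  rewrite <- e, <- (solution_at_samples TN SN F tau htau x y n hy).
  unfold a; rewrite <- exp_mult_nat.
  replace (- om' * tau * INR n) with (- om' * (INR n * tau)) by ring.
  apply (hstab x y hy); apply Rmult_le_pos; [apply pos_INR | lra]. }
set (om := (omega + om') / 2).
set (b := exp (- om * tau)).
assert (hab : a < b).
{ apply exp_increasing; unfold om; nra. }
assert (hME : 0 <= M * E) by (apply Rmult_le_pos; lra).
(* Beyond c <= 1/4, the bound makes the rate a + M E c of the iterates at most b. *)
exists (Rmin (/ 4) ((b - a) / (M * E + 1))); split.
  apply Rmin_pos; [lra | apply Rdiv_lt_0_compat; lra].
intros c hc'.
assert (hc : 0 <= c <= / 4).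
  split; [easy | apply Rle_trans with (1 := proj2 hc'), Rmin_l].
assert (hcb : a + M * (E * c) <= b).
{ assert (h : c <= (b - a) / (M * E + 1))
    by apply (Rle_trans _ _ _ (proj2 hc') (Rmin_r _ _)).
  assert ((M * E + 1) * c <= (M * E + 1) * ((b - a) / (M * E + 1)))
    by (apply Rmult_le_compat_l; lra).
  replace ((M * E + 1) * ((b - a) / (M * E + 1))) with (b - a) in H by (field; lra).
  lra. }
destruct (hall c hc) as [hgen [hext [hinp [hlin _]]]].
split.
  exists t0; split; [easy |]; apply (ds_scale hA hj hTm1 t0 D0 hD0 c); lra.
exists (S c), (S' c), (fun t u => Ic c t (B u)).
split; [exact hgen |]; split; [exact hext |]; split; [intros t u; apply hinp |].
exists (1 + E * M * exp (om * tau)), om.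
split; [| split].
- pose proof (Rmult_le_pos _ _ hE (Rle_trans _ _ _ Rle_0_1 hM1)).
  pose proof (Rmult_le_pos _ _ H (Rlt_le _ _ (exp_pos (om * tau)))); lra.
- unfold om; lra.
- apply (solution_decay (S c) _ F tau htau M E b om); try easy.
  + unfold om; lra.
  + intros n x.
    assert (hEc : 0 <= E * c) by (apply Rmult_le_pos; easy).
    assert (hlin' : is_linear (step 0 tau)).
      apply is_linear_sum; [apply (sg_linear (S 0) (proj1 hgen0)); lra |].
      apply (is_linear_compose (fun x => B (F x)) (Ic 0 tau)).
        apply is_linear_compose; easy.
      apply hlin0; lra.
    assert (h := perturbed_iterates (step 0 tau) (step c tau) M a (E * c) hlin'
      ltac:(lra) ltac:(lra) hEc hpow
      (fun x => proj2 (hstep c tau x hc (conj (Rlt_le _ _ htau) (Rle_refl _)))) n O x).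
    simpl in h; rewrite Rmult_1_r in h.
    apply Rle_trans with (1 := h).
    apply Rmult_le_compat_r; [apply norm_nonneg |].
    apply Rmult_le_compat_l; [lra |].
    apply pow_incr; split; [| exact hcb].
    pose proof (Rmult_le_pos _ _ (Rle_trans _ _ _ Rle_0_1 hM1) hEc); lra.
  + intros t x ht; apply (hstep c t x hc); lra.
Qed.
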